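(* On a closed Kähler manifold $(M,g)$ of arbitrary signature, any metric in $[\![g]\!]$ (that is, any metric projectively equivalent to $g$) is affinely equivalent to $g$.
   Context: Manifolds are smooth, connected and of dimension $n\ge2$; closed means compact without boundary. Metrics are pseudo-Riemannian of arbitrary signature. A Kähler manifold of arbitrary signature is a pseudo-Riemannian manifold $(M,g)$ with a complex structure $J$ that is $g$-orthogonal and parallel for the Levi-Civita connection of $g$. Two metrics are projectively equivalent if they have the same geodesics up to reparametrisation, and affinely equivalent if their Levi-Civita connections coincide; $[\![g]\!]$ is the set of all metrics projectively equivalent to $g$.
   Formalization: The manifold is assumed to have real dimension greater than 2 (so at least 4); in real dimension 2 the claim fails, e.g. for the round sphere and its pull-back under x -> Ax/|Ax| with A an invertible matrix that is not a multiple of an orthogonal one. *)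

(* Defs.v *)
From HB Require Import structures.
From mathcomp Require Import all_boot all_order all_algebra.
From mathcomp Require Import all_classical all_reals all_analysis.

Set Implicit Arguments.
Unset Strict Implicit.
Unset Printing Implicit Defensive.

Import Order.TTheory GRing.Theory Num.Theory.
Import numFieldNormedType.Exports.

Local Open Scope classical_set_scope.
Local Open Scope ring_scope.

(* Tangent vectors are row vectors of components, as in the library's
   [jacobian], whose entry (i, k) is the i-th partial derivative of the k-th
   component. *)

Definition partial (R : realType) (n : nat) (W : normedModType R) (i : 'I_n)
    (f : 'rV[R]_n -> W) : 'rV[R]_n -> W :=
  fun x => 'D_(delta_mx 0 i) f x.

Fixpoint times_differentiable_on (R : realType) (n : nat)
    (W : normedModType R) (k : nat) (U : set 'rV[R]_n) (f : 'rV[R]_n -> W) :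
    Prop :=
  if k is k'.+1 then
    (forall x, U x -> differentiable f x) /\
    (forall i, times_differentiable_on k' U (partial i f))
  else True.

Definition smooth_on (R : realType) (n : nat) (W : normedModType R)
    (U : set 'rV[R]_n) (f : 'rV[R]_n -> W) : Prop :=
  forall k, times_differentiable_on k U f.

(* [cmap] and [cinv] are total functions; their values outside [cdom] and
   outside the image of [cdom] carry no information. *)
Record chart (R : realType) (n : nat) (M : topologicalType) := Chart {
  cdom : set M;
  cmap : M -> 'rV[R]_n;
  cinv : 'rV[R]_n -> M;
  cdom_open : open cdom;
  cimg_open : open (cmap @` cdom);
  cmapK : forall p, cdom p -> cinv (cmap p) = p;
  cmap_continuous : forall p, cdom p -> {for p, continuous cmap};
  cinv_continuous : forall x, (cmap @` cdom) x -> {for x, continuous cinv}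
}.

Section Manifolds.
Variables (R : realType) (n : nat) (M : topologicalType).
Implicit Types (c d : chart R n M) (A : set (chart R n M)).

Definition cimg c : set 'rV[R]_n := cmap c @` cdom c.

Definition overlap c d : set 'rV[R]_n := cmap c @` (cdom c `&` cdom d).

Definition transition c d : 'rV[R]_n -> 'rV[R]_n := cmap d \o cinv c.

Definition compatible c d : Prop :=
  smooth_on (overlap c d) (transition c d) /\
  smooth_on (overlap d c) (transition d c).

(* A smooth structure is a maximal atlas. *)
Definition smooth_structure A : Prop :=
  [/\ forall p : M, exists2 c, A c & cdom c p,
      forall c d, A c -> A d -> compatible c d &
      forall c, (forall d, A d -> compatible c d) -> A c].

(* Charts take values in R^n, so there is no boundary. *)
Definition closed_connected_manifold A : Prop :=
  [/\ hausdorff_space M, @second_countable M, connected [set: M],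
      compact [set: M] & smooth_structure A].

(* A tensor field with two indices is the family of its component matrices in
   the charts of the atlas; only the values of [T c] on [cimg c] matter. *)
Definition tensor2 := chart R n M -> 'rV[R]_n -> 'M[R]_n.
Implicit Types (g h J : tensor2).

Definition smooth_tensor A (T : tensor2) : Prop :=
  forall c, A c -> smooth_on (cimg c) (T c).

Definition covariant A g : Prop :=
  forall c d, A c -> A d -> forall x, overlap c d x ->
    let P := jacobian (transition c d) x in
    g c x = P *m g d (transition c d x) *m P^T.

(* The (j, k) entry of [J c x] is J^k_j: the endomorphism is v |-> v *m J. *)
Definition endomorphism A J : Prop :=
  forall c d, A c -> A d -> forall x, overlap c d x ->
    let P := jacobian (transition c d) x in
    J c x *m P = P *m J d (transition c d x).

Definition pseudo_riemannian_metric A g : Prop :=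
  [/\ smooth_tensor A g, covariant A g &
      forall c, A c -> forall x, cimg c x ->
        (g c x)^T = g c x /\ g c x \in unitmx].

(* Components Gamma_{ij}^k of the Levi-Civita connection, where [G] gives the
   components of the metric in a chart. *)
Definition christoffel (G : 'rV[R]_n -> 'M[R]_n) (x : 'rV[R]_n)
    (i j k : 'I_n) : R :=
  2^-1 * \sum_(l < n)
    (partial i (fun y => G y j l) x + partial j (fun y => G y i l) x
     - partial l (fun y => G y i j) x) * invmx (G x) l k.

Definition almost_complex_structure A J : Prop :=
  [/\ smooth_tensor A J, endomorphism A J &
      forall c, A c -> forall x, cimg c x -> J c x *m J c x = - 1%:M].

(* [J] comes from a holomorphic atlas iff around each point there are
   coordinates in which its components are constant: a constant matrix of
   square -1 is the standard one up to a linear change of coordinates. *)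
Definition complex_structure A J : Prop :=
  almost_complex_structure A J /\
  forall p : M, exists c, [/\ A c, cdom c p &
    exists J0 : 'M[R]_n, forall x, cimg c x -> J c x = J0].

Definition orthogonal_endomorphism A g J : Prop :=
  forall c, A c -> forall x, cimg c x -> J c x *m g c x *m (J c x)^T = g c x.

(* nabla_i J^k_j = 0 *)
Definition parallel_endomorphism A g J : Prop :=
  forall c, A c -> forall x, cimg c x -> forall i j k : 'I_n,
    partial i (fun y => J c y j k) x
    + \sum_(l < n) christoffel (g c) x i l k * J c x j l
    - \sum_(l < n) christoffel (g c) x i j l * J c x l k = 0.

Definition kahler A g J : Prop :=
  [/\ pseudo_riemannian_metric A g, complex_structure A J,
      orthogonal_endomorphism A g J & parallel_endomorphism A g J].

Definition affinely_equivalent A g h : Prop :=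
  forall c, A c -> forall x, cimg c x -> forall i j k : 'I_n,
    christoffel (g c) x i j k = christoffel (h c) x i j k.

Definition open_interval (I : set R) : Prop :=
  [/\ open I, is_interval I & I !=set0].

(* An affinely parametrised geodesic on the open interval [I]. Twice
   differentiable solutions of the geodesic equation are smooth. *)
Definition geodesic A g (I : set R) (gam : R -> M) : Prop :=
  forall t, I t -> {for t, continuous gam} /\
    forall c, A c -> cdom c (gam t) ->
      let y : R -> 'rV[R]_n := cmap c \o gam in
      [/\ derivable y t 1, derivable (derive1 y) t 1 &
          forall k : 'I_n,
            derive1 (derive1 y) t 0 k
            + \sum_(i < n) \sum_(j < n)
                christoffel (g c) (y t) i j k * derive1 y t 0 i * derive1 y t 0 j
            = 0].

Definition reparametrisation (I' I : set R) (phi : R -> R) : Prop :=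
  [/\ phi @` I' = I,
      forall (k : nat) t, I' t -> derivable (derive1n k phi) t 1 &
      forall t, I' t -> derive1 phi t != 0].

(* The interval [I'] may be unbounded even when [I] is bounded, and
   conversely. *)
Definition geodesics_reparametrise A g h : Prop :=
  forall (I : set R) (gam : R -> M), open_interval I -> geodesic A g I gam ->
    exists (I' : set R) (phi : R -> R),
      [/\ open_interval I', reparametrisation I' I phi &
          geodesic A h I' (gam \o phi)].

Definition projectively_equivalent A g h : Prop :=
  geodesics_reparametrise A g h /\ geodesics_reparametrise A h g.

Definition projective_class A g : set tensor2 :=
  [set h | pseudo_riemannian_metric A h /\ projectively_equivalent A g h].

End Manifolds.

(* Main.v *)
Require Import Defs.
From HB Require Import structures.
From mathcomp Require Import all_boot all_order all_algebra.
From mathcomp Require Import all_classical all_reals all_analysis.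
From mathcomp Require Import perm ring lra.

Set Implicit Arguments.
Unset Strict Implicit.
Unset Printing Implicit Defensive.

Import Order.TTheory GRing.Theory Num.Theory.
Import numFieldNormedType.Exports.

Local Open Scope classical_set_scope.
Local Open Scope ring_scope.

(* If g and h have the same geodesics up to parametrisation, the difference T of
   their connections satisfies T(v, v) // v for every v, because a g-geodesic
   starts in every direction; hence T_ij^k = psi_i delta_j^k + psi_j delta_i^k.
   A suitable multiple b = e^{2 phi} h^{-1} then satisfies
   nabla_k b^ij = lambda^i delta_k^j + lambda^j delta_k^i with
   lambda^i = - psi_j b^ji, and d(tr_g b / 2) is g(lambda, .).
   On a Kaehler manifold the curvature is J-invariant in its first two indices.
   Applied to b, and with n > 2, this forces nabla lambda = mu Id, and applied to
   lambda it forces mu to be constant.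
   At the extrema of f = tr_g b / 2 on the closed manifold lambda vanishes. If mu
   is not 0, then g(lambda, lambda) - 2 mu f is constant, so max f = min f; if
   mu = 0, then lambda is parallel and {f = max f} is open and closed. In both
   cases f is constant, so lambda = 0 and psi = 0. *)

(** * Smooth functions *)

(** Signature: [g] is indefinite, so g(lambda, lambda) = 0 does not give lambda = 0. Only the
    converse is used: lambda vanishes at the extrema of f because they are critical points, and
    g(lambda, lambda) vanishes with it. The weight: the trace of T_i is (n + 1) psi_i, and tr
    Gamma_i is the derivative of ln |det g| / 2. Hence psi = d phi with e^{2 phi} = |det h / det
    g|^{1/(n+1)}, a function on the whole manifold since both determinants change by the same
    factor. Determinants are squared throughout because their sign depends on the signature.
    Dimension: the J-invariance of the curvature is exploited by contractions, which end in n (n -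
    2) N = (n - 2) tr N Id for N = nabla lambda and in (n - 2) d mu = 0. In dimension 2 the
    conclusion fails: the round sphere is Kähler, and linear maps of R^3 induce projectively
    equivalent metrics that are not affinely equivalent to it. Complex structure: in a holomorphic
    chart J is a constant matrix, so nabla J = 0 becomes the commutation of J with the Christoffel
    matrices. Geodesics: their existence in every direction is a local existence theorem for
    differential equations, proved here by Picard iteration. *)

Lemma near_eq_differentiable (R : realType) (V W : normedModType R)
    (f g : V -> W) (x : V) :
  (\near x, f x = g x) -> differentiable f x -> differentiable g x.
Proof.
move=> fg df.
have [cdf /eqaddoP dfx] := (diff_locallyP _ _).1 df.
have fgx : f x = g x by exact: nbhs_singleton fg.
have gx : g \o shift x = cst (g x) + 'd f x +o_ (0 : V) id.
  have fg0 : \forall h \near (0 : V), f (h + x) = g (h + x).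
    by have := fg; rewrite (near_shift 0 x) /= subr0.
  apply/eqaddoP => e e0; have dfe := dfx e e0.
  apply: filterS2 fg0 dfe => h fgh.
  rewrite -![(_ - _ : _ -> _) _]/(_ - _) -![(_ + _ : _ -> _) _]/(_ + _) /=.
  by rewrite fgh fgx.
have dd : 'd g x = 'd f x :> (V -> W) by apply: diff_unique.
by apply/diff_locallyP; rewrite dd.
Qed.

Section ScalarCalculus.
Context {R : realType} {n : nat}.
Implicit Types (U : set 'rV[R]_n) (f g : 'rV[R]_n -> R) (x : 'rV[R]_n).

Lemma times_differentiable_eq (W : normedModType R) k U (f g : 'rV[R]_n -> W) :
  open U -> (forall x, U x -> f x = g x) ->
  times_differentiable_on k U f -> times_differentiable_on k U g.
Proof.
move=> oU; elim: k f g => //= k IH f g fg [df pf]; split.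
  move=> x Ux; apply: near_eq_differentiable (df x Ux).
  by apply: filterS fg _; exact: open_nbhs_nbhs.
move=> i; apply: IH (pf i) => x Ux; apply: near_eq_derive.
by apply: filterS fg _; exact: open_nbhs_nbhs.
Qed.

Lemma times_differentiable_le (W : normedModType R) k U (f : 'rV[R]_n -> W) :
  times_differentiable_on k.+1 U f -> times_differentiable_on k U f.
Proof.
elim: k f => //= k IH f [df pf]; split=> // i.
by apply: IH; have [] := pf i.
Qed.

Lemma times_differentiable_cst (W : normedModType R) k U (c : W) :
  times_differentiable_on k U (cst c).
Proof.
elim: k c => //= k IH c; split=> [x _|i]; first exact: differentiable_cst.
have -> : partial i (cst c : 'rV[R]_n -> W) = cst 0.
  by apply/funext => x; rewrite /partial derive_cst.
exact: IH.
Qed.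

Lemma partialD f g x i : differentiable f x -> differentiable g x ->
  partial i (fun y => f y + g y) x = partial i f x + partial i g x.
Proof. by move=> df dg; rewrite /partial; apply: deriveD; apply: diff_derivable. Qed.

Lemma partialN f x i : differentiable f x ->
  partial i (fun y => - f y) x = - partial i f x.
Proof. by move=> df; rewrite /partial; apply: deriveN; apply: diff_derivable. Qed.

Lemma partialM f g x i : differentiable f x -> differentiable g x ->
  partial i (fun y => f y * g y) x = partial i f x * g x + f x * partial i g x.
Proof.
move=> df dg; rewrite /partial.
have -> := @deriveM _ _ f g x (delta_mx 0 i) (diff_derivable df) (diff_derivable dg).
by rewrite addrC mulrC [X in _ + X]mulrC [X in X + _]mulrC /GRing.scale /= [X in _ + X]mulrC.
Qed.


Lemma times_differentiableD k U f g :
  times_differentiable_on k U f -> times_differentiable_on k U g ->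
  open U -> times_differentiable_on k U (fun y => f y + g y).
Proof.
move=> + + oU; elim: k f g => //= k IH f g [df pf] [dg pg]; split.
  by move=> x Ux; apply: differentiableD; [exact: df|exact: dg].
move=> i; apply: (times_differentiable_eq oU _ (IH _ _ (pf i) (pg i))) => x Ux.
by rewrite partialD//; [exact: df|exact: dg].
Qed.

Lemma times_differentiableM k U f g :
  times_differentiable_on k U f -> times_differentiable_on k U g ->
  open U -> times_differentiable_on k U (fun y => f y * g y).
Proof.
move=> + + oU; elim: k f g => //= k IH f g [df pf] [dg pg]; split.
  by move=> x Ux; apply: differentiableM; [exact: df|exact: dg].
move=> i; have lf : times_differentiable_on k U f by exact: times_differentiable_le.
have lg : times_differentiable_on k U g by exact: times_differentiable_le.
apply: (times_differentiable_eq oU _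
  (times_differentiableD (IH _ _ (pf i) lg) (IH _ _ lf (pg i)) oU)) => x Ux.
by rewrite partialM//; [exact: df|exact: dg].
Qed.

Lemma times_differentiableN k U f : times_differentiable_on k U f ->
  open U -> times_differentiable_on k U (fun y => - f y).
Proof.
move=> df oU; apply: (times_differentiable_eq oU _
  (times_differentiableM (times_differentiable_cst k U (-1 : R)) df oU)) => x _.
by rewrite /cst /= mulN1r.
Qed.

Lemma partialV f x i : differentiable f x -> f x != 0 ->
  partial i (fun y => (f y)^-1) x = - partial i f x * (f x)^-1 * (f x)^-1.
Proof.
move=> df f0; rewrite /partial.
have -> := @deriveV _ _ f x (delta_mx 0 i) f0 (diff_derivable df).
by rewrite /GRing.scale /= expr2 invfM; ring.
Qed.

Lemma times_differentiableV k U f : times_differentiable_on k U f -> (forall x, U x -> f x != 0) ->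
  open U -> times_differentiable_on k U (fun y => (f y)^-1).
Proof.
move=> + f0 oU; elim: k f f0 => //= k IH f f0 [df pf]; split.
  by move=> x Ux; apply: differentiableV; [exact: df|exact: f0].
move=> i; have lf : times_differentiable_on k U f by exact: times_differentiable_le.
have lv := IH _ f0 lf.
apply: (times_differentiable_eq oU _
  (times_differentiableM (times_differentiableM (times_differentiableN (pf i) oU) lv oU) lv oU)) => x Ux.
by rewrite partialV//; [exact: df|exact: f0].
Qed.

Lemma differentiable_comp1 (phi : R -> R) f x : differentiable f x ->
  derivable phi (f x) 1 -> differentiable (fun y => phi (f y)) x.
Proof. by move=> df /derivable1_diffP dp; exact: differentiable_comp. Qed.

Lemma partial_comp1 (phi : R -> R) f x i : differentiable f x ->
  derivable phi (f x) 1 ->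
  partial i (fun y => phi (f y)) x = derive1 phi (f x) * partial i f x.
Proof.
move=> df dphi; have /derivable1_diffP dp := dphi.
rewrite /partial !deriveE//; last exact: differentiable_comp.
by rewrite (@diff_comp _ _ _ _ f phi) //= (diff1E dp) /=; exact: mulrC.
Qed.

Lemma times_differentiable_expR k U f : times_differentiable_on k U f -> open U ->
  times_differentiable_on k U (fun y => expR (f y)).
Proof.
move=> + oU; elim: k => //= k IH [df pf]; split=> [x Ux|i].
  exact/differentiable_comp1/derivable_expR/df.
have lf : times_differentiable_on k U f by exact: times_differentiable_le.
apply: (times_differentiable_eq oU _
  (times_differentiableM (IH lf) (pf i) oU)) => x Ux.
by rewrite (partial_comp1 i (df _ Ux) (@derivable_expR R (f x))) derive1E derive_val.
Qed.

Lemma times_differentiable_ln k U f : times_differentiable_on k U f -> (forall x, U x -> 0 < f x) ->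
  open U -> times_differentiable_on k U (fun y => ln (f y)).
Proof.
(* A case analysis suffices: the partial derivatives of [ln f] are [f^-1 * partial i f], in which
   [ln] no longer occurs. *)
move=> + f0 oU; case: k => //= k [df pf]; split=> [x Ux|i].
  by apply: differentiable_comp1; [exact: df|apply: ex_derive; exact/is_derive1_ln/f0].
have lf : times_differentiable_on k U f by exact: times_differentiable_le.
have fn x : U x -> f x != 0 by move=> /f0 /lt0r_neq0.
apply: (times_differentiable_eq oU _
  (times_differentiableM (times_differentiableV lf fn oU) (pf i) oU)) => x Ux.
have dl := is_derive1_ln (f0 _ Ux).
rewrite (partial_comp1 _ (df _ Ux)); last exact: ex_derive.
by rewrite derive1E derive_val.
Qed.

End ScalarCalculus.

Section SmoothScalar.
Context {R : realType} {n : nat}.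
Implicit Types (U : set 'rV[R]_n) (f g : 'rV[R]_n -> R) (x : 'rV[R]_n).

Lemma smooth_differentiable U (W : normedModType R) (f : 'rV[R]_n -> W) x :
  smooth_on U f -> U x -> differentiable f x.
Proof. by move=> /(_ 1%N)[df _] /df. Qed.

Lemma smooth_partial U (W : normedModType R) (f : 'rV[R]_n -> W) i :
  smooth_on U f -> smooth_on U (partial i f).
Proof. by move=> sf k; case: (sf k.+1) => _; exact. Qed.

Lemma smooth_eq U (W : normedModType R) (f g : 'rV[R]_n -> W) : open U ->
  (forall x, U x -> f x = g x) -> smooth_on U f -> smooth_on U g.
Proof. by move=> oU fg sf k; exact: times_differentiable_eq oU fg (sf k). Qed.

Lemma smooth_cst U (c : R) : smooth_on U (fun=> c).
Proof. by move=> k; exact: times_differentiable_cst. Qed.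

Lemma smoothD U f g : open U -> smooth_on U f -> smooth_on U g ->
  smooth_on U (fun y => f y + g y).
Proof. by move=> oU sf sg k; exact: times_differentiableD. Qed.

Lemma smoothM U f g : open U -> smooth_on U f -> smooth_on U g ->
  smooth_on U (fun y => f y * g y).
Proof. by move=> oU sf sg k; exact: times_differentiableM. Qed.

Lemma smoothN U f : open U -> smooth_on U f -> smooth_on U (fun y => - f y).
Proof. by move=> oU sf k; exact: times_differentiableN. Qed.

Lemma smoothV U f : open U -> smooth_on U f -> (forall x, U x -> f x != 0) ->
  smooth_on U (fun y => (f y)^-1).
Proof. by move=> oU sf f0 k; exact: times_differentiableV. Qed.

Lemma smooth_sum U (I : Type) (r : seq I) (P : pred I) (F : I -> 'rV[R]_n -> R) :
  open U -> (forall i, smooth_on U (F i)) ->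
  smooth_on U (fun y => \sum_(i <- r | P i) F i y).
Proof.
move=> oU sF; elim: r => [|i r IH].
  by under eq_fun do rewrite big_nil; exact: smooth_cst.
under eq_fun do rewrite big_cons; case: (P i) => //; exact: smoothD.
Qed.

Lemma smooth_prod U (I : Type) (r : seq I) (P : pred I) (F : I -> 'rV[R]_n -> R) :
  open U -> (forall i, smooth_on U (F i)) ->
  smooth_on U (fun y => \prod_(i <- r | P i) F i y).
Proof.
move=> oU sF; elim: r => [|i r IH].
  by under eq_fun do rewrite big_nil; exact: smooth_cst.
under eq_fun do rewrite big_cons; case: (P i) => //; exact: smoothM.
Qed.

Lemma partial_eq U (W : normedModType R) (f g : 'rV[R]_n -> W) x i : open U -> U x ->
  (forall y, U y -> f y = g y) -> partial i f x = partial i g x.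
Proof.
move=> oU Ux fg; apply: near_eq_derive; apply: filterS fg _.
exact: open_nbhs_nbhs.
Qed.

Lemma partial_cst (W : normedModType R) (c : W) x i : partial i (fun=> c : W) x = 0.
Proof. by rewrite /partial derive_cst. Qed.

Lemma partial_sum (I : Type) (r : seq I) (P : pred I) (F : I -> 'rV[R]_n -> R) x i :
  (forall j, differentiable (F j) x) ->
  differentiable (fun y => \sum_(j <- r | P j) F j y) x /\
  partial i (fun y => \sum_(j <- r | P j) F j y) x =
  \sum_(j <- r | P j) partial i (F j) x.
Proof.
move=> dF; elim: r => [|j r [IHd IH]].
  have -> : (fun y => \sum_(j <- [::] | P j) F j y) = cst 0.
    by apply/funext => y; rewrite big_nil.
  by rewrite big_nil partial_cst; split=> //; exact: differentiable_cst.
have -> : (fun y => \sum_(k <- j :: r | P k) F k y) =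
   fun y => (if P j then F j y else 0) + \sum_(k <- r | P k) F k y.
  by apply/funext => y; rewrite big_cons; case: (P j); rewrite ?add0r.
rewrite big_cons; case: (P j); split.
- exact: differentiableD.
- by rewrite partialD// IH.
- by under eq_fun do rewrite add0r.
- by rewrite -IH; congr (partial _ _ _); apply/funext => y; rewrite add0r.
Qed.

Lemma diff_row_sum (W : normedModType R) (f : 'rV[R]_n -> W) x v : differentiable f x ->
  'd f x v = \sum_(i < n) v 0 i *: partial i f x.
Proof.
move=> df; rewrite {1}(row_sum_delta v) linear_sum; apply: eq_bigr => i _.
by rewrite linearZ /= /partial deriveE.
Qed.

Lemma times_differentiable_entry k U m p (F : 'rV[R]_n -> 'M[R]_(m, p)) a b :
  open U -> times_differentiable_on k U F ->
  times_differentiable_on k U (fun y => F y a b).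
Proof.
move=> oU; elim: k F => //= k IH F [dF pF]; split.
  move=> x Ux; have := dF x Ux => dFx.
  apply: (@differentiable_comp _ _ _ _ F (fun N : 'M[R]_(m, p) => N a b)) => //.
  exact: differentiable_coord.
move=> i; apply: (times_differentiable_eq oU _ (IH _ (pF i))) => x Ux.
by rewrite /partial derive_mx ?mxE//; exact/diff_derivable/dF.
Qed.

Lemma partial_entry m p (F : 'rV[R]_n -> 'M[R]_(m, p)) a b x i :
  differentiable F x -> partial i F x a b = partial i (fun y => F y a b) x.
Proof. by move=> dF; rewrite /partial derive_mx ?mxE//; exact/diff_derivable. Qed.

Lemma smooth_entry U m p (F : 'rV[R]_n -> 'M[R]_(m, p)) a b : open U -> smooth_on U F ->
  smooth_on U (fun y => F y a b).
Proof. by move=> oU sF k; exact: times_differentiable_entry. Qed.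

Lemma differentiable_entry m p (F : 'rV[R]_n -> 'M[R]_(m, p)) a b x :
  differentiable F x -> differentiable (fun y => F y a b) x.
Proof.
move=> dF; apply: (@differentiable_comp _ _ _ _ F (fun N : 'M[R]_(m, p) => N a b)) => //.
exact: differentiable_coord.
Qed.

Lemma jacobian_entry m (F : 'rV[R]_n -> 'rV[R]_m) x i a : differentiable F x ->
  jacobian F x i a = partial i (fun y => F y 0 a) x.
Proof. by move=> dF; rewrite -partial_entry// /partial deriveE// /jacobian mxE. Qed.

Lemma partial_comp m (F : 'rV[R]_n -> 'rV[R]_m) (f : 'rV[R]_m -> R) x i :
  differentiable F x -> differentiable f (F x) ->
  differentiable (fun y => f (F y)) x /\
  partial i (fun y => f (F y)) x = \sum_(a < m) jacobian F x i a * partial a f (F x).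
Proof.
move=> dF df; have dc : differentiable (f \o F) x by exact: differentiable_comp.
split=> //; rewrite /partial deriveE// diff_comp//=.
rewrite -['d f _ _]/('d f (F x) ('d F x (delta_mx 0 i))).
rewrite [LHS](_ : _ = \sum_(a < m) ('d F x (delta_mx 0 i)) 0 a * partial a f (F x)).
  by apply: eq_bigr => a _; rewrite /jacobian mxE.
set v := 'd F x _.
rewrite {1}(row_sum_delta v) linear_sum; apply: eq_bigr => a _.
by rewrite linearZ /= /partial deriveE.
Qed.

End SmoothScalar.

(** * Mean value inequality and symmetry of second partial derivatives *)

Lemma dist_quarter (R : realType) (a b c : R) :
  `|b - c| < `|a - b| / 4 -> `|a - c| < `|a - b| / 4 -> false.
Proof.
move=> h1 h2; have := ler_distD c a b.
by move: h1 h2; rewrite (distrC b c); have := normr_ge0 (a - b); lra.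
Qed.

Section MeanValue.
Context {R : realType} {n : nat}.
Implicit Types (U : set 'rV[R]_n) (f g : 'rV[R]_n -> R) (x a v : 'rV[R]_n).

Lemma is_derive_line (W : normedModType R) (f : 'rV[R]_n -> W) a v (s : R) :
  differentiable f (a + s *: v) ->
  is_derive s 1 (fun t : R => f (a + t *: v)) ('D_v f (a + s *: v)).
Proof.
move=> df; have E : (fun h : R => h^-1 *: (((fun t : R => f (a + t *: v)) \o shift s) (h *: 1)
      - f (a + s *: v))) =
    (fun h : R => h^-1 *: ((f \o shift (a + s *: v)) (h *: v) - f (a + s *: v))).
  apply/funext => h /=; congr (_ *: (f _ - _)).
  by rewrite [h%:A]mulr1 scalerDl addrCA.
have dv := diff_derivable df (v := v).
apply: DeriveDef; last by rewrite /derive E.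
by rewrite /derivable E.
Qed.

Lemma MVT_line f a v (t : R) : 0 <= t ->
  (forall s, 0 <= s <= t -> differentiable f (a + s *: v)) ->
  exists2 s, 0 <= s <= t & f (a + t *: v) - f a = t * 'D_v f (a + s *: v).
Proof.
move=> t0 df.
have [||s] := @MVT_segment R (fun s => f (a + s *: v)) (fun s => 'D_v f (a + s *: v)) 0 t t0.
- move=> s /[!in_itv]/= /andP[/ltW s0 /ltW st]; apply: is_derive_line.
  by apply: df; rewrite s0 st.
- apply: derivable_within_continuous => s /[!in_itv]/= s01.
  by have [] := @is_derive_line _ f a v s (df s s01).
rewrite in_itv /= scale0r addr0 subr0 mulrC => ? ?; by exists s.
Qed.

Lemma ball_line x a b (r : R) : ball x r a -> ball x r b ->
  forall s, 0 <= s <= 1 -> ball x r (a + s *: (b - a)).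
Proof.
rewrite -!ball_normE /= => xa xb s /andP[s0 s1].
have -> : x - (a + s *: (b - a)) = (1 - s) *: (x - a) + s *: (x - b).
  rewrite !scalerBr !scalerBl !scale1r; apply/matrixP => i j; rewrite !mxE; ring.
rewrite (le_lt_trans (ler_normD _ _))// !normrZ !ger0_norm ?subr_ge0//.
have [->|s1'] := eqVneq s 1; first by rewrite subrr mul0r add0r mul1r.
have s2 : 0 < 1 - s by rewrite subr_gt0 lt_neqAle s1' s1.
have /ltr_leD H : (1 - s) * `|x - a| < (1 - s) * r by rewrite ltr_pM2l.
apply: (lt_le_trans (H _ _ (_ : s * `|x - b| <= s * r))).
  by rewrite ler_wpM2l// ltW.
by rewrite -mulrDl subrK mul1r.
Qed.

Lemma norm_entry m p (A : 'M[R]_(m, p)) i j : `|A i j| <= `|A|.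
Proof.
rewrite [leRHS]/Num.Def.normr/= mx_normrE.
exact: (le_bigmax _ (fun ij : 'I_m * 'I_p => `|A ij.1 ij.2|) (i, j)).
Qed.

Lemma norm_row_le m p (A : 'M[R]_(m, p)) C : 0 <= C ->
  (forall i j, `|A i j| <= C) -> `|A| <= C.
Proof.
move=> C0 AC; rewrite [leLHS]/Num.Def.normr/= mx_normrE.
by apply: bigmax_le => // -[i j] _; exact: AC.
Qed.

(** The norm on rows is the sup norm, so the differential applied to [b - a] is a sum of n terms,
    each at most C times the norm of [b - a]. *)
Lemma mean_value_ball f x (r C : R) : 0 <= C ->
  (forall y, ball x r y -> differentiable f y /\ forall i, `|partial i f y| <= C) ->
  forall a b, ball x r a -> ball x r b -> `|f b - f a| <= n%:R * C * `|b - a|.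
Proof.
move=> C0 H a b xa xb.
have [||s s01] := @MVT_line f a (b - a) 1.
- exact: ler01.
- by move=> s s01; have [] := H _ (ball_line xa xb s01).
rewrite scale1r mul1r [a + _]addrC subrK => ->.
have [df pf] := H _ (ball_line xa xb s01).
rewrite deriveE// diff_row_sum// (le_trans (ler_norm_sum _ _ _))//.
rewrite (le_trans (ler_sum _ (_ : forall i, true -> _ <= C * `|b - a|)))//.
  move=> i _; rewrite normrM mulrC ler_pM//; exact: norm_entry.
by rewrite sumr_const card_ord -mulrnAl mulr_natl.
Qed.

Let second_difference f x i j t : R :=
  f (x + t *: delta_mx 0 i + t *: delta_mx 0 j) - f (x + t *: delta_mx 0 i)
  - f (x + t *: delta_mx 0 j) + f x.

Lemma norm_delta_mx i : `|delta_mx 0 i : 'rV[R]_n| <= 1.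
Proof.
apply: norm_row_le => // k l; rewrite mxE; case: (_ && _) => /=.
  by rewrite normr1.
by rewrite normr0.
Qed.

(** Two mean value theorems in succession: for the increment in direction j as a function of the
    step in direction i, then for [partial i f] in direction j. The second difference is symmetric
    in i and j while the right side is not, which is what yields [partialC]. *)
Lemma second_differenceE U f x i j (r t : R) : open U -> smooth_on U f ->
  (forall y, ball x r y -> U y) -> 0 <= t -> 2 * t < r ->
  exists2 p, `|x - p| <= 2 * t &
    second_difference f x i j t = t * (t * partial j (partial i f) p).
Proof.
move=> oU sf Bx t0 tr.
have near_x s u : 0 <= s <= t -> 0 <= u <= t ->
    `|x - (x + s *: delta_mx 0 i + u *: delta_mx 0 j)| <= 2 * t.
  move=> /andP[s0 st] /andP[u0 ut]; rewrite -addrA opprD addNKr normrN.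
  rewrite (le_trans (ler_normD _ _))// !normrZ mulr2n mulrDl mul1r !ger0_norm//.
  by rewrite lerD// -[leRHS]mulr1 ler_pM// norm_delta_mx.
have inU s u : 0 <= s <= t -> 0 <= u <= t ->
    U (x + s *: delta_mx 0 i + u *: delta_mx 0 j).
  move=> sl ul; apply: Bx; rewrite -ball_normE /=.
  exact: le_lt_trans (near_x _ _ sl ul) tr.
have t00 : 0 <= (0 : R) <= t by rewrite lexx.
have tt : 0 <= t <= t by rewrite t0 lexx.
have inU0 s : 0 <= s <= t -> U (x + s *: delta_mx 0 i).
  by move=> sl; have := inU s 0 sl t00; rewrite scale0r addr0.
pose h s := f (x + t *: delta_mx 0 j + s *: delta_mx 0 i) - f (x + s *: delta_mx 0 i).
pose dh s := partial i f (x + t *: delta_mx 0 j + s *: delta_mx 0 i)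
  - partial i f (x + s *: delta_mx 0 i).
have hdh s : 0 <= s <= t -> is_derive s 1 h (dh s).
  move=> sl; apply: is_deriveB; apply: is_derive_line.
    by rewrite addrAC; exact: smooth_differentiable sf (inU s t sl tt).
  exact: smooth_differentiable sf (inU0 s sl).
have [||s sl hE] := @MVT_segment R h dh 0 t t0.
- by move=> s /[!in_itv]/= /andP[/ltW s0 /ltW st]; apply: hdh; rewrite s0 st.
- apply: derivable_within_continuous => s /[!in_itv]/= s01.
  by have [] := hdh s s01.
rewrite in_itv /= in sl.
have [|u ul uE] := @MVT_line (partial i f) (x + s *: delta_mx 0 i) (delta_mx 0 j) t t0.
  by move=> u ul; exact: smooth_differentiable (smooth_partial i sf) (inU s u sl ul).
exists (x + s *: delta_mx 0 i + u *: delta_mx 0 j); first exact: near_x.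
rewrite -[RHS]/(t * (t * 'D_(delta_mx 0 j) (partial i f) (x + s *: delta_mx 0 i + u *: delta_mx 0 j))).
rewrite -uE [x + _ + _]addrAC -/(dh s) mulrC -[t]subr0 -hE /h /second_difference !scale0r !addr0 subr0.
by rewrite [x + _ + _]addrAC; ring.
Qed.

Lemma partialC U f x i j : open U -> smooth_on U f -> U x ->
  partial i (partial j f) x = partial j (partial i f) x.
Proof.
move=> oU sf Ux.
have [r r0 Br] : exists2 r : R, 0 < r & forall y, ball x r y -> U y.
  have /nbhs_ballP[r r0 Br] : nbhs x U by exact: open_nbhs_nbhs.
  by exists r.
(* If the mixed derivatives differ by e at x, each stays within e/4 of its value at x on a small
   ball. The second difference equals t^2 times either of them at suitable points of that ball,
   which is contradictory. *)
apply/eqP/contraT; rewrite -subr_eq0 -normr_gt0 => e0.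
set e := `|_| in e0.
have cij : {for x, continuous (partial i (partial j f))}.
  apply: differentiable_continuous; apply: smooth_differentiable Ux.
  by do 2!apply: smooth_partial.
have cji : {for x, continuous (partial j (partial i f))}.
  apply: differentiable_continuous; apply: smooth_differentiable Ux.
  by do 2!apply: smooth_partial.
have e4 : 0 < e / 4 by rewrite divr_gt0.
have /cvgrPdist_lt/(_ _ e4)/nbhs_ballP[r1 r10 B1] := cij.
have /cvgrPdist_lt/(_ _ e4)/nbhs_ballP[r2 r20 B2] := cji.
(* The two mean value points lie within 2t of x, and the factor 1/4 keeps 2t strictly below all
   three radii. *)
pose t := Num.min r (Num.min r1 r2) / 4.
have m0 : 0 < Num.min r (Num.min r1 r2) by rewrite !lt_min r0 r10 r20.
have t0 : 0 < t by rewrite divr_gt0.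
have t2 : 2 * t < Num.min r (Num.min r1 r2) by rewrite /t; lra.
have [tr tr1 tr2] : [/\ 2 * t < r, 2 * t < r1 & 2 * t < r2].
  by move: t2; rewrite !lt_min => /and3P[].
have [p px] := second_differenceE i j oU sf Br (ltW t0) tr.
have [q qx] := second_differenceE j i oU sf Br (ltW t0) tr.
have -> : second_difference f x j i t = second_difference f x i j t.
  rewrite /second_difference (addrAC x (t *: delta_mx 0 j)).
  by set a := f _; set b := f _; set c := f _; rewrite (addrAC a).
move=> -> /(mulfI (lt0r_neq0 t0))/(mulfI (lt0r_neq0 t0)) pq.
have := B1 q; rewrite -ball_normE /= => /(_ (le_lt_trans qx tr1)).
have := B2 p; rewrite -ball_normE /= => /(_ (le_lt_trans px tr2)).
rewrite -pq => h1 h2.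
exact: dist_quarter h1 h2.
Qed.

End MeanValue.

Opaque partial.

(** * Matrix fields *)

HB.lock Definition partial_mx (R : realType) n m p (i : 'I_n)
    (X : 'rV[R]_n -> 'M[R]_(m, p)) (x : 'rV[R]_n) : 'M[R]_(m, p) :=
  \matrix_(a, b) partial i (fun y => X y a b) x.

Section MatrixCalculus.
Context {R : realType} {n : nat}.
Implicit Types (U : set 'rV[R]_n) (x : 'rV[R]_n).

Definition smooth_mx U m p (X : 'rV[R]_n -> 'M[R]_(m, p)) :=
  forall a b, smooth_on U (fun y => X y a b).

Definition differentiable_mx m p (X : 'rV[R]_n -> 'M[R]_(m, p)) x :=
  forall a b, differentiable (fun y => X y a b) x.

Lemma partial_mxE m p (i : 'I_n) (X : 'rV[R]_n -> 'M[R]_(m, p)) x a b :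
  partial_mx i X x a b = partial i (fun y => X y a b) x.
Proof. by rewrite unlock mxE. Qed.

Lemma smooth_mx_differentiable U m p (X : 'rV[R]_n -> 'M[R]_(m, p)) x :
  smooth_mx U X -> U x -> differentiable_mx X x.
Proof. by move=> sX Ux a b; exact: smooth_differentiable (sX a b) Ux. Qed.

Lemma smooth_mx_eq U m p (X Y : 'rV[R]_n -> 'M[R]_(m, p)) : open U ->
  (forall x, U x -> X x = Y x) -> smooth_mx U X -> smooth_mx U Y.
Proof.
by move=> oU XY sX a b; apply: smooth_eq oU _ (sX a b) => x Ux; rewrite XY.
Qed.

Lemma smooth_mxM U m p q (X : 'rV[R]_n -> 'M[R]_(m, p))
    (Y : 'rV[R]_n -> 'M[R]_(p, q)) : open U ->
  smooth_mx U X -> smooth_mx U Y -> smooth_mx U (fun y => X y *m Y y).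
Proof.
move=> oU sX sY a b; under eq_fun do rewrite mxE.
by apply: smooth_sum => // i; apply: smoothM.
Qed.

Lemma smooth_mxD U m p (X Y : 'rV[R]_n -> 'M[R]_(m, p)) : open U ->
  smooth_mx U X -> smooth_mx U Y -> smooth_mx U (fun y => X y + Y y).
Proof. by move=> oU sX sY a b; under eq_fun do rewrite mxE; apply: smoothD. Qed.

Lemma smooth_mxN U m p (X : 'rV[R]_n -> 'M[R]_(m, p)) : open U ->
  smooth_mx U X -> smooth_mx U (fun y => - X y).
Proof. by move=> oU sX a b; under eq_fun do rewrite mxE; apply: smoothN. Qed.

Lemma smooth_mxT U m p (X : 'rV[R]_n -> 'M[R]_(m, p)) :
  smooth_mx U X -> smooth_mx U (fun y => (X y)^T).
Proof. by move=> sX a b; under eq_fun do rewrite mxE; apply: sX. Qed.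

Lemma smooth_mxZ U m p (f : 'rV[R]_n -> R) (X : 'rV[R]_n -> 'M[R]_(m, p)) : open U ->
  smooth_on U f -> smooth_mx U X -> smooth_mx U (fun y => f y *: X y).
Proof. by move=> oU sf sX a b; under eq_fun do rewrite mxE; apply: smoothM. Qed.

Lemma smooth_mx_cst U m p (A : 'M[R]_(m, p)) : smooth_mx U (fun=> A).
Proof. by move=> a b; exact: smooth_cst. Qed.

Lemma smooth_partial_mx U m p (X : 'rV[R]_n -> 'M[R]_(m, p)) i :
  smooth_mx U X -> smooth_mx U (partial_mx i X).
Proof.
by move=> sX a b; under eq_fun do rewrite partial_mxE; apply: smooth_partial; exact: sX.
Qed.

Lemma smooth_mxtrace U m (X : 'rV[R]_n -> 'M[R]_m) : open U ->
  smooth_mx U X -> smooth_on U (fun y => \tr (X y)).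
Proof. by move=> oU sX; apply: smooth_sum => // i; exact: sX. Qed.

Lemma smooth_det U m (X : 'rV[R]_n -> 'M[R]_m) : open U ->
  smooth_mx U X -> smooth_on U (fun y => \det (X y)).
Proof.
move=> oU sX; apply: smooth_sum => // s; apply: smoothM => //.
  exact: smooth_cst.
by apply: smooth_prod => // i; exact: sX.
Qed.

Lemma smooth_invmx U m (X : 'rV[R]_n -> 'M[R]_m) : open U ->
  smooth_mx U X -> (forall x, U x -> X x \in unitmx) ->
  smooth_mx U (fun y => invmx (X y)).
Proof.
move=> oU sX uX.
apply: (@smooth_mx_eq _ _ _ (fun y => (\det (X y))^-1 *: \adj (X y))) => //.
  by move=> x /uX ux; rewrite /invmx ux.
apply: smooth_mxZ => //.
  apply: smoothV => //; first exact: smooth_det.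
  by move=> x /uX; rewrite unitmxE unitfE.
move=> a b; under eq_fun do rewrite mxE.
apply: smoothM => //; first exact: smooth_cst.
apply: smooth_det => // c d; under eq_fun do rewrite !mxE.
exact: sX.
Qed.

Lemma partial_mx_eq U m p (X Y : 'rV[R]_n -> 'M[R]_(m, p)) x i : open U -> U x ->
  (forall y, U y -> X y = Y y) -> partial_mx i X x = partial_mx i Y x.
Proof.
move=> oU Ux XY; apply/matrixP => a b; rewrite !partial_mxE.
by apply: (partial_eq _ oU Ux) => y /XY ->.
Qed.

Lemma partial_mx_cst m p (A : 'M[R]_(m, p)) x i : partial_mx i (fun=> A) x = 0.
Proof. by apply/matrixP => a b; rewrite partial_mxE mxE partial_cst. Qed.

Lemma partial_mxM m p q (X : 'rV[R]_n -> 'M[R]_(m, p))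
    (Y : 'rV[R]_n -> 'M[R]_(p, q)) x i :
  differentiable_mx X x -> differentiable_mx Y x ->
  partial_mx i (fun y => X y *m Y y) x =
  partial_mx i X x *m Y x + X x *m partial_mx i Y x.
Proof.
move=> dX dY; apply/matrixP => a b; rewrite partial_mxE !mxE.
under eq_fun do rewrite mxE.
have [|_ ->] := @partial_sum R n _ (index_enum 'I_p) xpredT
   (fun j y => X y a j * Y y j b) x i.
  by move=> j; apply: differentiableM; [exact: dX|exact: dY].
rewrite -big_split; apply: eq_bigr => j _; rewrite partialM.
- by rewrite !partial_mxE.
- exact: dX.
- exact: dY.
Qed.

Lemma partial_mxD m p (X Y : 'rV[R]_n -> 'M[R]_(m, p)) x i :
  differentiable_mx X x -> differentiable_mx Y x ->
  partial_mx i (fun y => X y + Y y) x = partial_mx i X x + partial_mx i Y x.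
Proof.
move=> dX dY; apply/matrixP => a b; rewrite partial_mxE !mxE.
under eq_fun do rewrite mxE.
by rewrite !partial_mxE partialD; [|exact: dX|exact: dY].
Qed.

Lemma partial_mxN m p (X : 'rV[R]_n -> 'M[R]_(m, p)) x i :
  differentiable_mx X x -> partial_mx i (fun y => - X y) x = - partial_mx i X x.
Proof.
move=> dX; apply/matrixP => a b; rewrite mxE !partial_mxE; under eq_fun do rewrite mxE.
by rewrite partialN; [|exact: dX].
Qed.

Lemma partial_mxT m p (X : 'rV[R]_n -> 'M[R]_(m, p)) x i :
  partial_mx i (fun y => (X y)^T) x = (partial_mx i X x)^T.
Proof. by apply/matrixP => a b; rewrite mxE !partial_mxE; under eq_fun do rewrite mxE. Qed.

Lemma partial_mxZ m p (f : 'rV[R]_n -> R) (X : 'rV[R]_n -> 'M[R]_(m, p)) x i :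
  differentiable f x -> differentiable_mx X x ->
  partial_mx i (fun y => f y *: X y) x = partial i f x *: X x + f x *: partial_mx i X x.
Proof.
move=> df dX; apply/matrixP => a b; rewrite !mxE !partial_mxE; under eq_fun do rewrite mxE.
by rewrite partialM//; exact: dX.
Qed.

Lemma partial_mxtrace m (X : 'rV[R]_n -> 'M[R]_m) x i :
  differentiable_mx X x ->
  partial i (fun y => \tr (X y)) x = \tr (partial_mx i X x).
Proof.
move=> dX; have [|_ ->] := @partial_sum R n _ (index_enum 'I_m) xpredT
   (fun j y => X y j j) x i; first by move=> j; exact: dX.
by apply: eq_bigr => j _; rewrite partial_mxE.
Qed.

Lemma partial_mxC U m p (X : 'rV[R]_n -> 'M[R]_(m, p)) x i j : open U ->
  smooth_mx U X -> U x ->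
  partial_mx i (partial_mx j X) x = partial_mx j (partial_mx i X) x.
Proof.
move=> oU sX Ux; apply/matrixP => a b; rewrite !partial_mxE.
have E k : (fun y => partial_mx k X y a b) = partial k (fun y => X y a b).
  by apply/funext => y; rewrite partial_mxE.
rewrite !E; exact: partialC oU (sX a b) Ux.
Qed.

Lemma partial_invmx U m (X : 'rV[R]_n -> 'M[R]_m) x i : open U ->
  smooth_mx U X -> (forall x, U x -> X x \in unitmx) -> U x ->
  partial_mx i (fun y => invmx (X y)) x =
  - (invmx (X x) *m partial_mx i X x *m invmx (X x)).
Proof.
move=> oU sX uX Ux.
have dX := smooth_mx_differentiable sX Ux.
have dV := smooth_mx_differentiable (smooth_invmx oU sX uX) Ux.
have /(_ _)/wrap[] := @partial_mx_eq U _ _ (fun y => X y *m invmx (X y)) (fun=> 1%:M) x i oU Ux.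
  by move=> y /uX /mulmxV.
rewrite partial_mx_cst partial_mxM// addrC => /eqP; rewrite addr_eq0 => /eqP e.
by rewrite -[LHS](mulKmx (uX _ Ux)) e mulmxN mulmxA.
Qed.

(** The Leibniz rule is stated with full products in which one factor is replaced, to match a
    determinant with one row differentiated; [uniq] ensures that exactly one factor is replaced. *)
Lemma partial_prod (I : eqType) (r : seq I) (F : I -> 'rV[R]_n -> R) x i : uniq r ->
  (forall j, differentiable (F j) x) ->
  differentiable (fun y => \prod_(j <- r) F j y) x /\
  partial i (fun y => \prod_(j <- r) F j y) x =
  \sum_(k <- r) \prod_(j <- r) (if j == k then partial i (F j) x else F j x).
Proof.
move=> + dF; elim: r => [|j r IH] /=.
  have -> : (fun y => \prod_(j <- [::]) F j y) = cst 1.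
    by apply/funext => y; rewrite big_nil.
  by rewrite big_nil partial_cst; split=> //; exact: differentiable_cst.
move=> /andP[jr /IH{IH}[IHd IH]].
have -> : (fun y => \prod_(k <- j :: r) F k y) =
   fun y => F j y * \prod_(k <- r) F k y.
  by apply/funext => y; rewrite big_cons.
split; first exact: differentiableM.
rewrite partialM// IH !big_cons eqxx; congr (_ * _ + _).
  apply: eq_big_seq => k kr; case: eqP => // kj.
  by rewrite -kj kr in jr.
rewrite mulr_sumr; apply: eq_big_seq => k kr; rewrite big_cons.
by case: eqP => // jk; rewrite jk kr in jr.
Qed.

(** Jacobi's formula. Through it the trace of the Christoffel matrices becomes a logarithmic
    derivative of the determinant of the metric. *)
Lemma partial_det m (X : 'rV[R]_n -> 'M[R]_m) x i : differentiable_mx X x ->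
  X x \in unitmx ->
  partial i (fun y => \det (X y)) x =
  \det (X x) * \tr (invmx (X x) *m partial_mx i X x).
Proof.
move=> dX uX.
have [|_ ->] := @partial_sum R n _ (index_enum 'S_m) xpredT
   (fun (s : 'S_m) y => (-1) ^+ s * \prod_(j < m) X y j (s j)) x i.
  move=> s; apply: differentiableM; first exact: differentiable_cst.
  have [||] := @partial_prod _ (index_enum 'I_m) (fun j y => X y j (s j)) x i.
  - exact: index_enum_uniq.
  - by move=> j; exact: dX.
  by [].
(* [Y k] is [X x] with row k differentiated; expanded along row k it involves only cofactors of
   [X x]. *)
pose Y k : 'M[R]_m := \matrix_(a, b) if a == k then partial_mx i X x a b else X x a b.
transitivity (\sum_k \det (Y k)).
  rewrite exchange_big /=; apply: eq_bigr => s _.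
  have [||dP eP] := @partial_prod _ (index_enum 'I_m) (fun j y => X y j (s j)) x i.
  - exact: index_enum_uniq.
  - by move=> j; exact: dX.
  rewrite (partialM i (differentiable_cst _ _) dP) partial_cst mul0r add0r eP mulr_sumr; apply: eq_bigr => k _.
  by congr (_ * _); apply: eq_bigr => j _; rewrite !mxE partial_mxE.
have detY k : \det (Y k) = \sum_j partial_mx i X x k j * cofactor (X x) k j.
  rewrite (expand_det_row _ k); apply: eq_bigr => j _.
  rewrite {1}/Y mxE eqxx; congr (_ * (_ * \det _)).
  by apply/matrixP => a b; rewrite !mxE eq_sym (negbTE (neq_lift _ _)).
rewrite /invmx uX -scalemxAl mxtraceZ mulrA mulfV ?mul1r; last first.
  by move: uX; rewrite unitmxE unitfE.
under eq_bigr do rewrite detY.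
rewrite exchange_big /=; apply: eq_bigr => j _; rewrite mxE; apply: eq_bigr => k _.
by rewrite mulrC [\adj _ _ _]mxE.
Qed.

End MatrixCalculus.

(** * The Levi-Civita connection in coordinates *)

(* Row j of [gamma_mx G x i] is the covariant derivative of e_j along e_i, so
   that of a row vector field v is d_i v + v Gamma_i. *)
HB.lock Definition gamma_mx (R : realType) n (G : 'rV[R]_n -> 'M[R]_n) x i : 'M[R]_n :=
  \matrix_(j, k) christoffel G x i j k.

Section LeviCivita.
Context {R : realType} {n : nat}.
Implicit Types (U : set 'rV[R]_n) (x : 'rV[R]_n) (G : 'rV[R]_n -> 'M[R]_n).

Definition metric_on U G : Prop :=
  smooth_mx U G /\ forall x, U x -> (G x)^T = G x /\ G x \in unitmx.

Lemma gamma_mxE G x i j k : gamma_mx G x i j k = christoffel G x i j k.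
Proof. by rewrite unlock mxE. Qed.

Lemma gamma_mx_row G x i j : row j (gamma_mx G x i) =
  (2^-1 *: \row_l (partial_mx i G x j l + partial_mx j G x i l - partial_mx l G x i j))
   *m invmx (G x).
Proof.
apply/rowP => k; rewrite -scalemxAl mxE gamma_mxE mxE; congr (_ * _).
by rewrite mxE; apply: eq_bigr => l _; rewrite mxE !partial_mxE.
Qed.

End LeviCivita.

(** Applying the two transpositions alternately, three times each, restores the order of the indices
    with the sign (-1)^3. This is the algebra behind the uniqueness of the Levi-Civita
    connection. *)
Lemma sym_skew_eq0 (R : realType) (I : Type) (T : I -> I -> I -> R) :
  (forall i j k, T i j k = T j i k) -> (forall i j k, T i j k = - T i k j) ->
  forall i j k, T i j k = 0.
Proof.
move=> symT skewT i j k.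
have : T i j k = - T i j k.
  by rewrite {1}skewT {1}symT {1}skewT {1}symT {1}skewT {1}symT !opprK.
by move=> /eqP; rewrite -addr_eq0 -mulr2n mulrn_eq0 /= => /eqP.
Qed.

Section LeviCivitaTheory.
Context {R : realType} {n : nat}.
Implicit Types (U : set 'rV[R]_n) (x : 'rV[R]_n) (G : 'rV[R]_n -> 'M[R]_n).

Lemma partial_mx_sym U G x i j k : open U -> metric_on U G -> U x ->
  partial_mx i G x j k = partial_mx i G x k j.
Proof.
move=> oU [sG mG] Ux.
have e : partial_mx i (fun y => (G y)^T) x = partial_mx i G x.
  by apply: (partial_mx_eq _ oU Ux) => y /mG[].
by rewrite -{1}e partial_mxT mxE.
Qed.

Lemma gamma_mx_sym U G x i j : open U -> metric_on U G -> U x ->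
  row j (gamma_mx G x i) = row i (gamma_mx G x j).
Proof.
move=> oU mG Ux; rewrite !gamma_mx_row; congr ((_ *: _) *m _).
apply/rowP => l; rewrite [LHS]mxE [RHS]mxE (partial_mx_sym l i j oU mG Ux).
by congr (_ - _); rewrite addrC.
Qed.

Lemma gamma_mx_lowered U G x i j k : metric_on U G -> U x ->
  (gamma_mx G x i *m G x) j k =
  2^-1 * (partial_mx i G x j k + partial_mx j G x i k - partial_mx k G x i j).
Proof.
move=> [_ mG] Ux; have [_ uG] := mG x Ux.
transitivity (row j (gamma_mx G x i *m G x) 0 k); first by rewrite [RHS]mxE.
by rewrite row_mul gamma_mx_row mulmxKV// mxE mxE.
Qed.

Lemma gamma_mx_metric U G x i : open U -> metric_on U G -> U x ->
  partial_mx i G x = gamma_mx G x i *m G x + (gamma_mx G x i *m G x)^T.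
Proof.
move=> oU mG Ux.
apply/matrixP => j k; rewrite [RHS]mxE [X in _ + X]mxE !(gamma_mx_lowered _ _ _ mG Ux).
rewrite (partial_mx_sym i k j oU mG Ux).
move: (partial_mx _ _ _ _ _) (partial_mx _ _ _ _ _) (partial_mx _ _ _ _ _) => a b c.
by field.
Qed.

(** The difference of two torsion-free metric connections, lowered by [G], is symmetric in its first
    two indices and skew in its last two. This gives the transformation law of the Christoffel
    symbols without transforming the formula that defines them. *)
Lemma gamma_mx_unique U G x (X : 'I_n -> 'M[R]_n) : open U -> metric_on U G -> U x ->
  (forall i j, row j (X i) = row i (X j)) ->
  (forall i, partial_mx i G x = X i *m G x + (X i *m G x)^T) ->
  forall i, X i = gamma_mx G x i.
Proof.
move=> oU mG Ux symX mX.
have [_ /(_ _ Ux)[GT uG]] := mG.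
pose T i := (X i - gamma_mx G x i) *m G x.
suff T0 i : T i = 0.
  move=> i; apply/eqP; rewrite -subr_eq0; apply/eqP.
  by rewrite -[LHS](mulmxK uG) -/(T i) T0 mul0mx.
apply/matrixP => j k; rewrite [RHS]mxE; move: i j k.
apply: (@sym_skew_eq0 R 'I_n (fun i j k => T i j k)) => i j k /=.
  have rT a b : row b (T a) = row b (X a) *m G x - row b (gamma_mx G x a) *m G x.
    by rewrite row_mul linearB /= mulmxBl.
  have : row j (T i) = row i (T j).
    by rewrite !rT symX (gamma_mx_sym i j oU mG Ux).
  by move: (T i) (T j) => A B /rowP/(_ k); rewrite !mxE.
have : T i + (T i)^T = 0.
  rewrite /T mulmxBl linearB /= addrACA -mX (gamma_mx_metric i oU mG Ux) -opprD.
  by rewrite subrr.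
by move: (T i) => A /matrixP/(_ j k); rewrite !mxE => /eqP; rewrite addr_eq0 => /eqP.
Qed.

End LeviCivitaTheory.

(** * Local solutions of second order equations *)

Section Primitive.
Context {R : realType}.
Implicit Types (f g P : R -> R) (e t : R).

(** The interval (-1, 1) is enough, since the Picard operator evaluates primitives only at times in
    [-1/2, 1/2]. *)
Lemma exists_primitive f : continuous f ->
  exists P, P 0 = 0 /\ forall t, -1 < t < 1 -> is_derive t 1 P (f t).
Proof.
move=> cf; pose F t := (\int[lebesgue_measure]_(s in `[-1, t]) f s)%R.
have dF t : -1 < t < 1 -> is_derive t 1 F (f t).
  move=> /andP[t1 t2].
  have [|dt <-] := @continuous_FTC1_closed R f (-1) t 1 t2 _ t1 (cf t).
    apply: continuous_compact_integrable; first exact: segment_compact.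
    exact: continuous_subspaceT.
  by rewrite derive1E; exact: derivableP dt.
exists (fun t => F t - F 0); split; first by rewrite subrr.
move=> t t1; have dt := dF t t1; rewrite -[f t]subr0; apply: is_deriveB.
Qed.

Lemma primitive_bound P p (C : R) : P 0 = 0 ->
  (forall t, -1 < t < 1 -> is_derive t 1 P (p t)) -> (forall t, `|p t| <= C) ->
  forall t, -1 < t < 1 -> `|P t| <= C * `|t|.
Proof.
move=> P0 dP pC t /andP[t1 t2].
have W (a b : R) : -1 < a -> b < 1 -> a <= b -> `|P b - P a| <= C * (b - a).
  move=> a1 b1 ab; have [||s _ ->] := @MVT_segment R P p a b ab.
  - move=> s /[!in_itv]/= /andP[s1 s2]; apply: dP.
    by rewrite (lt_trans a1 s1) (lt_trans s2 b1).
  - apply: derivable_within_continuous => s /[!in_itv]/= /andP[s1 s2].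
    by have [] := dP s _; rewrite ?(lt_le_trans a1 s1) ?(le_lt_trans s2 b1).
  by rewrite normrM (ger0_norm (_ : 0 <= b - a)) ?subr_ge0// ler_wpM2r ?subr_ge0.
have [t0|t0] := leP 0 t.
  by have := W 0 t (ltrN10 _) t2 t0; rewrite P0 !subr0 (ger0_norm t0).
have := W t 0 t1 ltr01 (ltW t0).
by rewrite P0 !sub0r normrN (ltr0_norm t0).
Qed.

(** The retraction of R onto [-e, e]. With time clamped, the Picard iterates are continuous on all
    of R and every estimate is uniform in t. *)
Definition clamp e t : R := Num.max (- e) (Num.min e t).

Lemma clamp_bound e t : 0 <= e -> - e <= clamp e t <= e.
Proof.
move=> e0; rewrite /clamp le_max lexx /= ge_max; apply/andP; split; last first.
  by rewrite ge_min lexx.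
by rewrite lerNl; apply: (le_trans _ e0); rewrite oppr_le0.
Qed.

Lemma clamp_id e t : - e <= t <= e -> clamp e t = t.
Proof. by move=> /andP[t1 t2]; rewrite /clamp (min_idPr t2) (max_idPr t1). Qed.

Lemma clamp_lipschitz e s t : `|clamp e s - clamp e t| <= `|s - t|.
Proof.
wlog st : s t / s <= t.
  by move=> W; have [/W//|/ltW/W] := leP s t; rewrite distrC (distrC t).
have H : 0 <= clamp e t - clamp e s <= t - s.
  by rewrite /clamp; case: (leP e s); case: (leP e t) => *;
   case: (leP (- e) e); case: (leP (- e) s); case: (leP (- e) t) => *;
   apply/andP; split; lra.
move: H => /andP[h1 h2]; rewrite distrC (distrC s) (ger0_norm h1) ger0_norm//.
exact: le_trans h2.
Qed.

End Primitive.

(** * The Picard-Lindelöf theorem *)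

Section Picard.
Context {R : realType} {m : nat}.
Local Notation V := 'rV[R]_m.

Lemma continuous_row (T : topologicalType) (u : T -> V) (t : T) :
  (forall j, {for t, continuous (fun s => u s 0 j)}) -> {for t, continuous u}.
Proof.
move=> cu; apply/cvgrPdist_lt => e e0; near=> s.
rewrite [ltLHS](_ : _ = `|u t - u s|)//; apply: (@le_lt_trans _ _ (e / 2)).
  apply: norm_row_le => [|i j]; first by rewrite divr_ge0// ltW.
  rewrite ord1 !mxE; move: j; near: s; apply: filter_forall => j.
  have e2 : 0 < e / 2 by rewrite divr_gt0.
  have /cvgrPdist_le/(_ _ e2) := cu j; exact.
by rewrite ltr_pdivrMr// ltr_pMr// ltr1n.
Unshelve. all: by end_near. Qed.

Lemma continuous_entry (T : topologicalType) (u : T -> V) (t : T) j :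
  {for t, continuous u} -> {for t, continuous (fun s => u s 0 j)}.
Proof.
move=> cu; apply: (@continuous_comp _ _ _ u (fun N : V => N 0 j)) => //.
exact: coord_continuous.
Qed.

Lemma continuous_lipschitz (F : V -> V) (L : R) (u : R -> V) : 0 <= L ->
  (forall v w, `|F v - F w| <= L * `|v - w|) -> continuous u -> continuous (F \o u).
Proof.
move=> L0 LF cu t; apply/cvgrPdist_lt => e e0.
(* [L] may be 0, hence the division by [L + 1]. *)
have L1 : 0 < L + 1 by rewrite ltr_wpDl.
have e1 : 0 < e / (L + 1) by rewrite divr_gt0.
have /cvgrPdist_lt/(_ _ e1) := cu t; apply: filterS => s us /=.
rewrite (le_lt_trans (LF _ _))//; move: us; rewrite ltr_pdivlMr//.
by apply: le_lt_trans; rewrite mulrC ler_wpM2l// lerDl.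
Qed.

Lemma le_geometric_eq0 (x C : R) : 0 <= x -> (forall k, x <= C / 2 ^+ k) -> x = 0.
Proof.
move=> x0 H; apply/eqP; rewrite eq_le x0 andbT leNgt; apply/negP => xp.
have C0 : C / x < (Num.truncn (C / x)).+1%:R by exact: truncnS_gt.
have := H (Num.truncn (C / x)).+1.
rewrite ler_pdivlMr ?exprn_gt0// mulrC -ler_pdivlMr// => /(le_lt_trans)/(_ C0).
by rewrite -natrX ltr_nat ltnNge ltnW// ltn_expl.
Qed.

(** Because [F] is Lipschitz on the whole space, no domain has to be controlled along the iteration:
    the iterates of the integral operator converge uniformly at a geometric rate. *)
Lemma picard_lindelof (F : V -> V) (u0 : V) (L : R) : 0 <= L ->
  (forall v w, `|F v - F w| <= L * `|v - w|) ->
  exists (e : R) (u : R -> V), [/\ 0 < e, u 0 = u0 &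
    forall t : R, - e < t < e -> is_derive t 1 u (F (u t))].
Proof.
move=> L0 LF.
(* A primitive is chosen for all functions at once; a discontinuous function receives itself as a
   junk value. *)
have [Pr PrP] : {Pr : (R -> R) -> R -> R & forall f, continuous f -> Pr f 0 = 0 /\
    forall t : R, -1 < t < 1 -> is_derive t 1 (Pr f) (f t)}.
  apply: (@choice _ _ (fun (f P : R -> R) => continuous f -> P 0 = 0 /\
    forall t : R, -1 < t < 1 -> is_derive t 1 P (f t))) => f.
  have [cf|ncf] := pselect (continuous f).
    by have [P PP] := exists_primitive cf; exists P.
  by exists f.
have L1 : 0 < L + 1 by rewrite ltr_wpDl.
(* [e <= 1 / 2] keeps clamped times inside (-1, 1), where the primitives are differentiable;
   [L * e <= 1 / 2] makes [T] halve uniform distances. *)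
pose e := (2 * (L + 1))^-1.
have e0 : 0 < e by rewrite invr_gt0 mulr_gt0.
have e2 : e <= 1 / 2.
  by rewrite /e invfM div1r ger_pMr// invf_le1// lerDr.
have eL : L * e <= 1 / 2.
  by rewrite /e invfM mulrCA div1r ger_pMr// ler_pdivrMr// mul1r lerDl.
have ce t : -1 < clamp e t < 1 /\ `|clamp e t| <= e.
  have := clamp_bound t (ltW e0) => /andP[c1 c2].
  by rewrite ler_norml c1 c2; split => //; apply/andP; split; lra.
pose comp (u : R -> V) j s := F (u s) 0 j.
have ccomp u j : continuous u -> continuous (comp u j).
  by move=> cu t; apply: continuous_entry; exact: continuous_lipschitz LF cu t.
pose T (u : R -> V) t := u0 + \row_j Pr (comp u j) (clamp e t).
have cT u : continuous u -> continuous (T u).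
  move=> cu t; apply: continuous_row => j.
  have -> : (fun s => T u s 0 j) = (fun s => u0 0 j + Pr (comp u j) (clamp e s)).
    by apply/funext => s; rewrite !mxE.
  apply: cvgD; first exact: cvg_cst.
  have cc : continuous (clamp e).
    move=> s; apply/cvgrPdist_lt => d d0.
    have /cvgrPdist_lt/(_ _ d0) := @cvg_id _ (nbhs s); apply: filterS => r.
    exact: le_lt_trans (clamp_lipschitz _ _ _).
  apply: (@continuous_comp _ _ _ (clamp e) (Pr (comp u j))); first exact: cc.
  apply/differentiable_continuous/derivable1_diffP.
  by have [_ /(_ _ (ce t).1)[]] := PrP _ (ccomp u j cu).
have TL u v d : continuous u -> continuous v -> (forall t, `|u t - v t| <= d) ->
    forall t, `|T u t - T v t| <= d / 2.
  move=> cu cv uv t.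
  have d0 : 0 <= d by exact: le_trans (uv 0).
  apply: norm_row_le => [|i j]; first by rewrite divr_ge0.
  rewrite ord1 !mxE opprD addrACA subrr add0r.
  have [u00 du] := PrP _ (ccomp u j cu); have [v00 dv] := PrP _ (ccomp v j cv).
  have [ce1 ce2] := ce t.
  have := @primitive_bound R (Pr (comp u j) - Pr (comp v j)) (comp u j - comp v j) (L * d).
  rewrite -[(_ - _) 0]/(_ - _) u00 v00 subrr => /(_ erefl) H.
  apply: (le_trans (H _ _ _ ce1)).
  - by move=> s s1; apply: is_deriveB; [exact: du|exact: dv].
  - move=> s; rewrite -[_ s]/(F (u s) 0 j - F (v s) 0 j).
    have -> : F (u s) 0 j - F (v s) 0 j = (F (u s) - F (v s)) 0 j by rewrite !mxE.
    rewrite (le_trans (norm_entry _ _ _))// (le_trans (LF _ _))//.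
    by rewrite ler_wpM2l.
  - apply: (@le_trans _ _ (L * d * e)); first by rewrite ler_wpM2l// mulr_ge0.
    by rewrite mulrAC mulrC ler_wpM2l// -div1r.
pose us k := iter k T (cst u0).
have cus k : continuous (us k).
  elim: k => [|k IH]; last exact: cT.
  by move=> t; exact: cvg_cst.
pose D := `|F u0|; have D0 : 0 <= D by exact: normr_ge0.
have us1 t : `|us 1%N t - us 0%N t| <= D.
  apply: norm_row_le => [|i j]; first exact: D0.
  rewrite ord1 !mxE addrAC subrr add0r.
  have [v00 dv] := PrP _ (ccomp _ j (cus 0%N)).
  have [ce1 ce2] := ce t.
  rewrite (le_trans (primitive_bound v00 dv (C := D) _ ce1))//.
    by move=> s; exact: norm_entry.
  by rewrite -[leRHS]mulr1 ler_wpM2l// (le_trans ce2)//; lra.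
have usk k t : `|us k.+1 t - us k t| <= D / 2 ^+ k.
  elim: k t => [|k IH] t; first by rewrite expr0 divr1.
  rewrite exprSr invfM mulrA.
  exact: (TL _ _ _ (cus k.+1) (cus k) IH t).
(* The bound is a difference of two geometric tails, so that the induction on l closes. *)
have uskl k l t : `|us (k + l)%N t - us k t| <= 2 * D / 2 ^+ k - 2 * D / 2 ^+ (k + l)%N.
  elim: l => [|l IH]; first by rewrite addn0 !subrr normr0.
  rewrite (le_trans (ler_distD (us (k + l)%N t) _ _))// addnS.
  apply: (le_trans (lerD (usk _ _) IH)).
  rewrite exprS invfM.
  have : D / 2 ^+ (k + l) = 2 * D * (2^-1 / 2 ^+ (k + l)).
    by rewrite mulrA [2 * D]mulrC mulfK.
  by rewrite mulrA; lra.
have uskl' k l t : `|us (k + l)%N t - us k t| <= 2 * D / 2 ^+ k.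
  rewrite (le_trans (uskl k l t))// gerBl divr_ge0// ?exprn_ge0//.
  by rewrite mulr_ge0.
have small (d : R) : 0 < d -> exists k, 2 * D / 2 ^+ k < d.
  move=> d0; apply: contrapT => H.
  have : d = 0; last by move=> dd; rewrite dd ltxx in d0.
  apply: (@le_geometric_eq0 d (2 * D)) (ltW d0) _ => k.
  by rewrite leNgt; apply/negP => kd; apply: H; exists k.
have cvgu t : cvgn (us ^~ t).
  apply/cauchy_cvgP/cauchy_exP => d d0.
  have [k kd] := small d d0; exists (us k t).
  exists k => // l /= kl; rewrite -ball_normE /= distrC.
  by rewrite -(subnKC kl) (le_lt_trans (uskl' _ _ _)).
pose u t := limn (us ^~ t).
have ulim k t : `|u t - us k t| <= 2 * D / 2 ^+ k.
  apply/ler_addgt0Pr => d d0.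
  have /cvgrPdist_lt/(_ d d0)[N _ NP] := cvgu t.
  have := NP (k + N)%N (leq_addl _ _) => /= h.
  rewrite -(subrKA (us (k + N)%N t)) (le_trans (ler_normD _ _))// addrC.
  by rewrite lerD// ltW.
have cu : continuous u.
  move=> t; apply/cvgrPdist_lt => d d0.
  have d3 : 0 < d / 3 by rewrite divr_gt0.
  have [k kd] := small _ d3.
  have /cvgrPdist_lt/(_ _ d3) := cus k t; apply: filterS => s ks.
  have h1 := ulim k t; have h2 := ulim k s; rewrite distrC in h2.
  have h3 := ler_distD (us k t) (u t) (u s).
  have h4 := ler_distD (us k s) (us k t) (u s).
  by lra.
have Tu t : T u t = u t.
  apply/eqP; rewrite -subr_eq0 -normr_eq0; apply/eqP.
  apply: (@le_geometric_eq0 _ (2 * D)) => // k.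
  have h1 := TL _ _ _ cu (cus k) (ulim k) t.
  have h2 := ulim k.+1 t; rewrite exprS invfM in h2; rewrite distrC in h2.
  have h3 := ler_distD (us k.+1 t) (T u t) (u t).
  rewrite -[T (us k) t]/(us k.+1 t) in h1.
  by lra.
exists e, u; split => //.
  rewrite -Tu; apply/rowP => j; rewrite !mxE clamp_id ?oppr_le0 ?ltW//.
  by have [-> _] := PrP _ (ccomp u j cu); rewrite addr0.
move=> t te.
have du j : is_derive t 1 (fun s => u s 0 j) (F (u t) 0 j).
  have t1 : -1 < t < 1 by move: te => /andP[? ?]; apply/andP; split; lra.
  have [_ /(_ t t1) dP] := PrP _ (ccomp u j cu).
  have dD : is_derive t 1 (fun s => u0 0 j + Pr (comp u j) s) (F (u t) 0 j).
    by rewrite -[F (u t) 0 j]add0r; apply: is_deriveD.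
  (* Near t the clamp is the identity, and the fixed point equation [Tu] becomes the integral
     equation. *)
  apply: near_eq_is_derive dD; near=> s.
  rewrite -Tu !mxE clamp_id//.
  have se : - e < s < e by near: s; apply: near_in_itvoo; rewrite in_itv.
  by move: se => /andP[/ltW -> /ltW ->].
have dv : derivable u t 1.
  by apply/derivable_mxP => i j; rewrite ord1; have [] := du j.
apply: DeriveDef => //; rewrite derive_mx//; apply/rowP => j; rewrite mxE.
by have [] := du j.
Unshelve. all: by end_near. Qed.

End Picard.

(** * Truncation to globally Lipschitz vector fields *)

Section BoundedLipschitz.
Context {R : realType} {N : nat}.
Implicit Types (f g : 'rV[R]_N -> R).

(** Boundedness is carried along because a product of Lipschitz functions is Lipschitz only when the
    factors are bounded. *)
Definition bounded_lipschitz f := exists2 C, 0 <= C &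
  forall u v, `|f u| <= C /\ `|f u - f v| <= C * `|u - v|.

Lemma bounded_lipschitzD f g : bounded_lipschitz f -> bounded_lipschitz g ->
  bounded_lipschitz (fun u => f u + g u).
Proof.
move=> [C C0 fC] [D D0 gD]; exists (C + D); first exact: addr_ge0.
move=> u v; have [f1 f2] := fC u v; have [g1 g2] := gD u v; split.
  by rewrite (le_trans (ler_normD _ _))// lerD.
rewrite opprD addrACA (le_trans (ler_normD _ _))// mulrDl lerD//.
Qed.

Lemma bounded_lipschitzM f g : bounded_lipschitz f -> bounded_lipschitz g ->
  bounded_lipschitz (fun u => f u * g u).
Proof.
move=> [C C0 fC] [D D0 gD]; exists (C * D + C * D); first by rewrite addr_ge0 ?mulr_ge0.
move=> u v; have [f1 f2] := fC u v; have [g1 g2] := gD u v; have [g3 _] := gD v v; split.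
  by rewrite normrM (@le_trans _ _ (C * D)) ?ler_pM// lerDl mulr_ge0.
have -> : f u * g u - f v * g v = f u * (g u - g v) + (f u - f v) * g v by ring.
rewrite (le_trans (ler_normD _ _))// !normrM mulrDl lerD//.
  by rewrite -mulrA ler_pM.
by rewrite mulrAC ler_pM.
Qed.

Lemma bounded_lipschitz_cst (c : R) : bounded_lipschitz (fun=> c).
Proof. by exists `|c| => // u v; rewrite subrr normr0 mulr_ge0. Qed.

Lemma bounded_lipschitz_sum (I : Type) (r : seq I) (F : I -> 'rV[R]_N -> R) :
  (forall i, bounded_lipschitz (F i)) ->
  bounded_lipschitz (fun u => \sum_(i <- r) F i u).
Proof.
move=> lF; elim: r => [|i r IH].
  by under eq_fun do rewrite big_nil; exact: bounded_lipschitz_cst.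
by under eq_fun do rewrite big_cons; exact: bounded_lipschitzD.
Qed.

Lemma bounded_lipschitz_row m (F : 'rV[R]_N -> 'rV[R]_m) :
  (forall j, bounded_lipschitz (fun u => F u 0 j)) ->
  exists2 L, 0 <= L & forall u v, `|F u - F v| <= L * `|u - v|.
Proof.
move=> lF.
have [C CP] : {C : 'I_m -> R & forall j, 0 <= C j /\
    forall u v, `|F u 0 j - F v 0 j| <= C j * `|u - v|}.
  apply: (@choice _ _ (fun j C => 0 <= C /\
    forall u v, `|F u 0 j - F v 0 j| <= C * `|u - v|)) => j.
  by have [C C0 H] := lF j; exists C; split=> // u v; have [] := H u v.
have S0 : 0 <= \sum_j C j by apply: sumr_ge0 => j _; have [] := CP j.
exists (\sum_j C j) => // u v; apply: norm_row_le; first by rewrite mulr_ge0.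
move=> i j; rewrite ord1 !mxE; have [_ H] := CP j.
rewrite (le_trans (H u v))// ler_wpM2r// (bigD1 j)//= lerDl.
by apply: sumr_ge0 => k _; have [] := CP k.
Qed.

End BoundedLipschitz.

Section ClampBox.
Context {R : realType} {n : nat}.
Implicit Types (x y : 'rV[R]_n).

(** The coordinatewise retraction onto the closed sup-norm ball of radius r. It is 1-Lipschitz, so
    composing with it turns a Lipschitz bound near x into a global one. *)
Definition clamp_box x (r : R) y : 'rV[R]_n := x + \row_i clamp r ((y - x) 0 i).

Lemma clamp_box_dist x r y : 0 <= r -> `|clamp_box x r y - x| <= r.
Proof.
move=> r0; apply: norm_row_le => // i j; rewrite /clamp_box addrAC subrr add0r mxE.
by rewrite ler_norml; exact: clamp_bound.
Qed.

Lemma clamp_box_id x r y : `|y - x| <= r -> clamp_box x r y = y.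
Proof.
move=> yx; apply/rowP => i; rewrite mxE mxE clamp_id ?mxE; first by rewrite addrC subrK.
have := le_trans (norm_entry (y - x) 0 i) yx.
by rewrite mxE [X in _ + X]mxE ler_norml.
Qed.

Lemma clamp_box_lipschitz x r y z : `|clamp_box x r y - clamp_box x r z| <= `|y - z|.
Proof.
apply: norm_row_le => // i j; rewrite ord1 /clamp_box opprD addrACA subrr add0r.
rewrite mxE [X in _ + X]mxE [X in X + _]mxE [X in _ - X]mxE.
rewrite (le_trans (clamp_lipschitz _ _ _))//.
have -> : (y - x) 0 j - (z - x) 0 j = (y - z) 0 j by rewrite !mxE; ring.
exact: norm_entry.
Qed.

Lemma clamp_box_bounded_lipschitz N (p : {linear 'rV[R]_N -> 'rV[R]_n}) x r
    (f : 'rV[R]_n -> R) (C : R) : 0 <= r -> 0 <= C ->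
  (forall w, `|p w| <= `|w|) ->
  (forall y z, `|y - x| <= r -> `|z - x| <= r -> `|f y - f z| <= C * `|y - z|) ->
  bounded_lipschitz (fun w => f (clamp_box x r (p w))).
Proof.
move=> r0 C0 p1 fC; exists (`|f x| + C * r + C); first by rewrite !addr_ge0 ?mulr_ge0.
move=> u v; split.
  have := fC (clamp_box x r (p u)) x (clamp_box_dist _ _ r0).
  rewrite subrr normr0 => /(_ r0) h.
  have h2 : C * `|clamp_box x r (p u) - x| <= C * r by rewrite ler_wpM2l// clamp_box_dist.
  have := ler_distD 0 (f (clamp_box x r (p u))) (f x).
  have := lerB_dist (f (clamp_box x r (p u))) (f x).
  by lra.
rewrite (le_trans (fC _ _ (clamp_box_dist _ _ r0) (clamp_box_dist _ _ r0)))//.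
rewrite (@le_trans _ _ (C * `|u - v|))//.
  by rewrite ler_wpM2l// (le_trans (clamp_box_lipschitz _ _ _ _))// -linearB.
by rewrite ler_wpM2r// lerDr addr_ge0// mulr_ge0.
Qed.

End ClampBox.

Section SecondOrderODE.
Context {R : realType} {n : nat}.
Implicit Types (x v : 'rV[R]_n) (U : set 'rV[R]_n).

Lemma smooth_locally_lipschitz U (f : 'rV[R]_n -> R) x : open U -> smooth_on U f -> U x ->
  exists r C : R, [/\ 0 < r, 0 <= C, forall y, ball x r y -> U y &
    forall a b, ball x r a -> ball x r b -> `|f b - f a| <= C * `|b - a|].
Proof.
move=> oU sf Ux.
pose B := \sum_i (`|partial i f x| + 1).
have B0 : 0 <= B by apply: sumr_ge0 => i _; rewrite addr_ge0.
have ci i : \forall y \near x, `|partial i f y| <= B.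
  have ci : {for x, continuous (partial i f)}.
    exact/differentiable_continuous/(smooth_differentiable (smooth_partial i sf) Ux).
  have /cvgrPdist_lt/(_ _ ltr01) := ci; apply: filterS => y yx.
  apply: (@le_trans _ _ (`|partial i f x| + 1)).
    have := lerB_dist (partial i f y) (partial i f x); rewrite distrC; lra.
  rewrite /B (bigD1 i)//= lerDl; apply: sumr_ge0 => j _; exact: addr_ge0.
have : \forall y \near x, U y /\ forall i, `|partial i f y| <= B.
  near=> y; split; first by near: y; exact: open_nbhs_nbhs.
  by near: y; apply: filter_forall.
move=> /nbhs_ballP[r r0 H]; exists r, (n%:R * B); split=> //.
- by rewrite mulr_ge0.
- by move=> y /H[].
- apply: mean_value_ball => // y /H[Uy pB]; split=> //.
  exact: smooth_differentiable sf Uy.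
Unshelve. all: by end_near. Qed.

Lemma norm_lsubmx m p (w : 'rV[R]_(m + p)) : `|lsubmx w| <= `|w|.
Proof. by apply: norm_row_le => // i j; rewrite mxE; exact: norm_entry. Qed.

Lemma norm_rsubmx m p (w : 'rV[R]_(m + p)) : `|rsubmx w| <= `|w|.
Proof. by apply: norm_row_le => // i j; rewrite mxE; exact: norm_entry. Qed.

Lemma is_derive_entries m p (M : R -> 'M[R]_(m, p)) (t : R) (D : 'M[R]_(m, p)) :
  is_derive t 1 M D <-> forall i j, is_derive t 1 (fun s => M s i j) (D i j).
Proof.
split=> [[dM <-] i j|H].
  apply: DeriveDef; first by move/derivable_mxP: dM.
  by rewrite derive_mx// mxE.
have dM : derivable M t 1 by apply/derivable_mxP => i j; have [] := H i j.
by apply: DeriveDef => //; rewrite derive_mx//; apply/matrixP => i j; rewrite mxE; have [] := H i j.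
Qed.

(** For the Christoffel matrices this is Gamma_ij^k v^i v^j, the quadratic term of the geodesic
    equation. *)
Definition quadratic_field (S : 'I_n -> 'rV[R]_n -> 'M[R]_n) y v : 'rV[R]_n :=
  \sum_i v 0 i *: (v *m S i y).

(** A first order system for the pair (y, v). Its field is quadratic in v and is controlled only on
    U, so position and velocity are both clamped to boxes, which makes it globally Lipschitz. By
    continuity the solution stays in the boxes for a short time, and there it solves the original
    equation. *)
Lemma second_order_ode U (S : 'I_n -> 'rV[R]_n -> 'M[R]_n) x v0 : open U ->
  (forall i, smooth_mx U (S i)) -> U x ->
  exists (e : R) (y v : R -> 'rV[R]_n), [/\ 0 < e, y 0 = x, v 0 = v0 &
    forall t : R, - e < t < e -> [/\ U (y t), is_derive t 1 y (v t) &
      is_derive t 1 v (- quadratic_field S (y t) (v t))]].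
Proof.
move=> oU sS Ux.
have [rC rCP] : {rC : 'I_n * 'I_n * 'I_n -> R * R & forall k, [/\ 0 < (rC k).1, 0 <= (rC k).2,
    forall y, ball x (rC k).1 y -> U y & forall a b, ball x (rC k).1 a -> ball x (rC k).1 b ->
      `|S k.1.1 b k.1.2 k.2 - S k.1.1 a k.1.2 k.2| <= (rC k).2 * `|b - a|]}.
  apply: (@choice _ _ (fun k rC => [/\ 0 < rC.1, 0 <= rC.2,
    forall y, ball x rC.1 y -> U y & forall a b, ball x rC.1 a -> ball x rC.1 b ->
      `|S k.1.1 b k.1.2 k.2 - S k.1.1 a k.1.2 k.2| <= rC.2 * `|b - a|])) => k.
  have [r [C H]] := smooth_locally_lipschitz oU (sS k.1.1 k.1.2 k.2) Ux.
  by exists (r, C).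
have [r0 r00 r0U] : exists2 r : R, 0 < r & forall y, ball x r y -> U y.
  have /nbhs_ballP[r r0 Br] : nbhs x U by exact: open_nbhs_nbhs.
  by exists r.
pose r1 := \big[Num.min/r0]_k (rC k).1.
have r10 : 0 < r1 by apply/bigmin_gtP; split=> // k _; have [] := rCP k.
(* Half of the common radius: the closed box of radius r then lies in each of the open balls. *)
pose r := r1 / 2.
have rpos : 0 < r by rewrite divr_gt0.
have rr1 : r < r1 by rewrite ltr_pdivrMr// ltr_pMr// ltr1n.
have rr0 : r < r0 by apply: (lt_le_trans rr1); exact: bigmin_le_id.
have rrk k : r < (rC k).1 by apply: (lt_le_trans rr1); exact: bigmin_le_cond.
pose cy (w : 'rV[R]_(n + n)) := clamp_box x r (lsubmx w).
pose cv (w : 'rV[R]_(n + n)) := clamp_box v0 1 (rsubmx w).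
pose F w := row_mx (cv w) (- quadratic_field S (cy w) (cv w)).
have lv j : bounded_lipschitz (fun w => cv w 0 j).
  apply: (@clamp_box_bounded_lipschitz R n (n + n) rsubmx v0 1 (fun v => v 0 j) 1) => //.
    exact: norm_rsubmx.
  move=> y z _ _; rewrite mul1r.
  have -> : y 0 j - z 0 j = (y - z) 0 j by rewrite !mxE.
  exact: norm_entry.
have lS i j k : bounded_lipschitz (fun w => S i (cy w) j k).
  have [_ C0 _ H] := rCP (i, j, k).
  apply: (@clamp_box_bounded_lipschitz R n (n + n) lsubmx x r (fun y => S i y j k)
    (rC (i, j, k)).2 (ltW rpos) C0); first exact: norm_lsubmx.
  move=> y z yx zx; apply: H; rewrite -ball_normE /= distrC.
    exact: le_lt_trans zx (rrk _).
  exact: le_lt_trans yx (rrk _).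
have [L L0 LF] : exists2 L : R, 0 <= L & forall u v : 'rV[R]_(n + n), `|F u - F v| <= L * `|u - v|.
  apply: bounded_lipschitz_row => j; rewrite -(splitK j); case: (fintype.split j) => k /=.
    by under eq_fun do rewrite row_mxEl; exact: lv.
  under eq_fun do rewrite row_mxEr mxE /quadratic_field summxE -sumrN.
  apply: bounded_lipschitz_sum => i.
  under eq_fun do rewrite mxE [X in _ * X]mxE -mulN1r.
  apply: bounded_lipschitzM; first exact: bounded_lipschitz_cst.
  apply: bounded_lipschitzM; first exact: lv.
  by apply: bounded_lipschitz_sum => l; exact: bounded_lipschitzM.
have [e1 [w [e10 w0 dw]]] := picard_lindelof (row_mx x v0) L0 LF.
have cw : {for 0, continuous w}.
  apply/differentiable_continuous/derivable1_diffP.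
  by have [|] := dw 0; rewrite ?oppr_lt0 ?e10.
have m0 : 0 < Num.min r 1 by rewrite lt_min rpos ltr01.
have /cvgrPdist_lt/(_ _ m0)/nbhs_ballP[e2 e20 we] := cw.
rewrite w0 in we.
pose e := Num.min e1 e2.
exists e, (lsubmx \o w), (rsubmx \o w); split.
- by rewrite lt_min e10.
- by rewrite /= w0 row_mxKl.
- by rewrite /= w0 row_mxKr.
move=> t; rewrite -ltr_norml lt_min => /andP[te1 te2].
have := we t; rewrite -ball_normE /= sub0r normrN => /(_ te2); rewrite lt_min => /andP[wr w1].
have ylt : `|lsubmx (w t) - x| < r.
  have -> : lsubmx (w t) - x = - lsubmx (row_mx x v0 - w t).
    by rewrite linearB /= row_mxKl opprB.
  by rewrite normrN; exact: le_lt_trans (norm_lsubmx _) wr.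
have vlt : `|rsubmx (w t) - v0| < 1.
  have -> : rsubmx (w t) - v0 = - rsubmx (row_mx x v0 - w t).
    by rewrite linearB /= row_mxKr opprB.
  by rewrite normrN; exact: le_lt_trans (norm_rsubmx _) w1.
have cyE : cy (w t) = lsubmx (w t) by rewrite /cy clamp_box_id// ltW.
have cvE : cv (w t) = rsubmx (w t) by rewrite /cv clamp_box_id// ltW.
have := dw t; rewrite -ltr_norml => /(_ te1) /is_derive_entries dt.
split.
- by apply: r0U; rewrite -ball_normE /= distrC (lt_trans ylt).
- apply/is_derive_entries => i j; have := dt i (lshift n j).
  rewrite /F row_mxEl cvE; rewrite (_ : (fun s => w s i _) = (fun s => (lsubmx \o w) s i j))//.
  by apply/funext => s; rewrite /= mxE.
- apply/is_derive_entries => i j; have := dt i (rshift n j).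
  rewrite /F row_mxEr cvE cyE; rewrite (_ : (fun s => w s i _) = (fun s => (rsubmx \o w) s i j))//.
  by apply/funext => s; rewrite /= mxE.
Qed.

End SecondOrderODE.

(** * Curvature *)

Section CurvatureAlgebra.
Context {R : realType} {n : nat}.

(** Testing v = e_i + s e_j is enough: s = 0 gives T_ii^k = 0 for k different from i, s = 1 the
    vanishing for three distinct indices, and s = 1 together with s = -1 the relation T_ij^j =
    T_ii^i / 2. *)
Lemma weyl_projective (T : 'I_n -> 'M[R]_n) :
  (forall i j, row j (T i) = row i (T j)) ->
  (forall v : 'rV[R]_n, exists rho, \sum_i v 0 i *: (v *m T i) = rho *: v) ->
  exists psi : 'rV[R]_n, forall i, T i = (psi 0 i)%:M + psi^T *m delta_mx 0 i.
Proof.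
move=> symT parT.
have sT i j k : T i j k = T j i k by move: (symT i j) => /rowP/(_ k); rewrite !mxE.
have dd (i k : 'I_n) : (delta_mx 0 i : 'rV[R]_n) 0 k = (k == i)%:R by rewrite mxE.
have Q i j (s : R) k : (\sum_m (delta_mx 0 i + s *: delta_mx 0 j : 'rV[R]_n) 0 m *:
     ((delta_mx 0 i + s *: delta_mx 0 j : 'rV[R]_n) *m T m)) 0 k =
    T i i k + 2 * s * T i j k + s ^+ 2 * T j j k.
  rewrite summxE.
  transitivity (\sum_m (T m i k + s * T m j k) * (m == i)%:R
                + s * \sum_m (T m i k + s * T m j k) * (m == j)%:R).
    rewrite mulr_sumr -big_split; apply: eq_bigr => m _ /=.
    rewrite mulmxDl -scalemxAl -!rowE !mxE; ring.
  have D (F : 'I_n -> R) l : \sum_m F m * (m == l)%:R = F l.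
    rewrite (bigD1 l)//= eqxx mulr1 big1 ?addr0// => m /negbTE ->.
    by rewrite mulr0.
  by rewrite !D (sT j i k); ring.
have P i j s : exists rho, forall k,
    T i i k + 2 * s * T i j k + s ^+ 2 * T j j k = rho * ((k == i)%:R + s * (k == j)%:R).
  have [rho E] := parT (delta_mx 0 i + s *: delta_mx 0 j); exists rho => k.
  by rewrite -Q E !mxE.
have diag i k : k != i -> T i i k = 0.
  move=> /negbTE ki; have [rho /(_ k)] := P i i 0.
  by rewrite ki !mulr0 mul0r !addr0 expr0n /= mul0r addr0 mulr0.
have off i j k : i != j -> k != i -> k != j -> T i j k = 0.
  move=> ij ki kj; have [rho /(_ k)] := P i j 1.
  rewrite (negbTE ki) (negbTE kj) (diag _ _ ki) (diag _ _ kj) /=; lra.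
have half i j : i != j -> T i j j = T i i i / 2.
  move=> ij; have ji : j != i by rewrite eq_sym.
  have [r1 E1] := P i j 1; have [r2 E2] := P i j (-1).
  have := E1 i; have := E1 j; have := E2 i; have := E2 j.
  rewrite !eqxx (negbTE ij) (negbTE ji) (diag _ _ ij) (diag _ _ ji) /=; lra.
(* The required form gives T_ii^i = 2 psi_i, which forces this witness. *)
exists (\row_i (T i i i / 2)) => i; apply/matrixP => j k.
rewrite !mxE big_ord1 !mxE eqxx /=.
have [->|ij] := eqVneq i j; have [->|ki] := eqVneq k j.
- by rewrite mulr1n mulr1; field.
- by rewrite diag// mulr0n mulr0 addr0.
- by rewrite half// eq_sym (negbTE ij) mulr0 addr0.
rewrite mulr0n add0r; have [->|kj] := eqVneq k i.
  by rewrite sT half 1?eq_sym// mulr1.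
by rewrite mulr0 off.
Qed.

(** The classical octahedron argument: the four cyclic identities, one for each choice of the index
    left fixed, are brought to common terms by skew-symmetry and combined linearly. *)
Lemma pair_symmetry (I : Type) (T : I -> I -> I -> I -> R) :
  (forall i j k l, T i j k l = - T j i k l) ->
  (forall i j k l, T i j k l = - T i j l k) ->
  (forall i j k l, T i j k l + T j k i l + T k i j l = 0) ->
  forall i j k l, T i j k l = T k l i j.
Proof.
move=> a1 a2 B i j k l.
have := B i j k l; have := B j k l i; have := B k l i j; have := B l i j k.
rewrite (a2 i j l k) (a2 j k l i) (a1 l i j k) (a1 l i k j).
rewrite (a2 i l k j) (a1 l j k i) (a2 j l k i) (a2 k l j i) (a1 i k l j) (a2 k i l j).
lra.
Qed.

Lemma sum_delta_mul (F : 'I_n -> R) (i : 'I_n) : \sum_a F a * (a == i)%:R = F i.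
Proof.
rewrite (bigD1 i)//= eqxx mulr1 big1 ?addr0// => a /negbTE ->.
by rewrite mulr0.
Qed.

Lemma sum_deltaC_mul (F : 'I_n -> R) (i : 'I_n) : \sum_a F a * (i == a)%:R = F i.
Proof. by rewrite -[RHS](sum_delta_mul F i); under eq_bigr do rewrite eq_sym. Qed.

(* The tensor N_l^i delta_k^j + N_l^j delta_k^i - N_k^i delta_l^j - N_k^j delta_l^i
   is contracted over j = k before and after applying J to the indices l, k. *)
Lemma J_invariant_scalar (J N : 'M[R]_n) : (2 < n)%N ->
  J *m J = - 1%:M -> \tr J = 0 -> \tr (J *m N) = 0 ->
  (forall l k i j, \sum_a \sum_b J l a * (J k b *
     (N a i * (b == j)%:R + N a j * (b == i)%:R - N b i * (a == j)%:R - N b j * (a == i)%:R))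
   = N l i * (k == j)%:R + N l j * (k == i)%:R - N k i * (l == j)%:R - N k j * (l == i)%:R) ->
  N = (\tr N / n%:R)%:M.
Proof.
move=> n2 JJ trJ trJN inv; pose M := J *m N.
have inner a k i j : \sum_b J k b *
     (N a i * (b == j)%:R + N a j * (b == i)%:R - N b i * (a == j)%:R - N b j * (a == i)%:R) =
    N a i * J k j + N a j * J k i - (a == j)%:R * M k i - (a == i)%:R * M k j.
  transitivity (\sum_b (N a i * (J k b * (b == j)%:R) + N a j * (J k b * (b == i)%:R)
     - (a == j)%:R * (J k b * N b i) - (a == i)%:R * (J k b * N b j))).
    by apply: eq_bigr => b _; ring.
  by rewrite !big_split /= !sumrN -!mulr_sumr !sum_delta_mul !mxE.
have outer l k i j : \sum_a \sum_b J l a * (J k b *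
     (N a i * (b == j)%:R + N a j * (b == i)%:R - N b i * (a == j)%:R - N b j * (a == i)%:R)) =
    J k j * M l i + J k i * M l j - M k i * J l j - M k j * J l i.
  transitivity (\sum_a (J k j * (J l a * N a i) + J k i * (J l a * N a j)
     - M k i * (J l a * (a == j)%:R) - M k j * (J l a * (a == i)%:R))).
    by apply: eq_bigr => a _; rewrite -mulr_sumr inner; ring.
  by rewrite !big_split /= !sumrN -!mulr_sumr !sum_delta_mul !mxE.
(* The contraction over j = k. Since [J] and [M] have trace 0, the left side of the invariance
   contracts to MJ - JM, and JM = -N. *)
have E : M *m J + N = n%:R *: N - (\tr N)%:M.
  have JM : J *m M = - N by rewrite /M mulmxA JJ mulNmx mul1mx.
  rewrite -[X in _ + X]opprK -JM; have trM : \tr M = 0 by []; clearbody M; apply/matrixP => l i.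
  have -> : (M *m J - J *m M) l i =
      \sum_k (J k k * M l i + J k i * M l k - M k i * J l k - M k k * J l i).
    rewrite !big_split /= !sumrN -!mulr_suml -/(mxtrace J) -/(mxtrace M) trJ trM.
    rewrite !mul0r add0r subr0 mxE [X in _ + X]mxE mxE [X in _ - X]mxE; congr (_ - _).
      by apply: eq_bigr => k _; rewrite mulrC.
    by apply: eq_bigr => k _; rewrite mulrC.
  under eq_bigr do rewrite -outer inv.
  rewrite !big_split /= !sumrN -!mulr_suml -/(mxtrace N).
  have -> : \sum_(k < n) N l i * (k == k)%:R = n%:R * N l i.
    under eq_bigr do rewrite eqxx mulr1; by rewrite sumr_const card_ord mulr_natl.
  by rewrite sum_delta_mul sum_deltaC_mul !mxE mulr_natr; ring.
have F : J *m N *m J = (n%:R - 1) *: N - (\tr N)%:M.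
  by apply/eqP; rewrite -(inj_eq (addIr N)) E scalerBl scale1r addrAC subrK.
(* This is [F] multiplied by [J] on both sides. Eliminating JNJ between the two leaves n (n - 2) N =
   (n - 2) tr N Id, where [2 < n] allows the division. *)
have G : N = (n%:R - 1) *: (J *m N *m J) + (\tr N)%:M.
  have := congr1 (fun A => J *m A *m J) F.
  rewrite /= !mulmxA JJ !mulNmx mul1mx -mulmxA JJ mulmxN mulmx1 opprK => {1}->.
  by rewrite mulmxBr mulmxBl -scalemxAr -scalemxAl (scalar_mxC _ J) -(mulmxA _ J J) JJ mulmxN mulmx1 opprK.
have n1 : (n%:R * (n%:R - 2) : R) != 0.
  by rewrite mulf_neq0// ?subr_eq0 ?pnatr_eq0 ?eqr_nat; case: n n2 => [|[|[]]].
have m0 : (n%:R : R) != 0 by rewrite pnatr_eq0; case: n n2.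
rewrite mulrC -scale_scalar_mx; rewrite F in G.
move: {E F} (_%:M) G => T G; apply/matrixP => l i; move: G => /matrixP/(_ l i).
rewrite !mxE; move: (N l i) (T l i) (n%:R) m0 n1 => y t m m0 n1 G.
apply: (mulfI n1); transitivity ((m - 2) * t); last by field.
apply/eqP; rewrite -subr_eq0; apply/eqP; move/eqP: G; rewrite -subr_eq0 => /eqP G.
by rewrite -[RHS]oppr0 -G; ring.
Qed.

(** Contracting over j = k turns the left side into m_i, because tr J = 0 and J^2 = -1, and the
    right side into (n - 1) m_i; hence (n - 2) m_i = 0. It will be applied to the gradient of mu. *)
Lemma J_invariant_gradient (J : 'M[R]_n) (m : 'I_n -> R) : (2 < n)%N ->
  J *m J = - 1%:M -> \tr J = 0 ->
  (forall i j k, \sum_a \sum_b J i a * (J j b *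
     (m a * (b == k)%:R - m b * (a == k)%:R)) =
     m i * (j == k)%:R - m j * (i == k)%:R) ->
  forall i, m i = 0.
Proof.
move=> n2 JJ trJ inv i.
pose p i := \sum_a J i a * m a.
have outer l k j : \sum_a \sum_b J l a * (J k b *
     (m a * (b == j)%:R - m b * (a == j)%:R)) = J k j * p l - p k * J l j.
  transitivity (\sum_a (J k j * (J l a * m a) - p k * (J l a * (a == j)%:R))).
    apply: eq_bigr => a _.
    transitivity (\sum_b (J l a * m a * (J k b * (b == j)%:R)
         - J l a * (a == j)%:R * (J k b * m b))).
      by apply: eq_bigr => b _; ring.
    by rewrite big_split /= sumrN -!mulr_sumr sum_delta_mul -/(p k); ring.
  by rewrite big_split /= sumrN -!mulr_sumr sum_delta_mul.
have pp l : \sum_a J l a * p a = - m l.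
  transitivity (\sum_b (J *m J) l b * m b).
    under eq_bigr do rewrite /p mulr_sumr.
    rewrite exchange_big; apply: eq_bigr => b _ /=.
    rewrite mxE mulr_suml; apply: eq_bigr => a _; ring.
  rewrite JJ; under eq_bigr do rewrite !mxE mulrC mulrN.
  by rewrite sumrN sum_deltaC_mul.
have : \sum_k (J k k * p i - p k * J i k) = \sum_k (m i * (k == k)%:R - m k * (i == k)%:R).
  by apply: eq_bigr => k _; rewrite -outer inv.
rewrite !big_split /= !sumrN -!mulr_suml -/(mxtrace J) trJ mul0r add0r sum_deltaC_mul.
have -> : \sum_k p k * J i k = - m i.
  by rewrite -pp; apply: eq_bigr => k _; rewrite mulrC.
rewrite opprK.
under eq_bigr do rewrite eqxx mulr1.
rewrite sumr_const card_ord -[m i *+ n]mulr_natr => E.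
have n2' : (n%:R - 2 : R) != 0.
  by rewrite subr_eq0 eqr_nat; case: n n2 => [|[|[]]].
apply: (mulfI n2'); rewrite mulr0; lra.
Qed.

End CurvatureAlgebra.

Lemma trmxD (R : realType) m p (A B : 'M[R]_(m, p)) : (A + B)^T = A^T + B^T.
Proof. exact: linearD. Qed.

Lemma trmxN (R : realType) m p (A : 'M[R]_(m, p)) : (- A)^T = - A^T.
Proof. exact: linearN. Qed.

Ltac mx_expand := rewrite ?(trmxD, trmxN, trmx_mul, trmxK, mulmxDl, mulmxDr,
  mulmxN, mulNmx, mulmxA, opprD, opprK, addrA).

(* Products of matrices become opaque, so that a linear identity between them
   can be checked entrywise. *)
Ltac mx_atoms := repeat match goal with
  |- context [@mulmx ?S ?m ?n ?p ?A ?B] => let X := fresh in set X := (@mulmx S m n p A B); move: X; intro end.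

Ltac mx_linear := mx_expand; mx_atoms;
  apply/matrixP; let a := fresh in let b := fresh in move=> a b; rewrite !mxE; ring.

Ltac mx_linear_from := mx_expand; mx_atoms;
  let E := fresh in move=> /matrixP E; apply/matrixP;
  let a := fresh in let b := fresh in move=> a b; move: (E a b); rewrite !mxE; lra.

Section Curvature.
Context {R : realType} {n : nat}.
Implicit Types (U : set 'rV[R]_n) (x : 'rV[R]_n) (G : 'rV[R]_n -> 'M[R]_n).

(** The point comes last, so that [gamma G i] is a matrix field to which [partial_mx] applies. *)
Definition gamma G i y : 'M[R]_n := gamma_mx G y i.

(** Normalised by v R_ij = [nabla_i, nabla_j] v for row vectors v. Matrices act on the right, which
    reverses the usual order of the products. *)
Definition curvature G x i j : 'M[R]_n :=
  partial_mx i (gamma G j) x - partial_mx j (gamma G i) x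
  + gamma G j x *m gamma G i x - gamma G i x *m gamma G j x.

Lemma smooth_gamma U G i : open U -> metric_on U G -> smooth_mx U (gamma G i).
Proof.
move=> oU [sG mG] j k; under eq_fun do rewrite /gamma gamma_mxE.
apply: smoothM => //; first exact: smooth_cst.
apply: smooth_sum => // l; apply: smoothM => //; last first.
  by apply: smooth_invmx => // x /mG[].
apply: smoothD => //; last by apply: smoothN => //; apply: smooth_partial; exact: sG.
by apply: smoothD => //; apply: smooth_partial; exact: sG.
Qed.

Lemma gammaC U G x i j k : open U -> metric_on U G -> U x ->
  gamma G i x j k = gamma G j x i k.
Proof. by move=> oU mG Ux; move: (gamma_mx_sym i j oU mG Ux) => /rowP/(_ k); rewrite !mxE. Qed.

Lemma delta_gammaC U G x i j : open U -> metric_on U G -> U x ->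
  delta_mx 0 j *m gamma G i x = (delta_mx 0 i : 'rV[R]_n) *m gamma G j x.
Proof. by move=> oU mG Ux; rewrite -!rowE; exact: gamma_mx_sym oU mG Ux. Qed.

Lemma gamma_metric U G x i : open U -> metric_on U G -> U x ->
  partial_mx i G x = gamma G i x *m G x + G x *m (gamma G i x)^T.
Proof.
move=> oU mG Ux; rewrite (gamma_mx_metric i oU mG Ux) -/(gamma G i x) trmx_mul.
by have [_ /(_ x Ux)[-> _]] := mG.
Qed.

Lemma curvature_antisym G x i j : curvature G x i j = - curvature G x j i.
Proof. rewrite /curvature; mx_linear. Qed.

Lemma curvature_bianchi U G x i j k l : open U -> metric_on U G -> U x ->
  curvature G x i j k l + curvature G x j k i l + curvature G x k i j l = 0.
Proof.
move=> oU mG Ux.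
(* Row c of [P a b] is nabla_a nabla_b e_c. It is symmetric in b and c because the torsion vanishes,
   and the cyclic sum then cancels. *)
pose P i j := partial_mx i (gamma G j) x + gamma G j x *m gamma G i x.
have PC a b c : P a b c l = P a c b l.
  rewrite mxE [RHS]mxE; congr (_ + _).
    rewrite !partial_mxE; apply: (partial_eq _ oU Ux) => y Uy.
    exact: gammaC oU mG Uy.
  by rewrite mxE [RHS]mxE; apply: eq_bigr => m _; rewrite (gammaC b c m oU mG Ux).
have KP a b c : curvature G x a b c l = P a b c l - P b a c l.
  rewrite /curvature /P; mx_atoms; rewrite !mxE; ring.
by rewrite !KP (PC i j k) (PC j i k) (PC k i j); ring.
Qed.

(** The Ricci identity for the parallel tensor [G]: the partial derivatives of [gamma_metric] are
    taken and the second partial derivatives of [G] commute. *)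
Lemma curvature_skew U G x i j : open U -> metric_on U G -> U x ->
  curvature G x i j *m G x + G x *m (curvature G x i j)^T = 0.
Proof.
move=> oU mG Ux.
have [sG /(_ x Ux)[GT _]] := mG.
have dG := smooth_mx_differentiable sG Ux.
have dgam k := smooth_mx_differentiable (smooth_gamma k oU mG) Ux.
have E k l : partial_mx k (partial_mx l G) x =
   partial_mx k (gamma G l) x *m G x + gamma G l x *m partial_mx k G x
   + (partial_mx k G x *m (gamma G l x)^T + G x *m (partial_mx k (gamma G l) x)^T).
  rewrite (partial_mx_eq k oU Ux (fun y Uy => gamma_metric l oU mG Uy)).
  rewrite partial_mxD; first last.
  - apply: smooth_mx_differentiable Ux; apply: smooth_mxM => //.
    by apply: smooth_mxT; exact: smooth_gamma.
  - apply: smooth_mx_differentiable Ux; apply: smooth_mxM => //.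
    exact: smooth_gamma.
  rewrite partial_mxM// partial_mxM ?partial_mxT//.
  by apply: smooth_mx_differentiable Ux; apply: smooth_mxT; exact: smooth_gamma.
have := partial_mxC i j oU sG Ux.
rewrite !E !(gamma_metric _ oU mG Ux) /curvature.
mx_linear_from.
Qed.

Lemma curvature_pair U G x i j k l : open U -> metric_on U G -> U x ->
  (curvature G x i j *m G x) k l = (curvature G x k l *m G x) i j.
Proof.
move=> oU mG Ux; have [_ /(_ x Ux)[GT _]] := mG.
apply: (@pair_symmetry R 'I_n (fun i j k l => (curvature G x i j *m G x) k l)) => {}i {}j {}k {}l.
- by rewrite curvature_antisym mulNmx mxE.
- have : (curvature G x i j *m G x) + (curvature G x i j *m G x)^T = 0.
    by rewrite trmx_mul GT (curvature_skew i j oU mG Ux).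
  by move: (_ *m _) => A /matrixP/(_ k l); rewrite !mxE => /eqP; rewrite addr_eq0 => /eqP.
- rewrite !mxE -!big_split /= big1// => m _.
  by rewrite -!mulrDl (curvature_bianchi i j k m oU mG Ux) mul0r.
Qed.

(** [J] is a constant matrix here, so its commutation with the Christoffel matrices passes to their
    derivatives and products. *)
Lemma curvature_comm U G (J : 'M[R]_n) x i j : open U -> metric_on U G -> U x ->
  (forall y, U y -> forall i, J *m gamma G i y = gamma G i y *m J) ->
  J *m curvature G x i j = curvature G x i j *m J.
Proof.
move=> oU mG Ux JG.
have dgam k := smooth_mx_differentiable (smooth_gamma k oU mG) Ux.
have dc : differentiable_mx (fun=> J) x by move=> a b; exact: differentiable_cst.
have E k l : J *m partial_mx k (gamma G l) x = partial_mx k (gamma G l) x *m J.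
  have := partial_mx_eq k oU Ux (fun y Uy => JG y Uy l).
  by rewrite !partial_mxM// !partial_mx_cst mul0mx add0r mulmx0 addr0.
have JG' := JG x Ux.
rewrite /curvature !(mulmxDl, mulmxDr, mulNmx, mulmxN) !E !mulmxA !JG'.
by rewrite -!mulmxA !JG'.
Qed.

(** [J] is orthogonal and commutes with the curvature endomorphisms, so the lowered curvature is
    J-invariant in its last two indices; pair symmetry moves this to the first two. *)
Lemma curvature_J_invariant U G (J : 'M[R]_n) x i j : open U -> metric_on U G -> U x ->
  J *m G x *m J^T = G x ->
  (forall y, U y -> forall i, J *m gamma G i y = gamma G i y *m J) ->
  \sum_a \sum_b (J i a * J j b) *: curvature G x a b = curvature G x i j.
Proof.
move=> oU mG Ux oJ JG; have [_ /(_ x Ux)[_ uG]] := mG.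
rewrite -[LHS](mulmxK uG) -[RHS](mulmxK uG); congr (_ *m _).
apply/matrixP => k l; rewrite (curvature_pair i j k l oU mG Ux).
have -> : curvature G x k l *m G x = J *m (curvature G x k l *m G x) *m J^T.
  by rewrite mulmxA (curvature_comm k l oU mG Ux JG) -!mulmxA (mulmxA J) oJ.
rewrite mulmx_suml summxE mxE.
under [RHS]eq_bigr do rewrite mxE mulr_suml.
rewrite exchange_big /=; apply: eq_bigr => a _.
rewrite mulmx_suml summxE; apply: eq_bigr => b _.
by rewrite -scalemxAl mxE (curvature_pair a b k l oU mG Ux) [J^T _ _]mxE mulrAC.
Qed.

End Curvature.

(** * Projectively related metrics *)

Lemma invmx_mul (R : realType) n (A B : 'M[R]_n) : A \in unitmx -> B \in unitmx ->
  invmx (A *m B) = invmx B *m invmx A.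
Proof.
move=> uA uB; have uAB : A *m B \in unitmx by rewrite unitmx_mul uA.
by rewrite -[RHS](mulKmx uAB) (mulmxA (A *m B)) (mulmxK uB) (mulmxV uA) mulmx1.
Qed.

Lemma det_neq0 (R : realType) n (A : 'M[R]_n) : A \in unitmx -> \det A != 0.
Proof. by rewrite unitmxE unitfE. Qed.

Lemma mxtraceN (R : realType) n (A : 'M[R]_n) : \tr (- A) = - \tr A.
Proof. exact: linearN. Qed.

Section ProjectiveWeights.
Context {R : realType} {n : nat}.
Implicit Types (G H P : 'M[R]_n).

(* The factor e^{2 phi} for which e^{2 phi} H^-1 solves the linear
   metrisability equation of G. *)
Definition weight G H : R :=
  expR ((ln (\det H ^+ 2) - ln (\det G ^+ 2)) / (2 * n.+1%:R)).

Definition half_trace G H : R := 2^-1 * \tr (weight G H *: invmx H *m G).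

(** Both determinants are multiplied by (det P)^2, and the factors cancel in the difference of
    logarithms. *)
Lemma weight_covariant G H P : G \in unitmx -> H \in unitmx -> P \in unitmx ->
  weight (P *m G *m P^T) (P *m H *m P^T) = weight G H.
Proof.
have E A : A \in unitmx -> P \in unitmx ->
    ln (\det (P *m A *m P^T) ^+ 2) = ln (\det A ^+ 2) + ln (\det P ^+ 4).
  move=> /det_neq0 a0 /det_neq0 p0; rewrite !det_mulmx det_tr.
  move: (\det A) (\det P) a0 p0 => a p a0 p0.
  rewrite -lnM ?posrE ?exprn_even_gt0//; congr ln; ring.
by move=> uG uH uP; rewrite /weight !E// opprD addrACA subrr addr0.
Qed.

Lemma half_trace_covariant G H P : G \in unitmx -> H \in unitmx -> P \in unitmx ->
  half_trace (P *m G *m P^T) (P *m H *m P^T) = half_trace G H.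
Proof.
move=> uG uH uP; rewrite /half_trace weight_covariant// -!scalemxAl !mxtraceZ.
congr (_ * (_ * _)); have uPT : P^T \in unitmx by rewrite unitmx_tr.
rewrite !invmx_mul ?unitmx_mul ?uP//= !mulmxA mulmxKV// -!mulmxA mxtrace_mulC -!mulmxA.
by rewrite mulmxV ?mulmx1.
Qed.

End ProjectiveWeights.

Section ProjectivePair.
Context {R : realType} {n : nat}.
Implicit Types (U : set 'rV[R]_n) (x : 'rV[R]_n) (G H : 'rV[R]_n -> 'M[R]_n).

(** [psi] is required only pointwise, as the geodesics provide it. Its smoothness comes from the
    trace formula [proj_form]. *)
Definition projectively_related U G H : Prop := forall x, U x ->
  exists psi : 'rV[R]_n, forall i,
    gamma H i x = gamma G i x + (psi 0 i)%:M + psi^T *m delta_mx 0 i.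

(** The trace of psi_i Id + psi^T e_i is (n + 1) psi_i, whence the divisor. *)
Definition proj_form G H y : 'rV[R]_n :=
  \row_i ((\tr (gamma H i y) - \tr (gamma G i y)) / n.+1%:R).

Definition proj_inverse G H y : 'M[R]_n := weight (G y) (H y) *: invmx (H y).

Definition proj_vector G H y : 'rV[R]_n := - (proj_form G H y *m proj_inverse G H y).

Lemma proj_formP U G H x i : projectively_related U G H -> U x ->
  gamma H i x = gamma G i x + (proj_form G H x 0 i)%:M + (proj_form G H x)^T *m delta_mx 0 i.
Proof.
move=> /(_ x) GH /GH[psi E]; suff -> : proj_form G H x = psi by [].
apply/rowP => j; rewrite mxE E !mxtraceD mxtrace_scalar mxtrace_mulC -rowE.
have -> : \tr (row j psi^T) = psi 0 j by rewrite trace_mx11 mxE mxE.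
rewrite -natr1 -mulr_natr; move: (\tr _) (psi 0 j) => t p.
have n1 : n%:R + 1 != 0 :> R by rewrite natr1 pnatr_eq0.
by field.
Qed.

Lemma trace_gamma_form G H x i :
  \tr (gamma H i x) - \tr (gamma G i x) = n.+1%:R * proj_form G H x 0 i.
Proof. by rewrite mxE mulrC divfK// pnatr_eq0. Qed.

Lemma smooth_proj_form U G H : open U -> metric_on U G -> metric_on U H ->
  smooth_mx U (proj_form G H).
Proof.
move=> oU mG mH a b; under eq_fun do rewrite mxE.
apply: smoothM => //; last exact: smooth_cst.
apply: smoothD => //; last apply: smoothN => //.
  by apply: smooth_mxtrace => //; exact: smooth_gamma.
by apply: smooth_mxtrace => //; exact: smooth_gamma.
Qed.

Lemma smooth_ln_det U G : open U -> metric_on U G ->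
  smooth_on U (fun y => ln (\det (G y) ^+ 2)).
Proof.
move=> oU [sG mG] k; apply: times_differentiable_ln => //; last first.
  by move=> x /mG[_ /det_neq0 d0]; rewrite exprn_even_gt0.
by under eq_fun do rewrite expr2; apply: times_differentiableM => //; exact: smooth_det.
Qed.

Lemma smooth_weight U G H : open U -> metric_on U G -> metric_on U H ->
  smooth_on U (fun y => weight (G y) (H y)).
Proof.
move=> oU mG mH k; apply: times_differentiable_expR => //; move: k; apply: smoothM => //; last first.
  exact: smooth_cst.
by apply: smoothD => //; [|apply: smoothN => //]; exact: smooth_ln_det.
Qed.

Lemma smooth_proj_inverse U G H : open U -> metric_on U G -> metric_on U H ->
  smooth_mx U (proj_inverse G H).
Proof.
move=> oU mG [sH mH]; apply: smooth_mxZ => //; first exact: smooth_weight.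
by apply: smooth_invmx => // x /mH[].
Qed.

Lemma smooth_proj_vector U G H : open U -> metric_on U G -> metric_on U H ->
  smooth_mx U (proj_vector G H).
Proof.
move=> oU mG mH; apply: smooth_mxN => //; apply: smooth_mxM => //.
  exact: smooth_proj_form.
exact: smooth_proj_inverse.
Qed.

Lemma smooth_half_trace U G H : open U -> metric_on U G -> metric_on U H ->
  smooth_on U (fun y => half_trace (G y) (H y)).
Proof.
move=> oU mG mH; apply: smoothM => //; first exact: smooth_cst.
apply: smooth_mxtrace => //; apply: smooth_mxM => //; last by case: mG.
exact: smooth_proj_inverse.
Qed.

(** One factor 2 comes from the square of the determinant, the other from the two equal traces in
    [gamma_metric]. *)
Lemma partial_ln_det U G x i : open U -> metric_on U G -> U x ->
  partial i (fun y => ln (\det (G y) ^+ 2)) x = 4 * \tr (gamma G i x).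
Proof.
move=> oU mG Ux; have [sG /(_ x Ux)[GT uG]] := mG.
have dd := smooth_differentiable (smooth_det oU sG) Ux.
have d0 := det_neq0 uG.
have d2 : 0 < \det (G x) * \det (G x) by rewrite -expr2 exprn_even_gt0.
under eq_fun do rewrite expr2.
have dl := is_derive1_ln d2.
have dm : differentiable (fun y => \det (G y) * \det (G y)) x by exact: differentiableM.
rewrite (partial_comp1 i dm (@ex_derive _ _ _ _ _ _ _ dl)) partialM//.
rewrite derive1E derive_val (partial_det i (smooth_mx_differentiable sG Ux) uG).
have -> : \tr (invmx (G x) *m partial_mx i G x) = 2 * \tr (gamma G i x).
  rewrite (gamma_metric i oU mG Ux) mulmxDr mxtraceD mulKmx// mxtrace_tr.
  by rewrite mxtrace_mulC mulmxK//; ring.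
move: (\det (G x)) (\tr _) d0 => d t d0; by field.
Qed.

(** The exponent has derivative 4 (n + 1) psi_i / (2 (n + 1)) = 2 psi_i, which is what the
    normalisation of [weight] aims at. *)
Lemma partial_weight U G H x i : open U -> metric_on U G -> metric_on U H -> U x ->
  partial i (fun y => weight (G y) (H y)) x =
  2 * proj_form G H x 0 i * weight (G x) (H x).
Proof.
move=> oU mG mH Ux.
have dG := smooth_differentiable (smooth_ln_det oU mG) Ux.
have dH := smooth_differentiable (smooth_ln_det oU mH) Ux.
have dN := differentiableN dG.
have dB := differentiableD dH dN.
have dC : differentiable (fun=> (2 * n.+1%:R)^-1 : R) x by exact: differentiable_cst.
have dL := differentiableM dB dC.
rewrite (partial_comp1 i dL (@derivable_expR R _)) derive1E derive_val mulrC.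
congr (_ * _).
rewrite (partialM i dB dC) partial_cst mulr0 addr0 (partialD i dH dN) (partialN i dG).
rewrite !(partial_ln_det _ oU _ Ux)// -mulrBr trace_gamma_form.
have n1 : n.+1%:R != 0 :> R by rewrite pnatr_eq0.
by move: (n.+1%:R) (proj_form _ _ _ _ _) n1 => m p m0; field.
Qed.

(** The linear metrisability equation. The inverse of [H] is parallel for the connection of [H].
    Rewritten with that of [G], it acquires -2 psi_i times itself, which the derivative of the
    weight cancels, and two terms in psi b, which are those in lambda. *)
Lemma partial_proj_inverse U G H x i : open U -> metric_on U G -> metric_on U H ->
  projectively_related U G H -> U x ->
  partial_mx i (proj_inverse G H) x =
  (proj_vector G H x)^T *m delta_mx 0 i + (delta_mx 0 i)^T *m proj_vector G H x
  - (gamma G i x)^T *m proj_inverse G H x - proj_inverse G H x *m gamma G i x.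
Proof.
move=> oU mG mH GH Ux; have [sH mH'] := mH.
have [HT uH] := mH' x Ux.
have dw := smooth_differentiable (smooth_weight oU mG mH) Ux.
have uH' y : U y -> H y \in unitmx by move=> /mH'[].
have dI := smooth_mx_differentiable (smooth_invmx oU sH uH') Ux.
rewrite /proj_vector {1}/proj_inverse (partial_mxZ i dw dI).
rewrite (partial_weight i oU mG mH Ux) (partial_invmx i oU sH uH' Ux).
have E : invmx (H x) *m partial_mx i H x *m invmx (H x) =
    invmx (H x) *m gamma H i x + (gamma H i x)^T *m invmx (H x).
  by rewrite (gamma_metric i oU mH Ux) mulmxDr mulmxDl mulKmx// mulmxA mulmxK.
have IT : (invmx (H x))^T = invmx (H x) by rewrite trmx_inv HT.
have BT : (proj_inverse G H x)^T = proj_inverse G H x by rewrite linearZ /= IT.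
rewrite E scalerN scalerDr scalemxAl scalemxAr -scalerA -/(proj_inverse G H x).
rewrite (proj_formP i GH Ux) !trmxD tr_scalar_mx !(mulmxDl, mulmxDr).
rewrite mul_scalar_mx mul_mx_scalar.
mx_expand; rewrite BT; mx_atoms; apply/matrixP => a b; rewrite !mxE; ring.
Qed.

(** The Christoffel terms cancel in the trace because [G] is parallel; the two remaining traces are
    equal, hence the factor 1/2 in [half_trace]. *)
Lemma partial_half_trace U G H x i : open U -> metric_on U G -> metric_on U H ->
  projectively_related U G H -> U x ->
  partial i (fun y => half_trace (G y) (H y)) x = (proj_vector G H x *m G x) 0 i.
Proof.
move=> oU mG mH GH Ux; have [sG /(_ x Ux)[GT uG]] := mG.
have [_ /(_ x Ux)[HT _]] := mH.
have dG := smooth_mx_differentiable sG Ux.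
have dB := smooth_mx_differentiable (smooth_proj_inverse oU mG mH) Ux.
have BT : (proj_inverse G H x)^T = proj_inverse G H x by rewrite linearZ /= trmx_inv HT.
have dP : differentiable_mx (fun y => proj_inverse G H y *m G y) x.
  apply: smooth_mx_differentiable Ux; apply: smooth_mxM => //.
  exact: smooth_proj_inverse.
have dt : differentiable (fun y => \tr (proj_inverse G H y *m G y)) x.
  apply: smooth_differentiable Ux; apply: smooth_mxtrace => //.
  by apply: smooth_mxM => //; exact: smooth_proj_inverse.
have dC : differentiable (fun=> 2^-1 : R) x by exact: differentiable_cst.
rewrite (partialM i dC dt) partial_cst mul0r add0r (partial_mxtrace i dP).
rewrite (partial_mxM i dB dG) (partial_proj_inverse i oU mG mH GH Ux) (gamma_metric i oU mG Ux).
set v := proj_vector G H x; set B := proj_inverse G H x in BT *.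
have -> : (v *m G x) 0 i = \tr (v^T *m delta_mx 0 i *m G x).
  rewrite -mulmxA mxtrace_mulC -mxtrace_tr !trmx_mul trmxK GT trmx_delta mulmxA.
  by rewrite -colE trace_mx11 [RHS]mxE.
have T2 : \tr ((delta_mx 0 i)^T *m v *m G x) = \tr (v^T *m delta_mx 0 i *m G x).
  by rewrite -mxtrace_tr !trmx_mul trmxK GT mxtrace_mulC.
have T3 : \tr ((gamma G i x)^T *m B *m G x) = \tr (B *m G x *m (gamma G i x)^T).
  by rewrite -mulmxA mxtrace_mulC.
clearbody v B; mx_expand; rewrite !(mxtraceD, mxtraceN) T2 T3.
move: (\tr _) (\tr _) (\tr _) => t1 t2 t3; by field.
Qed.

End ProjectivePair.

(** * Integrability conditions and the Kähler case *)

Section KahlerLocal.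
Context {R : realType} {n : nat}.
Implicit Types (U : set 'rV[R]_n) (x : 'rV[R]_n) (G H : 'rV[R]_n -> 'M[R]_n).

Definition nabla G (v : 'rV[R]_n -> 'rV[R]_n) y : 'M[R]_n :=
  \matrix_(l, i) (partial_mx l v y + v y *m gamma G l y) 0 i.

Lemma row_nabla G v y l : row l (nabla G v y) = partial_mx l v y + v y *m gamma G l y.
Proof. by apply/rowP => i; rewrite mxE mxE. Qed.

Lemma smooth_nabla U G v : open U -> metric_on U G -> smooth_mx U v ->
  smooth_mx U (nabla G v).
Proof.
move=> oU mG sv l i; under eq_fun do rewrite mxE.
have : smooth_mx U (fun y => partial_mx l v y + v y *m gamma G l y).
  apply: smooth_mxD => //; first exact: smooth_partial_mx.
  by apply: smooth_mxM => //; exact: smooth_gamma.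
exact.
Qed.

(** For a gradient field, the lowered covariant derivative is the Hessian of [f], symmetric since
    the connection is torsion free. *)
Lemma nabla_sym U G v (f : 'rV[R]_n -> R) x : open U -> metric_on U G -> smooth_mx U v ->
  smooth_on U f -> (forall y, U y -> forall i, partial i f y = (v y *m G y) 0 i) -> U x ->
  (nabla G v x *m G x)^T = nabla G v x *m G x.
Proof.
move=> oU mG sv sf dfv Ux; have [sG _] := mG.
have dv := smooth_mx_differentiable sv Ux; have dG := smooth_mx_differentiable sG Ux.
have E l k : (nabla G v x *m G x) l k =
    partial l (partial k f) x - \sum_m (v x *m G x) 0 m * gamma G l x k m.
  have -> : partial l (partial k f) x = partial_mx l (fun y => v y *m G y) x 0 k.
    by rewrite partial_mxE; apply: (partial_eq _ oU Ux) => y Uy; exact: dfv.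
  rewrite (partial_mxM l dv dG) (gamma_metric l oU mG Ux).
  transitivity ((row l (nabla G v x) *m G x) 0 k); first by rewrite -row_mul [RHS]mxE.
  rewrite row_nabla.
  have -> : \sum_m (v x *m G x) 0 m * gamma G l x k m = (v x *m G x *m (gamma G l x)^T) 0 k.
    by rewrite [RHS]mxE; apply: eq_bigr => m _; rewrite [(gamma G l x)^T _ _]mxE.
  mx_expand; mx_atoms; rewrite !mxE; ring.
apply/matrixP => l k; rewrite mxE !E (partialC l k oU sf Ux); congr (_ - _).
by apply: eq_bigr => m _; rewrite (gammaC k l m oU mG Ux).
Qed.

(** The Ricci identity for [B]: the metrisability equation is differentiated once more and
    antisymmetrised in l and k. *)
Lemma projective_integrability U G (B : 'rV[R]_n -> 'M[R]_n) (v : 'rV[R]_n -> 'rV[R]_n)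
    x l k : open U -> metric_on U G -> smooth_mx U B -> smooth_mx U v ->
  (forall y, U y -> forall i, partial_mx i B y =
     (v y)^T *m delta_mx 0 i + (delta_mx 0 i)^T *m v y
     - (gamma G i y)^T *m B y - B y *m gamma G i y) -> U x ->
  let N := nabla G v x in
  (curvature G x l k)^T *m B x + B x *m curvature G x l k =
  (row l N)^T *m delta_mx 0 k + (delta_mx 0 k)^T *m row l N
  - (row k N)^T *m delta_mx 0 l - (delta_mx 0 l)^T *m row k N.
Proof.
move=> oU mG sB sv dBE Ux N.
have dB := smooth_mx_differentiable sB Ux.
have dv := smooth_mx_differentiable sv Ux.
have dg i := smooth_mx_differentiable (smooth_gamma i oU mG) Ux.
have dc m p (A : 'M[R]_(m, p)) : differentiable_mx (fun=> A) x.
  by move=> a b; exact: differentiable_cst.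
have dT m p (X : 'rV[R]_n -> 'M[R]_(m, p)) : differentiable_mx X x ->
    differentiable_mx (fun y => (X y)^T) x.
  by move=> dX a b; under eq_fun do rewrite mxE; exact: dX.
have dM m p q (X : 'rV[R]_n -> 'M[R]_(m, p)) (Y : 'rV[R]_n -> 'M[R]_(p, q)) :
    differentiable_mx X x -> differentiable_mx Y x ->
    differentiable_mx (fun y => X y *m Y y) x.
  move=> dX dY a b; under eq_fun do rewrite mxE.
  have [|] := @partial_sum R n _ (index_enum 'I_p) xpredT (fun j y => X y a j * Y y j b) x l.
    by move=> j; apply: differentiableM; [exact: dX|exact: dY].
  by [].
have dD m p (X Y : 'rV[R]_n -> 'M[R]_(m, p)) :
    differentiable_mx X x -> differentiable_mx Y x ->
    differentiable_mx (fun y => X y + Y y) x.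
  by move=> dX dY a b; under eq_fun do rewrite mxE; apply: differentiableD; [exact: dX|exact: dY].
have dN m p (X : 'rV[R]_n -> 'M[R]_(m, p)) :
    differentiable_mx X x -> differentiable_mx (fun y => - X y) x.
  by move=> dX a b; under eq_fun do rewrite mxE; apply: differentiableN; exact: dX.
have E i j : partial_mx i (partial_mx j B) x =
   (partial_mx i v x)^T *m delta_mx 0 j + (delta_mx 0 j)^T *m partial_mx i v x
   - ((partial_mx i (gamma G j) x)^T *m B x + (gamma G j x)^T *m partial_mx i B x)
   - (partial_mx i B x *m gamma G j x + B x *m partial_mx i (gamma G j) x).
  rewrite (partial_mx_eq i oU Ux (fun y Uy => dBE y Uy j)).
  rewrite !(partial_mxD, partial_mxN, partial_mxM, partial_mxT, partial_mx_cst); auto.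
  by rewrite !(mulmx0, mul0mx, add0r, addr0).
(* Vanishing torsion: it removes the terms in which [v] meets a Christoffel symbol contracted with a
   basis vector. *)
have DD := delta_gammaC l k oU mG Ux.
have := partial_mxC l k oU sB Ux.
rewrite !E !(dBE x Ux) /N !row_nabla /curvature.
have D1 : (gamma G l x)^T *m (delta_mx 0 k)^T = (gamma G k x)^T *m (delta_mx 0 l)^T :> 'cV_n.
  by rewrite -!trmx_mul DD.
have D3 : (v x)^T *m (delta_mx 0 k *m gamma G l x) = (v x)^T *m (delta_mx 0 l *m gamma G k x).
  by rewrite DD.
have D4 : (gamma G l x)^T *m (delta_mx 0 k)^T *m v x = (gamma G k x)^T *m (delta_mx 0 l)^T *m v x.
  by rewrite D1.
rewrite !mulmxA in D3; move: D3 D4.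
mx_expand; mx_atoms => /matrixP D3 /matrixP D4 /matrixP EE; apply/matrixP => a b.
by move: (D3 a b) (D4 a b) (EE a b); rewrite !mxE; lra.
Qed.

(** The Ricci identity for a field with nabla v = mu Id, where only the derivatives of [mu]
    survive. *)
Lemma vector_integrability U G (v : 'rV[R]_n -> 'rV[R]_n) (mu : 'rV[R]_n -> R) x i j :
  open U -> metric_on U G ->
  smooth_mx U v -> smooth_on U mu ->
  (forall y, U y -> forall k, partial_mx k v y = mu y *: delta_mx 0 k - v y *m gamma G k y) ->
  U x ->
  v x *m curvature G x i j = partial i mu x *: delta_mx 0 j - partial j mu x *: delta_mx 0 i.
Proof.
move=> oU mG sv smu dvE Ux.
have dv := smooth_mx_differentiable sv Ux.
have dg k := smooth_mx_differentiable (smooth_gamma k oU mG) Ux.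
have dmu := smooth_differentiable smu Ux.
have dc (A : 'rV[R]_n) : differentiable_mx (fun=> A) x.
  by move=> a b; exact: differentiable_cst.
have E k l : partial_mx k (partial_mx l v) x = partial k mu x *: delta_mx 0 l
   - (partial_mx k v x *m gamma G l x + v x *m partial_mx k (gamma G l) x).
  rewrite (partial_mx_eq k oU Ux (fun y Uy => dvE y Uy l)).
  rewrite partial_mxD; first last.
  - by apply: smooth_mx_differentiable Ux; apply: smooth_mxN => //; apply: smooth_mxM => //;
      exact: smooth_gamma.
  - by apply: smooth_mx_differentiable Ux; apply: smooth_mxZ => //; exact: smooth_mx_cst.
  rewrite partial_mxN; last first.
    by apply: smooth_mx_differentiable Ux; apply: smooth_mxM => //; exact: smooth_gamma.
  rewrite (partial_mxZ k dmu (dc _)) partial_mx_cst scaler0 addr0.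
  by rewrite (partial_mxM k dv (dg l)).
have DD := delta_gammaC i j oU mG Ux.
have := partial_mxC i j oU sv Ux.
rewrite !E !(dvE x Ux) /curvature !mulmxDl -!scalemxAl DD.
mx_expand; mx_atoms => /matrixP EE; apply/matrixP => a b.
by move: (EE a b); rewrite !mxE; lra.
Qed.

End KahlerLocal.

Section KahlerConcircular.
Context {R : realType} {n : nat}.
Implicit Types (U : set 'rV[R]_n) (x : 'rV[R]_n) (G H : 'rV[R]_n -> 'M[R]_n).

Lemma orthogonal_skew (G J : 'M[R]_n) : J *m J = - 1%:M -> J *m G *m J^T = G ->
  J *m G = - (G *m J^T).
Proof. by move=> JJ oJ; rewrite -{1}oJ !mulmxA JJ !mulNmx mul1mx. Qed.

(** An endomorphism skew for [G] times one symmetric for [G] has trace 0. Taking N = 1 gives tr J =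
    0. *)
Lemma orthogonal_trace0 (G J N : 'M[R]_n) : G \in unitmx -> G^T = G ->
  J *m J = - 1%:M -> J *m G *m J^T = G -> (N *m G)^T = N *m G -> \tr (J *m N) = 0.
Proof.
move=> uG GT JJ oJ symN; have sk := orthogonal_skew JJ oJ.
have iGT : (invmx G)^T = invmx G by rewrite trmx_inv GT.
have E : \tr (J *m N) = - \tr (J *m N).
  transitivity (\tr (J *m (N *m G *m invmx G))); first by rewrite mulmxK.
  rewrite -mxtrace_tr trmx_mul trmx_mul iGT symN mxtrace_mulC mulmxA.
  have -> : J^T *m invmx G = - (invmx G *m J).
    rewrite -[LHS](mulKmx uG) (mulmxA G) -[G *m J^T]opprK -sk mulNmx mulmxN.
    by rewrite (mulmxK uG).
  by rewrite mulNmx mxtraceN mxtrace_mulC mulmxA (mulmxK uG) mxtrace_mulC.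
by move/eqP: E; rewrite -addr_eq0 -mulr2n mulrn_eq0 /= => /eqP.
Qed.

Definition concircular_factor G (v : 'rV[R]_n -> 'rV[R]_n) y : R := \tr (nabla G v y) / n%:R.

Lemma kahler_concircular U G H (J : 'M[R]_n) : (2 < n)%N -> open U ->
  metric_on U G -> metric_on U H -> projectively_related U G H ->
  J *m J = - 1%:M -> (forall y, U y -> J *m G y *m J^T = G y) ->
  (forall y, U y -> forall i, J *m gamma G i y = gamma G i y *m J) ->
  let v := proj_vector G H in let mu := concircular_factor G v in
  smooth_on U mu /\ forall x, U x -> forall k,
    partial_mx k v x = mu x *: delta_mx 0 k - v x *m gamma G k x /\ partial k mu x = 0.
Proof.
move=> n2 oU mG mH GH JJ oJ JG v mu.
have sv : smooth_mx U v by exact: smooth_proj_vector.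
have sB := smooth_proj_inverse oU mG mH.
have smu : smooth_on U mu.
  apply: smoothM => //; last exact: smooth_cst.
  by apply: smooth_mxtrace => //; exact: smooth_nabla.
have trJ x : U x -> \tr J = 0.
  move=> Ux; have [_ /(_ x Ux)[GT uG]] := mG.
  rewrite -[J]mulmx1; apply: (orthogonal_trace0 uG GT JJ (oJ x Ux)).
  by rewrite mul1mx.
have dvE x : U x -> forall k, partial_mx k v x = mu x *: delta_mx 0 k - v x *m gamma G k x.
  move=> Ux k; have [_ /(_ x Ux)[GT uG]] := mG.
  (* lambda is the gradient of f; the symmetry of its covariant derivative N is what provides tr
     (JN) = 0. *)
  have symN := nabla_sym oU mG sv (smooth_half_trace oU mG mH)
    (fun y Uy i => partial_half_trace i oU mG mH GH Uy) Ux.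
  have trJN := orthogonal_trace0 uG GT JJ (oJ x Ux) symN.
  have S l m := projective_integrability l m oU mG sB sv
    (fun y Uy i => partial_proj_inverse i oU mG mH GH Uy) Ux.
  have NE : nabla G v x = (mu x)%:M.
    apply: (J_invariant_scalar n2 JJ (trJ x Ux) trJN) => l m i j.
    have Sij a b : ((curvature G x a b)^T *m proj_inverse G H x
         + proj_inverse G H x *m curvature G x a b) i j =
        nabla G v x a i * (b == j)%:R + nabla G v x a j * (b == i)%:R
        - nabla G v x b i * (a == j)%:R - nabla G v x b j * (a == i)%:R.
      rewrite S; move: (nabla G v x) => N.
      by rewrite !mxE !big_ord1 !mxE !eqxx /= ![_ == j]eq_sym ![_ == i]eq_sym; ring.
    rewrite -Sij -(curvature_J_invariant l m oU mG Ux (oJ x Ux) JG).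
    under eq_bigr do under eq_bigr do rewrite -Sij mulrA.
    rewrite linear_sum /= mulmx_suml mulmx_sumr -big_split summxE /=.
    apply: eq_bigr => a _.
    rewrite linear_sum /= mulmx_suml mulmx_sumr -big_split summxE /=.
    apply: eq_bigr => b _.
    move: (proj_inverse G H x) => B.
    rewrite linearZ /= -scalemxAl -scalemxAr -scalerDr.
    by rewrite [RHS]mxE.
  have := row_nabla G v x k; rewrite NE => E; apply/esym/eqP.
  rewrite subr_eq -E; apply/eqP/rowP => j; rewrite !mxE eqxx /= [_ == j]eq_sym mulr_natr.
  by [].
split=> // x Ux k; split; first exact: dvE.
move: k; apply: (J_invariant_gradient n2 JJ (trJ x Ux)) => i j k.
have V a b : (v x *m curvature G x a b) 0 k =
   partial a mu x * (b == k)%:R - partial b mu x * (a == k)%:R.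
  rewrite (vector_integrability a b oU mG sv smu dvE Ux) !mxE eqxx /=.
  by rewrite ![_ == k]eq_sym.
rewrite -V -(curvature_J_invariant i j oU mG Ux (oJ x Ux) JG).
under eq_bigr do under eq_bigr do rewrite -V mulrA.
rewrite mulmx_sumr summxE; apply: eq_bigr => a _.
rewrite mulmx_sumr summxE; apply: eq_bigr => b _.
by rewrite -scalemxAr [RHS]mxE.
Qed.

End KahlerConcircular.

(** * Changes of coordinates and geodesics *)

HB.lock Definition jac (R : realType) n (tau : 'rV[R]_n -> 'rV[R]_n) x : 'M[R]_n :=
  jacobian tau x.

Section CoordinateChange.
Context {R : realType} {n : nat}.
Implicit Types (U W : set 'rV[R]_n) (x : 'rV[R]_n) (G : 'rV[R]_n -> 'M[R]_n)
  (tau : 'rV[R]_n -> 'rV[R]_n).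

Lemma jacE tau x : jac tau x = jacobian tau x. Proof. by rewrite unlock. Qed.

Lemma jac_entry tau x i a : differentiable tau x ->
  jac tau x i a = partial i (fun y => tau y 0 a) x.
Proof. by rewrite jacE; exact: jacobian_entry. Qed.

Lemma partial_compE tau (f : 'rV[R]_n -> R) x i :
  differentiable tau x -> differentiable f (tau x) ->
  differentiable (fun y => f (tau y)) x /\
  partial i (fun y => f (tau y)) x = \sum_a jac tau x i a * partial a f (tau x).
Proof. by rewrite jacE; exact: partial_comp. Qed.

Lemma smooth_jacobian W tau : open W -> smooth_on W tau -> smooth_mx W (jac tau).
Proof.
move=> oW st i a; apply: (smooth_eq (f := partial i (fun y => tau y 0 a)) oW).
  by move=> y Wy; rewrite jac_entry//; exact: smooth_differentiable st Wy.
by apply: smooth_partial; exact: smooth_entry.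
Qed.

Lemma partial_jacobianC W tau x i j a : open W -> smooth_on W tau -> W x ->
  partial_mx i (jac tau) x j a = partial_mx j (jac tau) x i a.
Proof.
move=> oW st Wx; rewrite !partial_mxE.
have E k l : partial k (fun y => jac tau y l a) x = partial k (partial l (fun y => tau y 0 a)) x.
  apply: (partial_eq _ oW Wx) => y Wy; rewrite jac_entry//.
  exact: smooth_differentiable st Wy.
by rewrite !E; apply: (partialC _ _ oW (smooth_entry _ _ oW st) Wx).
Qed.

Lemma partial_mx_comp m p tau (X : 'rV[R]_n -> 'M[R]_(m, p)) x i :
  differentiable tau x -> differentiable_mx X (tau x) ->
  differentiable_mx (fun y => X (tau y)) x /\
  partial_mx i (fun y => X (tau y)) x =
  \sum_a jac tau x i a *: partial_mx a X (tau x).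
Proof.
move=> dt dX; split=> [a b|].
  by have [] := partial_compE i dt (dX a b).
apply/matrixP => a b; rewrite partial_mxE summxE.
have [_ ->] := partial_compE i dt (dX a b).
by apply: eq_bigr => k _; rewrite [RHS]mxE partial_mxE.
Qed.

Variables (W U : set 'rV[R]_n) (tau : 'rV[R]_n -> 'rV[R]_n) (G G' : 'rV[R]_n -> 'M[R]_n).
Hypotheses (oW : open W) (oU : open U) (mG : metric_on W G) (mG' : metric_on U G').
Hypotheses (st : smooth_on W tau) (tU : forall x, W x -> U (tau x)).
Hypothesis GE : forall x, W x -> G x = jac tau x *m G' (tau x) *m (jac tau x)^T.

(** Nondegeneracy of [G] forces this through the transformation law, so no inverse of [tau] is
    involved. *)
Lemma jacobian_unit x : W x -> jac tau x \in unitmx.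
Proof.
move=> Wx; have [_ /(_ x Wx)[_]] := mG.
by rewrite GE// !unitmx_mul => /andP[/andP[]].
Qed.

(** The right side, multiplied by the inverse Jacobian, is torsion free by symmetry of the second
    derivatives of [tau] and is metric for the pulled back metric; [gamma_mx_unique] identifies
    it. *)
Lemma gamma_change x i : W x ->
  gamma G i x *m jac tau x =
  jac tau x *m (\sum_a jac tau x i a *: gamma G' a (tau x))
  + partial_mx i (jac tau) x.
Proof.
move=> Wx; have uP := jacobian_unit Wx.
have dt := smooth_differentiable st Wx.
have [sG' /(_ _ (tU Wx))[G'T _]] := mG'.
have dG' := smooth_mx_differentiable sG' (tU Wx).
have dP := smooth_mx_differentiable (smooth_jacobian oW st) Wx.
pose Q i := \sum_a jac tau x i a *: gamma G' a (tau x).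
pose X i := (jac tau x *m Q i + partial_mx i (jac tau) x) *m invmx (jac tau x).
rewrite -/(Q i) -[RHS](mulmxKV uP) -/(X i); congr (_ *m _); apply/esym.
apply: (@gamma_mx_unique R n W G x X oW mG Wx) => {i} [i j|i].
  rewrite !row_mul; congr (_ *m _); apply/rowP => a.
  rewrite ![row _ _ 0 a]mxE [LHS]mxE [RHS]mxE (partial_jacobianC i j a oW st Wx).
  congr (_ + _); rewrite /Q [LHS]mxE [RHS]mxE.
  under eq_bigr do rewrite summxE mulr_sumr.
  under [RHS]eq_bigr do rewrite summxE mulr_sumr.
  rewrite exchange_big; apply: eq_bigr => b _; apply: eq_bigr => c _ /=.
  by rewrite !mxE (gammaC b c a oU mG' (tU Wx)); ring.
have [dGt dGtE] := partial_mx_comp i dt dG'.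
have Qt : partial_mx i (fun y => G' (tau y)) x = Q i *m G' (tau x) + G' (tau x) *m (Q i)^T.
  rewrite dGtE /Q linear_sum mulmx_suml mulmx_sumr -big_split; apply: eq_bigr => a _ /=.
  by rewrite (gamma_metric a oU mG' (tU Wx)) linearZ /= scalerDr scalemxAl scalemxAr.
rewrite (partial_mx_eq i oW Wx GE).
have dPT : differentiable_mx (fun y => (jac tau y)^T) x.
  by move=> a b; under eq_fun do rewrite mxE; exact: dP.
rewrite partial_mxM//; last first.
  move=> a b; under eq_fun do rewrite mxE.
  have [|] := @partial_sum R n _ (index_enum 'I_n) xpredT
     (fun c y => jac tau y a c * G' (tau y) c b) x i; last by [].
  by move=> c; apply: differentiableM; [exact: dP|exact: dGt].
rewrite (partial_mxM i dP dGt) partial_mxT Qt /X (GE Wx).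
have -> : (jac tau x *m Q i + partial_mx i (jac tau) x) *m invmx (jac tau x) *m
     (jac tau x *m G' (tau x) *m (jac tau x)^T) =
   (jac tau x *m Q i + partial_mx i (jac tau) x) *m (G' (tau x) *m (jac tau x)^T).
  by rewrite -!mulmxA (mulKmx uP).
rewrite !trmx_mul trmxK G'T.
mx_linear.
Qed.

End CoordinateChange.

(** * Curves and the geodesic equation under changes of coordinates *)

Section Curves.
Context {R : realType} {n : nat}.
Implicit Types (U W : set 'rV[R]_n) (x : 'rV[R]_n) (G : 'rV[R]_n -> 'M[R]_n)
  (tau : 'rV[R]_n -> 'rV[R]_n) (y : R -> 'rV[R]_n).

Lemma is_derive_mulmx m p q (A : R -> 'M[R]_(m, p)) (B : R -> 'M[R]_(p, q)) (t : R) dA dB :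
  is_derive t 1 A dA -> is_derive t 1 B dB ->
  is_derive t 1 (fun s => A s *m B s) (dA *m B t + A t *m dB).
Proof.
move=> /is_derive_entries hA /is_derive_entries hB; apply/is_derive_entries => i j.
have -> : (fun s => (A s *m B s) i j) = \sum_k (fun s => A s i k * B s k j).
  by apply/funext => s; rewrite fct_sumE mxE.
have -> : (dA *m B t + A t *m dB) i j = \sum_k (A t i k * dB k j + B t k j * dA i k).
  rewrite !mxE -big_split; apply: eq_bigr => k _ /=; ring.
apply: is_derive_sum => k; have := hA i k; have := hB k j => h1 h2.
exact: (@is_deriveM _ _ (fun s => A s i k) (fun s => B s k j)).
Qed.

Lemma is_derive_scalar_comp (z phi : R -> R) (r : R) : derivable phi r 1 ->
  derivable z (phi r) 1 ->
  is_derive r 1 (fun u => z (phi u)) (derive1 phi r * derive1 z (phi r)).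
Proof.
move=> dp dz; apply: DeriveDef.
  apply/derivable1_diffP; apply: (@differentiable_comp _ _ _ _ phi z).
    exact/derivable1_diffP.
  exact/derivable1_diffP.
by rewrite -derive1E mulrC (derive1_comp dp dz).
Qed.

Lemma is_derive_reparam m p (z : R -> 'M[R]_(m, p)) (phi : R -> R) (r : R) :
  derivable phi r 1 -> derivable z (phi r) 1 ->
  is_derive r 1 (fun u => z (phi u)) (derive1 phi r *: derive1 z (phi r)).
Proof.
move=> dp dz; have /derivable_mxP dz' := dz; apply/is_derive_entries => i j.
rewrite mxE.
have -> : derive1 z (phi r) i j = derive1 (fun u => z u i j) (phi r).
  by rewrite !derive1E derive_mx// mxE.
exact: is_derive_scalar_comp dp (dz' i j).
Qed.

Lemma is_derive_curve y (f : 'rV[R]_n -> R) (t : R) : derivable y t 1 ->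
  differentiable f (y t) ->
  is_derive t 1 (fun s => f (y s)) (\sum_i derive1 y t 0 i * partial i f (y t)).
Proof.
move=> /derivable1_diffP dy df.
have dc : differentiable (f \o y) t by exact: differentiable_comp.
apply: DeriveDef; first exact/derivable1_diffP.
rewrite deriveE// (@diff_comp _ _ _ _ y f)//=.
rewrite -derive1E'// diff_row_sum//.
Qed.

Lemma is_derive_derive1 (V : normedModType R) (y : R -> V) (t : R) : derivable y t 1 ->
  is_derive t 1 y (derive1 y t).
Proof. by move=> dy; rewrite derive1E; exact: derivableP. Qed.

Lemma derive1_is_derive (V : normedModType R) (y : R -> V) (t : R) v : is_derive t 1 y v ->
  derivable y t 1 /\ derive1 y t = v.
Proof. by move=> [dy E]; split=> //; rewrite derive1E. Qed.

Lemma curve_comp W tau y (t : R) : open W -> smooth_on W tau -> W (y t) ->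
  (\forall s \near t, derivable y s 1) -> derivable (derive1 y) t 1 ->
  let z := tau \o y in let v := derive1 y t in
  [/\ \forall s \near t, derivable z s 1 /\ derive1 z s = derive1 y s *m jac tau (y s),
    derivable (derive1 z) t 1 &
    derive1 (derive1 z) t = derive1 (derive1 y) t *m jac tau (y t)
      + v *m \sum_i v 0 i *: partial_mx i (jac tau) (y t)].
Proof.
move=> oW st Wy ndy ddy z v.
have cy : {for t, continuous y}.
  exact/differentiable_continuous/derivable1_diffP/(nbhs_singleton ndy).
have nW : \forall s \near t, W (y s) by apply: cy; exact: open_nbhs_nbhs.
have Z : \forall s \near t, derivable z s 1 /\ derive1 z s = derive1 y s *m jac tau (y s).
  apply: filterS2 nW ndy => s Ws dys; apply: derive1_is_derive; apply/is_derive_entries => i j.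
  have dt := smooth_differentiable st Ws.
  have := is_derive_curve dys (differentiable_entry 0 j dt).
  have -> : \sum_k derive1 y s 0 k * partial k (fun x => tau x 0 j) (y s) =
      (derive1 y s *m jac tau (y s)) i j.
    by rewrite ord1 [RHS]mxE; apply: eq_bigr => k _; rewrite jac_entry.
  by rewrite ord1.
have dP : is_derive t 1 (fun s => jac tau (y s)) (\sum_i v 0 i *: partial_mx i (jac tau) (y t)).
  apply/is_derive_entries => i j.
  have := is_derive_curve (nbhs_singleton ndy)
    (smooth_mx_differentiable (smooth_jacobian oW st) Wy i j).
  rewrite summxE; under [X in _ -> is_derive _ _ _ X]eq_bigr do rewrite mxE partial_mxE.
  by [].
have dz : is_derive t 1 (derive1 z) (derive1 (derive1 y) t *m jac tau (y t)
      + v *m \sum_i v 0 i *: partial_mx i (jac tau) (y t)).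
  apply: near_eq_is_derive (is_derive_mulmx (is_derive_derive1 ddy) dP).
  by apply: filterS Z => s [].
by have [d1 d2] := derive1_is_derive dz; split.
Qed.

Definition geodesic_at G y (t : R) : Prop :=
  [/\ derivable y t 1, derivable (derive1 y) t 1 &
    derive1 (derive1 y) t = - quadratic_field (gamma G) (y t) (derive1 y t)].

Lemma quadratic_field_entry G x v k : quadratic_field (gamma G) x v 0 k =
  \sum_i \sum_j christoffel G x i j k * v 0 i * v 0 j.
Proof.
rewrite /quadratic_field summxE; apply: eq_bigr => i _; rewrite mxE [X in _ * X]mxE mulr_sumr.
by apply: eq_bigr => j _; rewrite /gamma gamma_mxE; ring.
Qed.

Lemma geodesic_atP G y (t : R) : geodesic_at G y t <->
  [/\ derivable y t 1, derivable (derive1 y) t 1 &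
    forall k : 'I_n, derive1 (derive1 y) t 0 k
     + \sum_(i < n) \sum_(j < n) christoffel G (y t) i j k * derive1 y t 0 i * derive1 y t 0 j = 0].
Proof.
split=> -[d1 d2 E]; split=> //.
  by move=> k; rewrite -quadratic_field_entry E mxE addNr.
apply/rowP => k; rewrite mxE quadratic_field_entry.
by apply/eqP; rewrite -addr_eq0; apply/eqP.
Qed.

(** The derivative of the Jacobian in the second derivative of the composite cancels the
    inhomogeneous term of [gamma_change]. *)
Lemma geodesic_at_comp W U tau G G' y (t : R) : open W -> open U ->
  metric_on W G -> metric_on U G' -> smooth_on W tau -> (forall x, W x -> U (tau x)) ->
  (forall x, W x -> G x = jac tau x *m G' (tau x) *m (jac tau x)^T) ->
  W (y t) -> (\forall s \near t, derivable y s 1) -> geodesic_at G y t ->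
  geodesic_at G' (tau \o y) t.
Proof.
move=> oW oU mG mG' st tU GE Wy ndy [dy ddy E].
have [nz ddz Ez] := curve_comp oW st Wy ndy ddy.
have [dz z1] := nbhs_singleton nz.
split=> //; rewrite Ez E z1 /=.
set v := derive1 y t; set P := jac tau (y t).
rewrite /quadratic_field mulNmx mulmx_suml.
have -> : \sum_i v 0 i *: (v *m gamma G i (y t)) *m P =
   \sum_i (v 0 i *: (v *m P *m \sum_a P i a *: gamma G' a (tau (y t)))
      + v 0 i *: (v *m partial_mx i (jac tau) (y t))).
  apply: eq_bigr => i _; rewrite -scalemxAl -mulmxA.
  rewrite (gamma_change oW oU mG mG' st tU GE i Wy) mulmxDr scalerDr mulmxA.
  by [].
rewrite big_split /= opprD mulmx_sumr.
have -> : \sum_i v *m (v 0 i *: partial_mx i (jac tau) (y t)) =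
   \sum_i v 0 i *: (v *m partial_mx i (jac tau) (y t)).
  by apply: eq_bigr => i _; rewrite scalemxAr.
rewrite subrK; congr (- _).
under eq_bigr do rewrite mulmx_sumr scaler_sumr.
rewrite exchange_big; apply: eq_bigr => a _ /=.
rewrite [X in X *: _]mxE scaler_suml; apply: eq_bigr => i _.
by rewrite -scalemxAr scalerA.
Qed.

End Curves.

(** * Geodesics on the manifold and their reparametrisations *)

Section Charts.
Context {R : realType} {n : nat} {M : topologicalType}.
Variable A : set (chart R n M).
Hypothesis sA : smooth_structure A.
Implicit Types (c d : chart R n M) (g h J : tensor2 R n M).

Lemma cimg_openE c : open (cimg c). Proof. exact: cimg_open. Qed.

Lemma cinvP c x : cimg c x -> cdom c (cinv c x) /\ cmap c (cinv c x) = x.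
Proof. by move=> [p cp <-]; rewrite cmapK. Qed.

Lemma overlapP c d x : overlap c d x <-> cimg c x /\ cdom d (cinv c x).
Proof.
split=> [[p [cp dp] <-]|[cx dx]]; first by rewrite cmapK//; split=> //; exists p.
by have [cc <-] := cinvP cx; exists (cinv c x).
Qed.

Lemma overlap_open c d : open (overlap c d).
Proof.
rewrite openE => x /overlapP[cx dx].
have n1 : nbhs x (cimg c) by apply: open_nbhs_nbhs; split=> //; exact: cimg_openE.
have n2 : \forall z \near x, cdom d (cinv c z).
  have := @cinv_continuous _ _ _ c x cx; apply; apply: open_nbhs_nbhs; split=> //.
  exact: cdom_open.
by apply: filterS2 n1 n2 => z ? ?; apply/overlapP.
Qed.

Lemma transition_img c d x : overlap c d x -> cimg d (transition c d x).
Proof. by move=> /overlapP[cx dx]; exists (cinv c x). Qed.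

Lemma transition_smooth c d : A c -> A d -> smooth_on (overlap c d) (transition c d).
Proof. by move=> Ac Ad; have [_ /(_ _ _ Ac Ad)[]] := sA. Qed.

Lemma metric_chart g c : pseudo_riemannian_metric A g -> A c -> metric_on (cimg c) (g c).
Proof.
move=> [sg _ mg] Ac; split=> [a b|]; last exact: mg.
by apply: smooth_entry; [exact: cimg_openE|exact: sg].
Qed.

Lemma metric_overlap g c d : pseudo_riemannian_metric A g -> A c ->
  metric_on (overlap c d) (g c).
Proof.
move=> mg Ac; have [sg ug] := metric_chart mg Ac.
have oc : overlap c d `<=` cimg c by move=> x /overlapP[].
split=> [a b|x /oc/ug//] k; have := sg a b k.
elim: k (fun y => g c y a b) => //= k IH f [df pf]; split=> [x /oc/df//|i].
exact: IH.
Qed.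

Lemma metric_covariant g c d x : pseudo_riemannian_metric A g -> A c -> A d -> overlap c d x ->
  g c x = jac (transition c d) x *m g d (transition c d x) *m (jac (transition c d) x)^T.
Proof. by move=> [_ cg _] Ac Ad ox; rewrite jacE; exact: cg. Qed.

(** The equation is solved in the chart [c] alone, whereas a geodesic must satisfy it in every chart
    of the atlas that the curve meets; [geodesic_at_comp] on overlaps bridges the gap. *)
Lemma local_geodesic g c x v : pseudo_riemannian_metric A g -> A c -> cimg c x ->
  exists (e : R) (y : R -> 'rV[R]_n), [/\ 0 < e, y 0 = x, derive1 y 0 = v,
    forall t : R, - e < t < e -> cimg c (y t) /\ geodesic_at (g c) y t &
    geodesic A g `]- e, e[%classic (cinv c \o y)].
Proof.
move=> mg Ac cx; have mc := metric_chart mg Ac.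
have [e [y [w [e0 y0 w0 yP]]]] := second_order_ode v (cimg_openE (c := c))
  (fun i => smooth_gamma i (cimg_openE (c := c)) mc) cx.
have nI (t : R) : - e < t < e -> \forall s \near t, - e < s < e.
  by move=> te; near=> s; near: s; apply: near_in_itvoo; rewrite in_itv.
have geo (t : R) : - e < t < e -> cimg c (y t) /\ geodesic_at (g c) y t.
  move=> te; have [cy /derive1_is_derive[dy yw] dw] := yP t te; split; first exact: cy.
  have [d1 d2] : derivable (derive1 y) t 1 /\
      derive1 (derive1 y) t = - quadratic_field (gamma (g c)) (y t) (w t).
    apply: derive1_is_derive; apply: near_eq_is_derive dw.
    by apply: filterS (nI t te) => s /yP[_ /derive1_is_derive[_ ->]].
  by split=> //; rewrite yw.
have ndy (t : R) : - e < t < e -> \forall s \near t, derivable y s 1.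
  by move=> te; apply: filterS (nI t te) => s /geo[_ []].
have z0 : - e < 0 < e by rewrite oppr_lt0 e0.
exists e, y; split => //.
  by have [_ /derive1_is_derive[_ ->] _] := yP 0 z0.
move=> t /=; rewrite in_itv /= => te; have [cy gy] := geo t te; split.
  apply: (@continuous_comp _ _ _ y (cinv c)); last exact: cinv_continuous cy.
  exact/differentiable_continuous/derivable1_diffP/(nbhs_singleton (ndy t te)).
move=> d Ad dt; apply/geodesic_atP.
have oy : overlap c d (y t) by apply/overlapP.
apply: (@geodesic_at_comp R n (overlap c d) (cimg d) (transition c d) (g c) (g d) y t).
- exact: overlap_open.
- exact: cimg_openE.
- exact: metric_overlap mg Ac.
- exact: metric_chart mg Ad.
- exact: transition_smooth Ac Ad.
- by move=> z; exact: transition_img.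
- by move=> z oz; exact: metric_covariant mg Ac Ad oz.
- exact: oy.
- exact: ndy te.
- exact: gy.
Unshelve. all: by end_near. Qed.

(** The second derivative of the reparametrised curve is phi'' y' + phi'^2 y''. Inserting both
    geodesic equations and dividing by phi'^2 leaves the multiple -phi'' / phi'^2 of y'. *)
Lemma reparametrised_geodesic G H (y : R -> 'rV[R]_n) (phi : R -> R) (s : R) :
  (\forall r \near s, derivable phi r 1) -> derivable (derive1 phi) s 1 -> derive1 phi s != 0 ->
  (\forall r \near s, derivable y (phi r) 1) -> geodesic_at G y (phi s) ->
  geodesic_at H (y \o phi) s ->
  exists rho, quadratic_field (gamma H) (y (phi s)) (derive1 y (phi s))
    = quadratic_field (gamma G) (y (phi s)) (derive1 y (phi s)) + rho *: derive1 y (phi s).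
Proof.
move=> ndp ddp p0 ndy [dy ddy Ey] [_ _ Ez].
have dp := nbhs_singleton ndp.
have nz : \forall r \near s, derive1 (y \o phi) r = derive1 phi r *: derive1 y (phi r).
  by apply: filterS2 ndp ndy => r d1 d2; have [] := derive1_is_derive (is_derive_reparam d1 d2).
have d2 : is_derive s 1 (derive1 (y \o phi)) (derive1 (derive1 phi) s *: derive1 y (phi s)
     + derive1 phi s *: (derive1 phi s *: derive1 (derive1 y) (phi s))).
  have /is_derive_entries h2 := is_derive_reparam dp ddy.
  have h1 := is_derive_derive1 ddp.
  have : is_derive s 1 (fun r => derive1 phi r *: derive1 y (phi r))
     (derive1 (derive1 phi) s *: derive1 y (phi s)
     + derive1 phi s *: (derive1 phi s *: derive1 (derive1 y) (phi s))).
    apply/is_derive_entries => i j.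
    have -> : (fun r => (derive1 phi r *: derive1 y (phi r)) i j) =
        (derive1 phi : R -> R) * (fun r => (derive1 y \o phi) r i j).
      by apply/funext => r; rewrite mxE.
    apply: is_derive_eq (is_deriveM h1 (h2 i j)) _.
    by rewrite !mxE /GRing.scale /=; ring.
  by apply: near_eq_is_derive; apply: filterS nz => r ->.
have [_ E2] := derive1_is_derive d2.
have E1 := nbhs_singleton nz.
rewrite E2 Ey E1 /= in Ez.
set v := derive1 y (phi s) in Ez *; set p := derive1 phi s in p0 Ez.
set q := derive1 _ s in Ez.
have hom F (a : R) (w : 'rV[R]_n) : quadratic_field F (y (phi s)) (a *: w) =
    a *: (a *: quadratic_field F (y (phi s)) w).
  rewrite /quadratic_field !scaler_sumr; apply: eq_bigr => i _.
  by rewrite mxE -scalemxAl !scalerA; congr (_ *: _); ring.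
rewrite hom in Ez.
exists (- (q / p / p)).
move: Ez; move: (quadratic_field _ _ _) (quadratic_field _ _ _) => A1 A2 Ez.
apply/rowP => k; move/rowP/(_ k): Ez; rewrite !mxE.
move: (A1 0 k) (A2 0 k) (v 0 k) => a1 a2 vk E.
have -> : a1 = - (q * vk + p * (p * - a2)) / p / p by rewrite E; field.
by field.
Qed.

End Charts.

(** * Local to global *)

Section LocalAnalysis.
Context {R : realType} {n : nat}.
Implicit Types (U : set 'rV[R]_n) (x : 'rV[R]_n) (G : 'rV[R]_n -> 'M[R]_n)
  (f : 'rV[R]_n -> R).

Lemma open_ball U x : open U -> U x -> exists2 r : R, 0 < r & forall y, ball x r y -> U y.
Proof.
move=> oU Ux; have /nbhs_ballP[r r0 Br] : nbhs x U by exact: open_nbhs_nbhs.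
by exists r.
Qed.

Lemma partial0_locally_constant U f x : open U -> U x ->
  (forall y, U y -> differentiable f y /\ forall i, partial i f y = 0) ->
  \forall y \near x, f y = f x.
Proof.
move=> oU Ux H; have [r r0 Br] := open_ball oU Ux.
apply/nbhs_ballP; exists r => // y xy /=; apply/eqP; rewrite -subr_eq0 -normr_le0.
have xx : ball x r x by exact: ballxx.
rewrite (le_trans (@mean_value_ball R n f x r 0 (lexx _) _ x y xx xy))//.
  by move=> z /Br/H[dz pz]; split=> // i; rewrite pz normr0.
Qed.

Lemma partial_local_max U f x i : open U -> U x -> (forall y, U y -> differentiable f y) ->
  (forall y, U y -> f y <= f x) -> partial i f x = 0.
Proof.
move=> oU Ux df fx; have [r r0 Br] := open_ball oU Ux.
have inU (s : R) : - r < s < r -> U (x + s *: delta_mx 0 i).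
  move=> sr; apply: Br; rewrite -ball_normE /= opprD addNKr normrN normrZ.
  rewrite (le_lt_trans (_ : _ <= `|s| * 1)) ?ler_wpM2l ?norm_delta_mx// mulr1.
  by rewrite ltr_norml.
have z0 : x + 0 *: delta_mx 0 i = x by rewrite scale0r addr0.
have I0 : - r < 0 < r by rewrite oppr_lt0 r0.
have D (s : R) : - r < s < r -> is_derive s 1 (fun t : R => f (x + t *: delta_mx 0 i))
    ('D_(delta_mx 0 i) f (x + s *: delta_mx 0 i)).
  by move=> sr; apply: is_derive_line; apply: df; exact: inU.
have rr : - r <= r by rewrite (le_trans _ (ltW r0))// oppr_le0 ltW.
have := @derive1_at_max R (fun t : R => f (x + t *: delta_mx 0 i)) (- r) r 0 rr.
move=> /(_ _ _ _)/wrap[].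
- by move=> s; rewrite in_itv /= => /D[].
- by rewrite in_itv.
- by move=> s; rewrite in_itv /= z0 => /inU/fx.
move=> [_ E]; have [_] := D 0 I0; rewrite E z0 => E0.
by rewrite -[LHS]/('D_(delta_mx 0 i) f x) -E0.
Qed.

Lemma partial_local_min U f x i : open U -> U x -> (forall y, U y -> differentiable f y) ->
  (forall y, U y -> f x <= f y) -> partial i f x = 0.
Proof.
move=> oU Ux df fx; apply: oppr_inj; rewrite oppr0 -(partialN i (df x Ux)).
apply: (@partial_local_max U _ x i oU Ux) => y Uy; first exact/differentiableN/df.
by rewrite lerN2; exact: fx.
Qed.

(* On a small ball of radius r, sup |v| <= n^2 C r sup |v| <= (sup |v|) / 2. *)
Lemma parallel_vanishing U G (v : 'rV[R]_n -> 'rV[R]_n) x : open U -> metric_on U G ->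
  smooth_mx U v -> U x ->
  (forall y, U y -> forall k, partial_mx k v y = - (v y *m gamma G k y)) -> v x = 0 ->
  \forall y \near x, v y = 0.
Proof.
move=> oU mG sv Ux pv vx.
have bnd (f : 'rV[R]_n -> R) : smooth_on U f -> \forall y \near x, `|f y| <= `|f x| + 1.
  move=> sf; have cf := differentiable_continuous (smooth_differentiable sf Ux).
  have /cvgrPdist_lt/(_ _ ltr01) := cf; apply: filterS => y yx.
  by have := lerB_dist (f y) (f x); rewrite distrC; lra.
pose g (k : 'I_n * 'I_n * 'I_n) y := gamma G k.1.1 y k.1.2 k.2.
pose C : R := \sum_k (`|g k x| + 1).
have C0 : 0 <= C by apply: sumr_ge0 => k _; rewrite addr_ge0.
have gC k : `|g k x| + 1 <= C.
  rewrite /C (bigD1 k)//= lerDl; apply: sumr_ge0 => ? _; exact: addr_ge0.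
have nC : \forall y \near x, forall k, `|g k y| <= C.
  have nk k : \forall y \near x, `|g k y| <= C; last exact: filter_forall nk.
  apply: filterS (bnd _ (smooth_gamma k.1.1 oU mG k.1.2 k.2)) => y h.
  exact: le_trans h (gC k).
have nS : \forall y \near x, forall j, `|v y 0 j| <= 1.
  have nj j : \forall y \near x, `|v y 0 j| <= 1; last exact: filter_forall nj.
  by have := bnd _ (sv 0 j); rewrite vx mxE normr0 add0r.
have nU : \forall y \near x, U y by exact: open_nbhs_nbhs.
have /nbhs_ballP[r1 r10 H] : \forall y \near x, [/\ U y,
    forall k, `|g k y| <= C &
    forall j, `|v y 0 j| <= 1] by apply: filterS3 nU nC nS => y.
pose D := n%:R * (n%:R * C).
have D0 : 0 <= D by rewrite !mulr_ge0.
pose r := Num.min r1 (2 * (D + 1))^-1.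
have r0 : 0 < r by rewrite lt_min; apply/andP; split=> //; rewrite invr_gt0 mulr_gt0// ltr_wpDl.
have rr1 : r <= r1 by rewrite ge_min lexx.
have rD : D * r <= 2^-1.
  apply: (@le_trans _ _ (D * (2 * (D + 1))^-1)); first by rewrite ler_wpM2l// ge_min lexx orbT.
  by rewrite invfM mulrCA ger_pMr// ler_pdivrMr ?ltr_wpDl// mul1r lerDl.
have sub y : ball x r y -> ball x r1 y by exact: le_ball.
have xx : ball x r x by exact: ballxx.
have step k : forall y, ball x r y -> forall j, `|v y 0 j| <= 1 / 2 ^+ k.
  elim: k => [|k IH] y xy j; first by rewrite expr0 divr1; have [_ _] := H y (sub y xy).
  have s0 : 0 <= 1 / 2 ^+ k :> R by rewrite divr_ge0// exprn_ge0.
  have := @mean_value_ball R n (fun y => v y 0 j) x r (n%:R * (C * (1 / 2 ^+ k))).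
  move=> /(_ _ _ x y xx xy)/wrap[||]; first by rewrite !mulr_ge0.
    move=> z xz; have [Uz Cz _] := H z (sub z xz); split.
      exact: smooth_differentiable (sv 0 j) Uz.
    move=> i; rewrite -partial_mxE pv// mxE normrN mxE (le_trans (ler_norm_sum _ _ _))//.
    rewrite -[X in X%:R]card_ord mulr_natl -sumr_const; apply: ler_sum => l _.
    by rewrite normrM mulrC ler_pM//; [exact: (Cz (i, l, j))|exact: IH].
  rewrite vx [X in _ - X]mxE subr0 => h; apply: (le_trans h).
  have yx : `|y - x| <= r by rewrite distrC ltW//; move: xy; rewrite -ball_normE.
  apply: (@le_trans _ _ (n%:R * (n%:R * (C * (1 / 2 ^+ k))) * r)).
    by rewrite ler_wpM2l// !mulr_ge0.
  have -> : n%:R * (n%:R * (C * (1 / 2 ^+ k))) * r = D * r * (1 / 2 ^+ k) by rewrite /D; ring.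
  have -> : 1 / 2 ^+ k.+1 = 2^-1 * (1 / 2 ^+ k) :> R by rewrite exprS invfM mulrCA.
  by rewrite ler_wpM2r.
apply/nbhs_ballP; exists r => // y xy; apply/rowP => j; rewrite mxE.
apply/eqP; rewrite -normr_eq0; apply/eqP.
by apply: (@le_geometric_eq0 R _ 1) => // k; exact: step.
Qed.

End LocalAnalysis.

Lemma locally_constant_connected (M : topologicalType) (T : Type) (m : M -> T) :
  connected [set: M] -> (forall p, \forall q \near p, m q = m p) -> forall p q, m p = m q.
Proof.
move=> cM lm p q.
have op (P : T -> Prop) : open [set z | P (m z)].
  rewrite openE => z /= Pz; apply: filterS (lm z) => w /= ->; exact: Pz.
have /(_ [set z | m z = m p]) := cM.
move=> /(_ _ _ _)/wrap[|||E].
- by exists p.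
- exists [set z | m z = m p]; last by rewrite setTI.
  exact: (op (fun a => a = m p)).
- exists [set z | m z = m p]; last by rewrite setTI.
  rewrite -[X in closed X]setCK closedC.
  exact: (op (fun a => a <> m p)).
by have : [set: M] q by []; rewrite -E.
Qed.

(** Here local constancy is known only at points of the level set, which makes the level set open;
    that it is closed has to be assumed separately. *)
Lemma level_set_connected (M : topologicalType) (T : Type) (m : M -> T) (p : M) :
  connected [set: M] -> open [set q | m q <> m p] ->
  (forall q, m q = m p -> \forall r \near q, m r = m q) -> forall q, m q = m p.
Proof.
move=> cM oC lm q.
suff E : [set z | m z = m p] = [set: M] by have : [set: M] q by []; rewrite -E.
apply: cM; first by exists p.
- exists [set z | m z = m p]; last by rewrite setTI.
  by rewrite openE => z /= zp; apply: filterS (lm z zp) => w /= ->.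
- exists [set z | m z = m p]; last by rewrite setTI.
  by rewrite -[X in closed X]setCK closedC.
Qed.

(** * Objects attached to a projective pair and their transformation laws *)

Section ProjectiveCharts.
Context {R : realType} {n : nat} {M : topologicalType}.
Variable A : set (chart R n M).
Hypothesis sA : smooth_structure A.
Implicit Types (c d : chart R n M) (g h J : tensor2 R n M).

Lemma near_eq_derive1 (V : normedModType R) (O : set R) (y z : R -> V) s : open O -> O s ->
  (forall r, O r -> y r = z r) -> derivable y s 1 ->
  derivable z s 1 /\ derive1 z s = derive1 y s.
Proof.
move=> oO Os yz dy; apply: derive1_is_derive.
apply: near_eq_is_derive (is_derive_derive1 dy).
by apply: filterS yz _; exact: open_nbhs_nbhs.
Qed.

Lemma geodesic_at_eq G (O : set R) (y z : R -> 'rV[R]_n) s : open O -> O s ->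
  (forall r, O r -> y r = z r) -> (forall r, O r -> derivable y r 1) ->
  geodesic_at G y s -> geodesic_at G z s.
Proof.
move=> oO Os yz dO [dy ddy E].
have [dz z1] := near_eq_derive1 oO Os yz dy.
have yz1 r : O r -> derive1 y r = derive1 z r.
  by move=> Or; have [_ ->] := near_eq_derive1 oO Or yz (dO r Or).
have [ddz z2] := near_eq_derive1 oO Os yz1 ddy.
by split; [exact: dz|exact: ddz|rewrite z2 E z1 yz].
Qed.

Lemma projectively_related_chart g h c : pseudo_riemannian_metric A g ->
  pseudo_riemannian_metric A h -> geodesics_reparametrise A g h -> A c ->
  projectively_related (cimg c) (g c) (h c).
Proof.
move=> mg mh gh Ac x cx.
have mgc := metric_chart mg Ac; have mhc := metric_chart mh Ac.
pose T i := gamma (h c) i x - gamma (g c) i x.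
have symT i j : row j (T i) = row i (T j).
  rewrite /T !linearB /= /gamma (gamma_mx_sym i j (cimg_openE (c := c)) mgc cx).
  by rewrite (gamma_mx_sym i j (cimg_openE (c := c)) mhc cx).
have [v|psi E] := weyl_projective symT; last first.
  exists psi => i; rewrite -addrA -(E i) /T addrC subrK; by [].
have [e [y [e0 y0 y1 geo geoM]]] := local_geodesic sA v mg Ac cx.
have oI : open_interval `]- e, e[%classic.
  split; [exact: interval_open|exact: interval_is_interval|].
  by exists 0; rewrite /= in_itv /= oppr_lt0 e0.
have [I' [phi [[oI' _ _] [im dphi p0] geoH]]] := gh _ _ oI geoM.
(* The time 0, at which the geodesic has position x and velocity v, is attained because [phi] maps
   [I'] onto the whole interval. *)
have [s I's phis] : exists2 s, I' s & phi s = 0.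
  have : `]- e, e[%classic (0 : R) by rewrite /= in_itv /= oppr_lt0 e0.
  by rewrite -im => -[s I's ps]; exists s.
have inI r : I' r -> - e < phi r < e.
  move=> I'r; have : (phi @` I') (phi r) by exists r.
  by rewrite im /= in_itv.
have nI' : \forall r \near s, I' r by exact: open_nbhs_nbhs.
have [ccx cmx] := cinvP cx.
have geoz : geodesic_at (h c) (y \o phi) s.
  (* [cmap c \o cinv c] is the identity only on the image of the chart, so [w] is known to agree
     with [y \o phi] on [I'] alone; the geodesic equation is transported by local equality. *)
  pose w := cmap c \o (cinv c \o y \o phi).
  have wE r : I' r -> w r = y (phi r).
    by move=> I'r; have [cy _] := geo _ (inI r I'r); have [] := cinvP cy.
  have W r : I' r -> geodesic_at (h c) w r.
    move=> I'r; have [_ /(_ c Ac)] := geoH r I'r.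
    have [cy _] := geo _ (inI r I'r); have [ccy _] := cinvP cy.
    by move=> /(_ ccy) /geodesic_atP.
  apply: (@geodesic_at_eq (h c) I' w) => //; last exact: W.
  by move=> r /W[].
have np : \forall r \near s, derivable phi r 1.
  by apply: filterS nI' => r I'r; exact: (dphi 0%N r I'r).
have ny : \forall r \near s, derivable y (phi r) 1.
  by apply: filterS nI' => r I'r; have [_ []] := geo _ (inI r I'r).
have [_ gy] := geo _ (inI s I's).
have [rho] := reparametrised_geodesic np (dphi 1%N s I's) (p0 s I's) ny gy geoz.
rewrite phis y0 y1 => E; exists rho.
transitivity (quadratic_field (gamma (h c)) x v - quadratic_field (gamma (g c)) x v).
  rewrite /quadratic_field -sumrB; apply: eq_bigr => i _.
  by rewrite /T mulmxBr scalerBr.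
by rewrite E addrAC subrr add0r.
Qed.

Definition chart_trace g h c x : R := half_trace (g c x) (h c x).

Definition chart_vector g h c : 'rV[R]_n -> 'rV[R]_n := proj_vector (g c) (h c).

Variables (g h : tensor2 R n M).
Hypotheses (mg : pseudo_riemannian_metric A g) (mh : pseudo_riemannian_metric A h).

Lemma chart_trace_change c d x : A c -> A d -> overlap c d x ->
  chart_trace g h c x = chart_trace g h d (transition c d x).
Proof.
move=> Ac Ad ox; have td := transition_img ox.
have [_ /(_ _ td)[_ ugd]] := metric_chart mg Ad.
have [_ /(_ _ td)[_ uhd]] := metric_chart mh Ad.
have [_ /(_ _ ox)[_ ugc]] := metric_overlap d mg Ac.
rewrite /chart_trace (metric_covariant mg Ac Ad ox) (metric_covariant mh Ac Ad ox).
apply: half_trace_covariant => //.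
by move: ugc; rewrite (metric_covariant mg Ac Ad ox) !unitmx_mul => /andP[/andP[]].
Qed.

Lemma jac_unit c d x : A c -> A d -> overlap c d x -> jac (transition c d) x \in unitmx.
Proof.
move=> Ac Ad ox; have [_ /(_ _ ox)[_]] := metric_overlap d mg Ac.
by rewrite (metric_covariant mg Ac Ad ox) !unitmx_mul => /andP[/andP[]].
Qed.

Hypothesis gh : forall c, A c -> projectively_related (cimg c) (g c) (h c).

Local Notation v := (chart_vector g h).

Lemma partial_chart_trace c x i : A c -> cimg c x ->
  partial i (chart_trace g h c) x = (v c x *m g c x) 0 i.
Proof.
move=> Ac cx; apply: partial_half_trace (gh Ac) cx; first exact: cimg_openE.
  exact: metric_chart mg Ac.
exact: metric_chart mh Ac.
Qed.

Lemma smooth_chart_trace c : A c -> smooth_on (cimg c) (chart_trace g h c).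
Proof.
by move=> Ac; apply: smooth_half_trace; [exact: cimg_openE|exact: metric_chart mg Ac|exact: metric_chart mh Ac].
Qed.

(** lambda is the gradient of f, so its law follows from the invariance of f and the law of [g], and
    psi and b need not be transformed. *)
Lemma vector_change c d x : A c -> A d -> overlap c d x ->
  v c x *m jac (transition c d) x = v d (transition c d x).
Proof.
move=> Ac Ad ox; have td := transition_img ox.
have [cx _] := (overlapP _ _ _).1 ox.
have [_ /(_ _ td)[_ ugd]] := metric_chart mg Ad.
have uP := jac_unit Ac Ad ox.
have dt := smooth_differentiable (transition_smooth sA Ac Ad) ox.
have uPT : (jac (transition c d) x)^T \in unitmx by rewrite unitmx_tr.
have E : v c x *m g c x = v d (transition c d x) *m g d (transition c d x)
    *m (jac (transition c d) x)^T.
  apply/rowP => i; rewrite -(partial_chart_trace i Ac cx).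
  have -> : partial i (chart_trace g h c) x =
      partial i (fun y => chart_trace g h d (transition c d y)) x.
    apply: (partial_eq _ (overlap_open (c := c) (d := d)) ox) => y oy.
    exact: chart_trace_change.
  have df := smooth_differentiable (smooth_chart_trace Ad) td.
  have [_ ->] := partial_compE i dt df.
  rewrite mxE; apply: eq_bigr => a _; rewrite (partial_chart_trace a Ad td) mulrC.
  by rewrite [(_)^T _ _]mxE.
move: E; rewrite (metric_covariant mg Ac Ad ox) !mulmxA.
by move=> /(can_inj (mulmxK uPT))/(can_inj (mulmxK ugd)).
Qed.

(** g(lambda, lambda), a quantity without definite sign. *)
Definition chart_norm c x : R := (v c x *m g c x *m (v c x)^T) 0 0.

Lemma chart_norm_change c d x : A c -> A d -> overlap c d x ->
  chart_norm c x = chart_norm d (transition c d x).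
Proof.
move=> Ac Ad ox; rewrite /chart_norm -(vector_change Ac Ad ox).
rewrite [in LHS](metric_covariant mg Ac Ad ox).
by rewrite trmx_mul !mulmxA.
Qed.

Definition concircular_on c (mu : 'rV[R]_n -> R) := smooth_on (cimg c) mu /\
  forall x, cimg c x -> forall k,
  partial_mx k (v c) x = mu x *: delta_mx 0 k - v c x *m gamma (g c) k x /\
  partial k mu x = 0.

Lemma smooth_chart_vector c : A c -> smooth_mx (cimg c) (v c).
Proof.
by move=> Ac; apply: smooth_proj_vector; [exact: cimg_openE|exact: metric_chart mg Ac|exact: metric_chart mh Ac].
Qed.

(** Both factors are read off from the covariant derivative of the same vector field. In one
    coordinate direction k, their difference multiplies row k of the Jacobian, which is nonzero by
    invertibility. *)
Lemma factor_change c d mu nu x : (0 < n)%N -> A c -> A d -> concircular_on c mu ->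
  concircular_on d nu -> overlap c d x -> mu x = nu (transition c d x).
Proof.
move=> n0 Ac Ad [_ cmu] [_ dnu] ox; have td := transition_img ox.
have [cx _] := (overlapP _ _ _).1 ox.
have uP := jac_unit Ac Ad ox.
have st := transition_smooth sA Ac Ad.
have oW := overlap_open (c := c) (d := d).
have dt := smooth_differentiable st ox.
have dvc := smooth_mx_differentiable (smooth_chart_vector Ac) cx.
have dvd := smooth_mx_differentiable (smooth_chart_vector Ad) td.
have dP := smooth_mx_differentiable (smooth_jacobian oW st) ox.
pose k := Ordinal n0.
have := partial_mx_eq k oW ox (fun y oy => vector_change Ac Ad oy).
have [_ ->] := partial_mx_comp k dt dvd.
rewrite (partial_mxM k dvc dP) (cmu x cx k).1.
have -> : \sum_a jac (transition c d) x k a *: partial_mx a (v d) (transition c d x) =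
  nu (transition c d x) *: row k (jac (transition c d) x)
  - v d (transition c d x) *m \sum_a jac (transition c d) x k a *: gamma (g d) a (transition c d x).
  rewrite [row k _]row_sum_delta scaler_sumr mulmx_sumr -sumrN -big_split /=.
  apply: eq_bigr => a _; rewrite (dnu _ td a).1 scalerBr scalemxAr !scalerA mulrC.
  by rewrite [row k _ _ _]mxE.
rewrite mulmxBl -scalemxAl -rowE -[v c x *m _ *m _]mulmxA.
rewrite (gamma_change oW (cimg_openE (c := d)) (metric_overlap d mg Ac) (metric_chart mg Ad) st
  (fun y oy => transition_img oy) (fun y oy => metric_covariant mg Ac Ad oy) k ox).
rewrite mulmxDr opprD addrA subrK mulmxA (vector_change Ac Ad ox).
move=> /(addIr _) E.
have r0 : row k (jac (transition c d) x) != 0.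
  apply/eqP => r0; have : delta_mx 0 k = 0 :> 'rV[R]_n.
    by rewrite -(mulmxK uP (delta_mx 0 k)) -rowE r0 mul0mx.
  by move=> /rowP/(_ k); rewrite !mxE !eqxx => /eqP; rewrite oner_eq0.
by move/eqP: E; rewrite -subr_eq0 -scalerBl scaler_eq0 (negbTE r0) orbF subr_eq0 => /eqP.
Qed.

(** Metric compatibility gives 2 g(nabla_i lambda, lambda) = 2 mu g(e_i, lambda), and g(lambda, .)
    is the differential of f. *)
Lemma partial_chart_norm c mu x i : A c -> concircular_on c mu -> cimg c x ->
  partial i (chart_norm c) x = 2 * mu x * partial i (chart_trace g h c) x.
Proof.
move=> Ac [_ /(_ x) cmu] cx; have {cmu} [Ev _] := cmu cx i.
have oU := cimg_openE (c := c); have mgc := metric_chart mg Ac.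
have [sg /(_ x cx)[GT _]] := mgc.
have sv := smooth_chart_vector Ac.
have dv := smooth_mx_differentiable sv cx; have dG := smooth_mx_differentiable sg cx.
have dvG := smooth_mx_differentiable (smooth_mxM oU sv sg) cx.
have dvT := smooth_mx_differentiable (smooth_mxT sv) cx.
rewrite -partial_mxE (partial_mxM i dvG dvT) (partial_mxM i dv dG) partial_mxT.
rewrite (gamma_metric i oU mgc cx) Ev (partial_chart_trace i Ac cx).
have E1 : ((delta_mx 0 i : 'rV[R]_n) *m g c x *m (v c x)^T) 0 0 = (v c x *m g c x) 0 i.
  have -> : (delta_mx 0 i : 'rV[R]_n) *m g c x *m (v c x)^T = (v c x *m g c x *m (delta_mx 0 i)^T)^T.
    by rewrite !trmx_mul trmxK GT mulmxA.
  by rewrite trmx_delta mxE -colE mxE.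
have E2 : (v c x *m g c x *m (delta_mx 0 i : 'rV[R]_n)^T) 0 0 = (v c x *m g c x) 0 i.
  by rewrite trmx_delta -colE mxE.
move: (v c x) E1 E2 => w E1 E2.
rewrite trmxD trmxN linearZ /= trmx_mul mulmxBl -scalemxAl.
rewrite !mulmxDr !mulmxDl !mulmxN !mulNmx -!scalemxAl -!scalemxAr !mulmxA.
move: E1 E2; mx_atoms => E1 E2; rewrite !mxE E1 E2; ring.
Qed.

End ProjectiveCharts.

(** * From charts to the manifold *)

Section Global.
Context {R : realType} {n : nat} {M : topologicalType}.
Variable A : set (chart R n M).
Hypothesis sA : smooth_structure A.
Implicit Types (c d : chart R n M) (g h J : tensor2 R n M).

Lemma cimg_map c p : cdom c p -> cimg c (cmap c p).
Proof. by move=> cp; exists p. Qed.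

Lemma near_chart c p (P : 'rV[R]_n -> Prop) : cdom c p ->
  (\forall y \near cmap c p, P y) -> \forall q \near p, cdom c q /\ P (cmap c q).
Proof.
move=> cp nP; have n1 : \forall q \near p, cdom c q.
  by apply: open_nbhs_nbhs; split=> //; exact: cdom_open.
have n2 : \forall q \near p, P (cmap c q) by have := cmap_continuous cp; exact.
exact: filterS2 n1 n2 => q.
Qed.

Lemma overlap_point c d p : cdom c p -> cdom d p -> overlap c d (cmap c p).
Proof. by move=> cp dp; exists p. Qed.

Lemma transition_point c d p : cdom c p -> transition c d (cmap c p) = cmap d p.
Proof. by move=> cp; rewrite /transition /= cmapK. Qed.

(** With [J] constant in the chart, nabla J = 0 loses its derivative term and says that [J0]
    commutes with the Christoffel matrices. A point of the domain is needed to read off J0^2 =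
    -1. *)
Lemma kahler_chart g h J c (J0 : 'M[R]_n) : (2 < n)%N -> kahler A g J ->
  pseudo_riemannian_metric A h -> geodesics_reparametrise A g h ->
  A c -> cdom c !=set0 -> (forall x, cimg c x -> J c x = J0) ->
  concircular_on g h c (concircular_factor (g c) (chart_vector g h c)).
Proof.
move=> n2 [mg [[_ _ JJ] _] oJ pJ] mh gh Ac [p cp] J0E.
have mgc := metric_chart mg Ac; have oU := cimg_openE (c := c).
apply: (@kahler_concircular R n (cimg c) (g c) (h c) J0 n2 oU mgc (metric_chart mh Ac)).
- exact: (@projectively_related_chart R n M A sA g h c mg mh gh Ac).
- by have := JJ c Ac _ (cimg_map cp); rewrite J0E//; exact: cimg_map.
- by move=> y cy; have := oJ c Ac y cy; rewrite J0E.
- move=> y cy i; apply/matrixP => j k; have := pJ c Ac y cy i j k.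
  have -> : partial i (fun z => J c z j k) y = 0.
    have -> : partial i (fun z => J c z j k) y = partial i (fun=> J0 j k) y.
      by apply: (partial_eq _ oU cy) => z cz; rewrite J0E.
    exact: partial_cst.
  rewrite add0r J0E// => /eqP; rewrite subr_eq0 => /eqP E.
  rewrite !mxE; transitivity (\sum_l christoffel (g c) y i l k * J0 j l).
    by apply: eq_bigr => l _; rewrite /gamma gamma_mxE mulrC.
  by rewrite E; apply: eq_bigr => l _; rewrite /gamma gamma_mxE.
Qed.

Lemma constant_trace_affine g h c x i j k : pseudo_riemannian_metric A g ->
  pseudo_riemannian_metric A h -> projectively_related (cimg c) (g c) (h c) -> A c ->
  cimg c x -> (forall y, cimg c y -> chart_trace g h c y = chart_trace g h c x) ->
  christoffel (g c) x i j k = christoffel (h c) x i j k.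
Proof.
move=> mg mh gh Ac cx cst_f.
have mgc := metric_chart mg Ac; have mhc := metric_chart mh Ac.
have oU := cimg_openE (c := c).
have [_ /(_ x cx)[_ ugc]] := mgc; have [_ /(_ x cx)[_ uhc]] := mhc.
have v0 : proj_vector (g c) (h c) x = 0.
  rewrite -[LHS](mulmxK ugc); suff -> : proj_vector (g c) (h c) x *m g c x = 0.
    by rewrite mul0mx.
  apply/rowP => l; rewrite -(partial_half_trace l oU mgc mhc gh cx) mxE.
  rewrite (partial_eq (g := fun=> chart_trace g h c x) _ oU cx cst_f).
  exact: partial_cst.
(* lambda = - psi b with b invertible, so lambda = 0 gives psi = 0. *)
have p0 : proj_form (g c) (h c) x = 0.
  have uB : proj_inverse (g c) (h c) x \in unitmx.
    by rewrite /proj_inverse unitmxZ ?unitmx_inv// unitfE gt_eqF// expR_gt0.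
  rewrite -[LHS](mulmxK uB); suff -> : proj_form (g c) (h c) x *m proj_inverse (g c) (h c) x = 0.
    by rewrite mul0mx.
  by apply: oppr_inj; rewrite oppr0; exact: v0.
rewrite -!gamma_mxE -![gamma_mx _ _ _]/(gamma _ _ _) (proj_formP i gh cx) p0.
by rewrite trmx0 mul0mx addr0 mxE [X in X%:M]mxE [X in _ + X]mxE mul0rn addr0.
Qed.

End Global.

Theorem theorem6p3 (R : realType) (n : nat) (M : topologicalType)
    (A : set (chart R n M)) (g J : tensor2 R n M)
    (hn : (2 < n)%N)
    (hM : closed_connected_manifold A)
    (hK : kahler A g J) :
  forall h : tensor2 R n M, projective_class A g h -> affinely_equivalent A g h.
Proof.
move=> h [mh [gh _]] c0 Ac0 x0 cx0 i0 j0 k0.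
have [_ _ conM cptM sA] := hM.
have [mg [_ cxJ] _ _] := hK.
have n0 : (0 < n)%N by exact: ltn_trans hn.
have rel c : A c -> projectively_related (cimg c) (g c) (h c).
  by move=> Ac; exact: (@projectively_related_chart R n M A sA g h c mg mh gh Ac).
pose v := chart_vector g h; pose f := chart_trace g h.
pose mu c := concircular_factor (g c) (v c).
(* At each point a chart in which [J] is constant is fixed; functions on the manifold are then
   defined by reading local expressions in the chosen chart. *)
have [ch chP] : {ch : M -> chart R n M & forall p, [/\ A (ch p), cdom (ch p) p &
    concircular_on g h (ch p) (mu (ch p))]}.
  apply: (@choice _ _ (fun p c => [/\ A c, cdom c p & concircular_on g h c (mu c)])) => p.
  have [c [Ac cp [J0 J0E]]] := cxJ p; exists c; split=> //.
  by apply: (kahler_chart sA hn hK mh gh Ac _ J0E); exists p.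
pose F p := f (ch p) (cmap (ch p) p).
have FE c p : A c -> cdom c p -> F p = f c (cmap c p).
  move=> Ac cp; have [Ap pp _] := chP p.
  rewrite -(transition_point c pp); apply: (chart_trace_change mg mh Ap Ac).
  exact: overlap_point.
have FE' c y : A c -> cimg c y -> f c y = F (cinv c y).
  by move=> Ac cy; have [cc cE] := cinvP cy; rewrite (FE c)// cE.
suff Fcst o1 o2 : F o1 = F o2.
  apply: (constant_trace_affine i0 j0 k0 mg mh (rel c0 Ac0) Ac0 cx0) => y cy.
  by rewrite -/f !FE'//; exact: Fcst.
have cF : continuous F.
  move=> p; have [Ap pp _] := chP p; apply/cvgrPdist_lt => e e0.
  have cf := differentiable_continuous
    (smooth_differentiable (smooth_chart_trace mg mh Ap) (cimg_map pp)).
  have /cvgrPdist_lt/(_ e e0) := cf => /(near_chart pp); apply: filterS => q [pq].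
  by rewrite /F -/(F q) (FE (ch p) q Ap pq).
(* The points to be compared show that the manifold is nonempty, as the extreme value theorem
   requires. *)
have M0 : [set: M] !=set0 by exists o1.
have [pmax _ Fmax] : exists2 pm, pm \in [set: M] & forall t, t \in [set: M] -> F t <= F pm.
  by apply: compact_EVT_max => //; exact: continuous_subspaceT.
have [pmin _ Fmin] : exists2 pm, pm \in [set: M] & forall t, t \in [set: M] -> F pm <= F t.
  by apply: compact_EVT_min => //; exact: continuous_subspaceT.
have {}Fmax t : F t <= F pmax by apply: Fmax; rewrite inE.
have {}Fmin t : F pmin <= F t by apply: Fmin; rewrite inE.
have crit c z : A c -> cdom c z -> (forall i, partial i (f c) (cmap c z) = 0) ->
    v c (cmap c z) = 0.
  move=> Ac cz pz; have [_ /(_ _ (cimg_map cz))[_ ugc]] := metric_chart mg Ac.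
  rewrite -[LHS](mulmxK ugc); suff -> : v c (cmap c z) *m g c (cmap c z) = 0.
    by rewrite mul0mx.
  apply/rowP => i; rewrite [RHS]mxE -(pz i).
  exact: (esym (partial_chart_trace mg mh rel i Ac (cimg_map cz))).
have dfc c y : A c -> cimg c y -> differentiable (f c) y.
  by move=> Ac; exact: smooth_differentiable (smooth_chart_trace mg mh Ac).
have vmax c z : A c -> cdom c z -> F z = F pmax -> v c (cmap c z) = 0.
  move=> Ac cz Fz; apply: crit => // i.
  apply: (@partial_local_max R n (cimg c)); [exact: cimg_openE|exact: cimg_map|by move=> y; exact: dfc|].
  by move=> y cy; rewrite FE'// -(FE c z)// Fz; exact: Fmax.
have vmin c z : A c -> cdom c z -> F z = F pmin -> v c (cmap c z) = 0.
  move=> Ac cz Fz; apply: crit => // i.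
  apply: (@partial_local_min R n (cimg c)); [exact: cimg_openE|exact: cimg_map|by move=> y; exact: dfc|].
  by move=> y cy; rewrite (FE' c y)// -(FE c z)// Fz; exact: Fmin.
(* Whereas [F] may be read in any chart of the atlas, [m] is compared only between charts where
   [concircular_on] is known. *)
pose m p := mu (ch p) (cmap (ch p) p).
have mE c z : A c -> cdom c z -> concircular_on g h c (mu c) -> m z = mu c (cmap c z).
  move=> Ac cz cc; have [Az zz czc] := chP z.
  rewrite -(transition_point c zz).
  by apply: (factor_change sA mg mh rel n0 Az Ac czc cc); exact: overlap_point.
have mcst : forall p q, m p = m q.
  apply: locally_constant_connected => // z.
  have [Az zz [smu cz]] := chP z.
  have := partial0_locally_constant (cimg_openE (c := ch z)) (cimg_map zz)
    (fun y cy => conj (smooth_differentiable smu cy) (fun i => (cz y cy i).2)).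
  move=> /(near_chart zz); apply: filterS => q' [zq E].
  by rewrite (mE (ch z) q')// /m E.
pose a := m o1.
have muE c y : A c -> cimg c y -> concircular_on g h c (mu c) -> mu c y = a.
  move=> Ac cy cc; have [cc' cE] := cinvP cy.
  by rewrite -cE -(mE c)// /a (mcst _ o1).
have [a0|a0] := eqVneq a 0.
  have Fm z : F z = F pmax.
    (* Continuity of [F] makes the set of maxima closed. At a maximum lambda vanishes; being
       parallel it vanishes nearby, so [F] is constant there and the set is open. *)
    apply: (level_set_connected conM) => [|z' Fz'].
      have -> : [set q | F q <> F pmax] = F @^-1` (~` [set F pmax]).
        by apply/seteqP; split.
      apply: open_comp; first by move=> ? _; exact: cF.
      exact/closed_openC/closed_eq.
    have [Az zz cz] := chP z'; have [smu cE] := cz.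
    have oU := cimg_openE (c := ch z'); have mgc := metric_chart mg Az.
    have := @parallel_vanishing R n _ (g (ch z')) (v (ch z')) (cmap (ch z') z') oU mgc
      (smooth_chart_vector mg mh Az) (cimg_map zz).
    move=> /(_ _ (vmax _ _ Az zz Fz'))/wrap[|nv].
      by move=> y cy k; rewrite (cE y cy k).1 muE// a0 scale0r sub0r.
    have /nbhs_ballP[r r0 Br] : \forall y \near cmap (ch z') z', cimg (ch z') y /\ v (ch z') y = 0.
      by apply: filterI => //; apply: open_nbhs_nbhs; split=> //; exact: cimg_map.
    have pB y : ball (cmap (ch z') z') r y -> differentiable (f (ch z')) y /\
        forall i, partial i (f (ch z')) y = 0.
      move=> /Br[cy vy]; split; first exact: dfc.
      move=> i; rewrite (partial_chart_trace mg mh rel i Az cy) -/(v _ _) vy mul0mx mxE.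
      by [].
    have := partial0_locally_constant (ball_open _ _) (ballxx _ r0) pB.
    move=> /(near_chart zz); apply: filterS => q' [zq E].
    by rewrite (FE (ch z') q')// E.
  by rewrite !Fm.
pose Q p := chart_norm g h (ch p) (cmap (ch p) p).
have QE c z : A c -> cdom c z -> Q z = chart_norm g h c (cmap c z).
  move=> Ac cz; have [Az zz _] := chP z.
  rewrite -(transition_point c zz); apply: (chart_norm_change sA mg mh rel Az Ac).
  exact: overlap_point.
have Kcst : forall p q, Q p - 2 * a * F p = Q q - 2 * a * F q.
  apply: (locally_constant_connected (m := fun p => Q p - 2 * a * F p)) => // z.
  have [Az zz cz] := chP z.
  have oU := cimg_openE (c := ch z).
  pose K y := chart_norm g h (ch z) y + - (2 * a) * f (ch z) y.
  have sQ : smooth_on (cimg (ch z)) (chart_norm g h (ch z)).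
    have [sg _] := metric_chart mg Az; have sv := smooth_chart_vector mg mh Az.
    exact: (smooth_mxM oU (smooth_mxM oU sv sg) (smooth_mxT sv)).
  have KP y : cimg (ch z) y -> differentiable K y /\ forall i, partial i K y = 0.
    move=> cy; have dQ := smooth_differentiable sQ cy; have df := dfc _ _ Az cy.
    have dc : differentiable (fun=> - (2 * a) : R) y by exact: differentiable_cst.
    have dcf := differentiableM dc df.
    split; first exact: differentiableD.
    move=> i; rewrite (partialD i dQ dcf) (partialM i dc df) partial_cst mul0r add0r.
    rewrite (partial_chart_norm mg mh rel i Az cz cy) muE// mulNr.
    exact: addrN.
  have := partial0_locally_constant oU (cimg_map zz) KP.
  move=> /(near_chart zz); apply: filterS => q' [zq E].
  have KE q'' : cdom (ch z) q'' -> Q q'' - 2 * a * F q'' = K (cmap (ch z) q'').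
    by move=> zq''; rewrite (QE (ch z))// (FE (ch z))// /K mulNr.
  by rewrite !KE.
have Q0 z : v (ch z) (cmap (ch z) z) = 0 -> Q z = 0.
  by move=> vz; rewrite /Q /chart_norm -/(v _ _) vz !mul0mx mxE.
have FF : F pmax = F pmin.
  (* lambda vanishes at both points, so the constant Q - 2aF equals -2a max F and also -2a min F,
     and a is nonzero. *)
  have [Az zz _] := chP pmax; have [Aw ww _] := chP pmin.
  have := Kcst pmax pmin; rewrite (Q0 _ (vmax _ _ Az zz erefl)) (Q0 _ (vmin _ _ Aw ww erefl)).
  rewrite !sub0r => /oppr_inj; apply: mulfI.
  by rewrite mulf_neq0// pnatr_eq0.
have Fm z : F z = F pmin by apply/eqP; rewrite eq_le Fmin -FF Fmax.
by rewrite !Fm.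
Qed.
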